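(* Let $M$ be a smooth closed Riemannian manifold. Let $K$ be a compact set (with respect to the weak-* topology) in the space of Borel probability measures on $\mathrm{Homeo}(M)$ such that: (1) for every $\mu\in K$, $\mathrm{supp}(\mu)\subset \mathrm{Lip}(M)$; (2) there exist $\alpha>0$ and $C_0$ such that $\int_{\mathrm{Lip}(M)}(\log\mathfrak{L}(f))^\alpha\,d\mu(f)<C_0$ for every $\mu\in K$; (3) for every $\mu\in K$ there are no Borel probability measures $m_1,m_2$ on $M$ such that $f_*m_1=m_2$ for $\mu$-a.e. $f$. Then (with this $\alpha$) there exist $C<\infty$ and $\kappa>1$ such that for any Borel probability measures $\nu_0^{(1)},\nu_0^{(2)}$ on $M$, any $n_1,n_2\in\mathbb{N}$, and any $\mu_1^{(1)},\ldots,\mu_{n_1}^{(1)}\in K$ and $\mu_1^{(2)},\ldots,\mu_{n_2}^{(2)}\in K$, one has $$\iint_{M\times M}\left|\log\left(\max\{d(x,y),r\}\right)\right|^\alpha\,d\nu_1(x)\,d\nu_2(y)<C,$$ where $r=e^{-\kappa^{\min(n_1,n_2)}}$, $\nu_1=\mu_{n_1}^{(1)}*\mu_{n_1-1}^{(1)}*\cdots*\mu_1^{(1)}*\nu_0^{(1)}$ and $\nu_2=\mu_{n_2}^{(2)}*\mu_{n_2-1}^{(2)}*\cdots*\mu_1^{(2)}*\nu_0^{(2)}$.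
   Context: $d$ is the Riemannian distance on $M$. $\mathrm{Homeo}(M)$ is the group of homeomorphisms of $M$ with the topology of uniform convergence; $\mathrm{Lip}(M)\subset \mathrm{Homeo}(M)$ is the set of bi-Lipschitz homeomorphisms, and $\mathfrak{L}(f)=\max\left(\sup_{x\neq y}\frac{d(f(x),f(y))}{d(x,y)},\ \sup_{x\ne y}\frac{d(f^{-1}(x),f^{-1}(y))}{d(x,y)}\right)$. For a probability measure $\mu$ on $\mathrm{Homeo}(M)$ and a Borel probability measure $\nu$ on $M$, $\mu*\nu=\int (f_*\nu)\,d\mu(f)$; iterated expressions are $\mu_n*(\mu_{n-1}*(\cdots*(\mu_1*\nu_0)))$. The weak-* topology on measures on $\mathrm{Homeo}(M)$ is that of convergence against bounded continuous functions. *)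

(* Defs.v *)
From HB Require Import structures.
From mathcomp Require Import all_boot all_order all_algebra.
From mathcomp Require Import all_classical all_reals all_analysis.

Set Implicit Arguments.
Unset Strict Implicit.
Unset Printing Implicit Defensive.

Import Order.TTheory GRing.Theory Num.Theory.
Import numFieldNormedType.Exports.

Local Open Scope classical_set_scope.
Local Open Scope ring_scope.

(* [f] is of class C^k on [A]: the partial derivatives of order at most [k]
   exist and are continuous at the points of [A].  It is only used for open
   [A], where it does not depend on the values of [f] outside [A]. *)
Fixpoint Ck_on (R : realType) (n : nat) (W : normedModType R) (k : nat)
    (A : set 'rV[R]_n) (f : 'rV[R]_n -> W) : Prop :=
  (forall v, A v -> {for v, continuous f}) /\
  match k with
  | 0 => True
  | k'.+1 => forall a : 'I_n,
      (forall v, A v -> derivable f v (delta_mx 0 a)) /\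
      Ck_on k' A (fun v => 'D_(delta_mx 0 a) f v)
  end.

Definition smooth_on (R : realType) (n : nat) (W : normedModType R)
    (A : set 'rV[R]_n) (f : 'rV[R]_n -> W) : Prop :=
  forall k, Ck_on k A f.

(* Charts are total functions; the values of [chart i] outside [dom i] and of
   [chart_inv i] outside the image of [dom i] are irrelevant.  [chart_at x] is
   some chart around [x]; it expresses that the domains cover [M]. *)
Record smooth_atlas (R : realType) (n : nat) (M : topologicalType) :=
  SmoothAtlas {
  chart_index : Type;
  dom : chart_index -> set M;
  chart : chart_index -> M -> 'rV[R]_n;
  chart_inv : chart_index -> 'rV[R]_n -> M;
  chart_at : M -> chart_index;
  mem_chart_at : forall x, dom (chart_at x) x;
  open_dom : forall i, open (dom i);
  open_chart_image : forall i, open (chart i @` dom i);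
  chartK : forall i x, dom i x -> chart_inv i (chart i x) = x;
  chart_continuous : forall i x, dom i x -> {for x, continuous (chart i)};
  chart_inv_continuous : forall i v,
    (chart i @` dom i) v -> {for v, continuous (chart_inv i)};
  transition_smooth : forall i j,
    smooth_on (chart i @` (dom i `&` dom j)) (chart j \o chart_inv i)
}.

Definition bilinear_mx (R : realType) (n : nat) (G : 'M[R]_n)
    (u w : 'rV[R]_n) : R := (u *m G *m w^T) 0 0.

(* [gram i v] is the matrix (g_ab) of the metric in the coordinates of the
   chart [i], at the point with coordinates [v]; [gram_compat] is the
   transformation rule of covariant 2-tensors. *)
Record riemannian_metric (R : realType) (n : nat) (M : topologicalType)
    (A : smooth_atlas R n M) := RiemannianMetric {
  gram : chart_index A -> 'rV[R]_n -> 'M[R]_n;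
  gram_smooth : forall i (a b : 'I_n),
    smooth_on (chart i @` dom i) (fun v => gram i v a b : R);
  gram_sym : forall i v, (chart i @` dom i) v -> (gram i v)^T = gram i v;
  gram_pos : forall i v, (chart i @` dom i) v ->
    forall u, u != 0 -> 0 < bilinear_mx (gram i v) u u;
  gram_compat : forall i j x, dom i x -> dom j x ->
    forall u w : 'rV[R]_n,
      bilinear_mx (gram i (chart i x)) u w =
      bilinear_mx (gram j (chart j x))
        ('D_u (chart j \o chart_inv i) (chart i x))
        ('D_w (chart j \o chart_inv i) (chart i x))
}.

(* Connectedness is part of the definition: it is what makes the Riemannian
   distance finite. *)
Record closed_riemannian_manifold (R : realType) (n : nat) :=
  ClosedRiemannianManifold {
  carrier :> ptopologicalType;
  manifold_hausdorff : hausdorff_space carrier;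
  manifold_second_countable : @second_countable carrier;
  manifold_compact : compact [set: carrier];
  manifold_connected : connected [set: carrier];
  atlas : smooth_atlas R n carrier;
  metric : riemannian_metric atlas
}.

Section distance.
Context (R : realType) (n : nat) (M : closed_riemannian_manifold R n).
Implicit Types (x y : M) (c : R -> M).

Definition velocity (i : chart_index (atlas M)) c (t : R) : 'rV[R]_n :=
  derive1 (chart i \o c) t.

(* [c] is a C^1 curve on a neighbourhood of [0, 1]; its values away from
   [0, 1] are irrelevant. *)
Definition C1_curve c : Prop :=
  forall t : R, 0 <= t <= 1 ->
    {for t, continuous c} /\
    forall i, dom (s := atlas M) i (c t) ->
      (\forall s \near t, derivable (chart i \o c) s 1) /\
      {for t, continuous (velocity i c)}.

(* By [gram_compat], the speed does not depend on the choice of the chart. *)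
Definition speed c (t : R) : R :=
  let i := chart_at (atlas M) (c t) in
  Num.sqrt (bilinear_mx (gram (metric M) i (chart i (c t)))
    (velocity i c t) (velocity i c t)).

Definition curve_length c : R :=
  \int[@lebesgue_measure R]_(t in `[0, 1]) speed c t.

(* The C^1 curves of [s], put end to end, form a piecewise C^1 curve from
   [x] to [y]. *)
Fixpoint piecewise_C1 x (s : seq (R -> M)) y : Prop :=
  match s with
  | [::] => x = y
  | c :: s' => [/\ C1_curve c, c 0 = x & piecewise_C1 (c 1) s' y]
  end.

Definition rdist x y : R :=
  inf [set \sum_(c <- s) curve_length c | s in [set s | piecewise_C1 x s y]].

End distance.

Record homeo (R : realType) (n : nat) (M : closed_riemannian_manifold R n) :=
  Homeo {
  homeo_fun :> M -> M;
  homeo_inv : M -> M;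
  homeoK : cancel homeo_fun homeo_inv;
  homeo_invK : cancel homeo_inv homeo_fun;
  homeo_continuous : continuous homeo_fun;
  homeo_inv_continuous : continuous homeo_inv
}.

Section homeo_topology.
Context (R : realType) (n : nat) (M : closed_riemannian_manifold R n).
Implicit Types (f g : homeo M) (O : set (homeo M)).

Definition homeo_id : homeo M :=
  @Homeo R n M id id (fun=> erefl) (fun=> erefl)
    (fun=> cvg_id) (fun=> cvg_id).

Definition uniform_open O : Prop :=
  forall f, O f -> exists2 e : R, 0 < e &
    forall g, (forall x, rdist (f x) (g x) < e) -> O g.

Let uniform_openT : uniform_open setT.
Proof. by move=> f _; exists 1. Qed.

Let uniform_openI : setI_closed uniform_open.
Proof.
move=> O1 O2 o1 o2 f [/o1[e1 e10 h1] /o2[e2 e20 h2]].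
exists (Num.min e1 e2); first by rewrite lt_min e10.
move=> g fg; split; [apply: h1|apply: h2] => x;
  by have := fg x; rewrite lt_min => /andP[].
Qed.

Let uniform_open_bigU (I : Type) (F : I -> set (homeo M)) :
  (forall i, uniform_open (F i)) -> uniform_open (\bigcup_i F i).
Proof.
move=> oF f [i _ Fif]; have [e e0 h] := oF i f Fif.
by exists e => // g /h Fig; exists i.
Qed.

HB.instance Definition _ := gen_eqMixin (homeo M).
HB.instance Definition _ := gen_choiceMixin (homeo M).
HB.instance Definition _ := isPointed.Build (homeo M) homeo_id.
HB.instance Definition _ := isOpenTopological.Build (homeo M)
  uniform_openT uniform_openI uniform_open_bigU.

End homeo_topology.

Section lipschitz.
Context (R : realType) (n : nat) (M : closed_riemannian_manifold R n).

Definition Lip : set (homeo M) :=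
  [set f : homeo M | exists C : R, forall x y : M,
    rdist (f x) (f y) <= C * rdist x y /\
    rdist (homeo_inv f x) (homeo_inv f y) <= C * rdist x y].

Definition best_lip (f : M -> M) : \bar R :=
  ereal_sup [set (rdist (f p.1) (f p.2) / rdist p.1 p.2)%:E
            | p in [set p : M * M | p.1 <> p.2]].

Definition frakL (f : homeo M) : \bar R :=
  Order.max (best_lip f) (best_lip (homeo_inv f)).

End lipschitz.

Arguments Lip {R n} M.

Definition borel (T : ptopologicalType) := g_sigma_algebraType (@open T).

HB.instance Definition _ (T : ptopologicalType) :=
  Measurable.on (borel T).

Definition borel_prob (T : ptopologicalType) (R : realType) :=
  probability (borel T) R.

Section borel_prob.
Context (T : ptopologicalType) (R : realType).

Definition msupport (mu : borel_prob T R) : set T :=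
  [set x | forall U : set T, open U -> U x -> (0 < mu U)%E].

(* Weak-* topology: the coarsest one for which the integral of every bounded
   continuous function is continuous. *)
HB.instance Definition _ := Choice.on (borel_prob T R).
HB.instance Definition _ := @isSubBaseTopological.Build (borel_prob T R)
  ((T -> R) * set R)%type
  [set p | [/\ continuous p.1, bounded_fun p.1 & open p.2]]
  (fun p => [set mu : borel_prob T R | p.2 (\int[mu]_x p.1 x)]).

End borel_prob.

Section convolution.
Context (R : realType) (n : nat) (M : closed_riemannian_manifold R n).

(* The value on a Borel set [A] of the average of the push-forwards of [nu].
   The result is kept as a set function: that is all integration needs. *)
Definition convol (mu : borel_prob (homeo M) R) (nu : set (borel M) -> \bar R)
    : set (borel M) -> \bar R :=
  fun A => (\int[mu]_f nu ((f : homeo M) @^-1` A))%E.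

(* mu_k * (mu_{k-1} * ( ... * (mu_1 * nu0))) *)
Fixpoint iter_convol (mu : nat -> borel_prob (homeo M) R)
    (nu0 : set (borel M) -> \bar R) (k : nat) : set (borel M) -> \bar R :=
  match k with
  | 0 => nu0
  | j.+1 => convol (mu j.+1) (iter_convol mu nu0 j)
  end.

End convolution.

(* Main.v *)
From HB Require Import structures.
Require Import Defs.
From mathcomp Require Import all_boot all_order all_algebra.
From mathcomp Require Import all_classical all_reals all_analysis.
From mathcomp Require Import measurable_realfun giry ring lra.

(** The logarithmic singularity is replaced by a kernel of positive type.  At
    scale e^-j take a finite net of M and functions F_(j,z), indexed by the
    points z of the net, whose squares form a softmax partition of unity.  With
    w_j = (j+1)^alpha - j^alpha, the kernel
      k_m(x, y) = sum_(j < m) w_j sum_z F_(j,z)(x) F_(j,z)(y)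
    equals |log max(d(x, y), e^-m)|^alpha up to a factor 1 + e and an additive
    constant (the nets having at most exp(n j + B) points), and a bi-Lipschitz f
    changes it by at most e k_m + C (1 + (log L(f))^alpha), uniformly in m.

    The energy E(nu) = sum_j w_j sum_z nu(F_(j,z))^2 is quadratic, so E(mu * nu)
    falls short of the mean of E(f_* nu) by a variance.  If
    E(mu * nu) <= lam E(nu) + C failed for all lam < 1 and C, there would be
    m_k, nu_k and mu_k in K with energies tending to infinity and relative
    variances tending to 0; then the probability densities proportional to the
    potential of nu_k, pushed by f, would be close to one measure for most f.
    In the limit along an ultrafilter f_* m1 = m2 for every f in the support of
    a limit of the mu_k, which lies in K: this is excluded.

    The energy is at most m^alpha initially, so with kappa^alpha lam = 1 and
    m of order kappa^N it is bounded after N steps; the mixed term is at most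
    the mean of the two energies. *)

Import Order.TTheory GRing.Theory Num.Theory.
Import numFieldNormedType.Exports.

Set Implicit Arguments.
Unset Strict Implicit.
Unset Printing Implicit Defensive.

Local Open Scope classical_set_scope.
Local Open Scope ring_scope.

(** * Calculus in coordinates *)

(** The logarithmic kernel is not visibly a sum of squares; the Gram form of k_m is one, and it is
    the only source of the variance. The difficulty is uniformity in m, which grows with N: every
    comparison may lose e E(nu), with e arbitrarily small, plus a constant independent of m, and
    nothing more. Energies tending to infinity then absorb the constants.

    Small variance leads to f_* m1 = m2 through the density U nu, where U is the potential of nu.
    Forming it commutes with f up to the allowed error, because f hardly distorts the kernel. It is
    also close to the atomic measure with mass w_j nu(F_(j,z))^2 at z, because at small scales
    F_(j,z) is concentrated near z, while the large scales cost a constant. This atomic measure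
    knows nu only through the averages of the F_(j,z), so a small variance makes it nearly the same
    for f_* nu and for mu * nu.

    The weights are increments of j^alpha because a pair at distance d is left unseparated by about
    |log d| scales, whose weights then add up to about |log d|^alpha. *)

Section C1_calculus.
Context {R : realType}.

Lemma is_derive_line (V W : normedModType R) (f : V -> W) (x u : V) (t : R) :
  derivable f (t *: u + x) u ->
  is_derive t 1 (fun s => f (s *: u + x)) ('D_u f (t *: u + x)).
Proof.
move=> df.
have E : (fun h : R => h^-1 *: (f ((h *: (1 : R) + t) *: u + x) - f (t *: u + x)))
   = (fun h : R => h^-1 *: (f (h *: u + (t *: u + x)) - f (t *: u + x))).
  by apply/funext => h; rewrite [h *: _]mulr1 scalerDl addrA.
apply: DeriveDef; first by rewrite /derivable /= E.
by rewrite /derive /= E.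
Qed.

Lemma derive_line_MVT (V : normedModType R) (f : V -> R) (x u : V) (s : R) :
  0 <= s -> (forall t, 0 <= t <= s -> derivable f (t *: u + x) u) ->
  exists2 c, 0 <= c <= s & f (s *: u + x) - f x = s * 'D_u f (c *: u + x).
Proof.
move=> s0 df.
have dg t : 0 <= t <= s ->
    is_derive t 1 (fun s => f (s *: u + x)) ('D_u f (t *: u + x)).
  by move=> /df; exact: is_derive_line.
have [||c] := @MVT_segment R (fun s => f (s *: u + x))
   (fun t => 'D_u f (t *: u + x)) 0 s s0.
- by move=> t; rewrite in_itv/= => /andP[/ltW t0 /ltW ts]; apply: dg; rewrite t0.
- apply: derivable_within_continuous => t; rewrite in_itv/= => /dg h.
  exact: ex_derive.
- rewrite in_itv/= => cs; rewrite scale0r add0r subr0 mulrC => ?.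
  by exists c.
Qed.

Lemma mx_norm_le (m n : nat) (A : 'M[R]_(m, n)) (e : R) : 0 <= e ->
  (forall i j, `|A i j| <= e) -> `|A| <= e.
Proof.
move=> e0 h; rewrite [leLHS]/Num.Def.normr/= mx_normrE.
by apply: bigmax_le => // -[i j] _; exact: h.
Qed.

Lemma le_mx_norm (m n : nat) (A : 'M[R]_(m, n)) i j : `|A i j| <= `|A|.
Proof.
rewrite [leRHS]/Num.Def.normr/= mx_normrE.
exact: (le_bigmax _ (fun ij : 'I_m * 'I_n => `|A ij.1 ij.2|) (i, j)).
Qed.

(** The corners of a path from [v] to [w] that moves along one axis at a time. *)
Definition mix (n : nat) (v w : 'rV[R]_n) (k : nat) : 'rV[R]_n :=
  \row_a (if (a < k)%N then w 0 a else v 0 a).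

(** Only partial derivatives are given, so the increment is cut at the corners [mix v w k]. On each
    piece the mean value theorem applies, and the partial derivative is within [e / n.+1%:R] of its
    value at [v]. *)
Lemma C1_estimate (n : nat) (f : 'rV[R]_n -> R) (v : 'rV[R]_n) :
  (forall a : 'I_n, \forall w \near v, derivable f w (delta_mx 0 a)) ->
  (forall a : 'I_n, {for v, continuous (fun w => 'D_(delta_mx 0 a) f w)}) ->
  forall e : R, 0 < e -> \forall w \near v,
   `|f w - f v - \sum_a (w 0 a - v 0 a) * 'D_(delta_mx 0 a) f v|
    <= e * `|w - v|.
Proof.
move=> df cf e e0.
pose e' := e / n.+1%:R.
have e'0 : 0 < e' by rewrite divr_gt0.
have H : \forall w \near v, forall a : 'I_n, derivable f w (delta_mx 0 a) /\
    `|'D_(delta_mx 0 a) f v - 'D_(delta_mx 0 a) f w| <= e'.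
  suff h (a : 'I_n) : \forall w \near v, derivable f w (delta_mx 0 a) /\
      `|'D_(delta_mx 0 a) f v - 'D_(delta_mx 0 a) f w| <= e'.
    exact: (@filter_forall _ _ _ (nbhs v) (nbhs_filter v) h).
  near=> w; split; near: w; first exact: df.
  by have /cvgrPdist_le /(_ _ e'0) := cf a.
move/nbhs_ballP : H => [d /= d0 Hd].
apply/nbhs_ballP; exists d => //= w vw.
have vwd : `|w - v| < d by rewrite -normrN opprB; move: vw; rewrite -ball_normE.
have Hp p : `|p - v| <= `|w - v| -> forall a : 'I_n, derivable f p (delta_mx 0 a) /\
    `|'D_(delta_mx 0 a) f v - 'D_(delta_mx 0 a) f p| <= e'.
  move=> pv; apply: Hd; rewrite -ball_normE/= -normrN opprB.
  exact: le_lt_trans vwd.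
have mixv k i : `|mix v w k 0 i - v 0 i| <= `|w - v|.
  rewrite mxE; case: ifPn => _; last by rewrite subrr normr0.
  by have := le_mx_norm (w - v) 0 i; rewrite !mxE.
have mixS (k : 'I_n) : mix v w k.+1 = (w 0 k - v 0 k) *: delta_mx 0 k + mix v w k.
  apply/rowP => i; rewrite !mxE eqxx /=.
  have [->|ik] := eqVneq i k; first by rewrite ltnSn ltnn mulr1 subrK.
  rewrite mulr0 add0r ltnS leq_eqVlt.
  by rewrite (negbTE (_ : (i : nat) != k)).
have fm : f w - f v = \sum_(k < n) (f (mix v w k.+1) - f (mix v w k)).
  rewrite -(big_mkord xpredT (fun k => f (mix v w k.+1) - f (mix v w k))).
  rewrite telescope_sumr//; congr (f _ - f _); apply/rowP => i; rewrite mxE //.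
  by rewrite ltn_ord.
rewrite fm -sumrB.
apply: (le_trans (ler_norm_sum _ _ _)).
apply: (@le_trans _ _ (\sum_(k < n) e' * `|w - v|)); last first.
  rewrite sumr_const card_ord -mulr_natl mulrA ler_wpM2r// /e'.
  rewrite mulrCA ler_piMr// ?ltW//.
  by rewrite ltr_pdivrMr// mul1r ltr_nat.
apply: ler_sum => k _.
set h := w 0 k - v 0 k.
suff [p pv ->] : exists2 p, `|p - v| <= `|w - v| &
    f (mix v w k.+1) - f (mix v w k) = h * 'D_(delta_mx 0 k) f p.
  rewrite -mulrBr normrM -normrN opprB mulrC.
  have [_ ?] := Hp _ pv k.
  rewrite distrC ler_pM//.
  by have := le_mx_norm (v - w) 0 k; rewrite !mxE distrC.
have between (p : 'rV[R]_n) : (forall i, `|p 0 i - v 0 i| <= `|w - v|) -> `|p - v| <= `|w - v|.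
  by move=> Hi; apply: mx_norm_le => // i j; rewrite ord1 !mxE.
have mid (t : R) : (`|t| <= `|h|) && (0 <= t * h) ->
     `|t *: delta_mx 0 k + mix v w k - v| <= `|w - v|.
  move=> /andP[th th0]; apply: between => i; rewrite !mxE eqxx/=.
  have [->|ik] := eqVneq i k; last first.
    rewrite mulr0 add0r; have := mixv k i; by rewrite mxE.
  rewrite mulr1 ltnn addrK (le_trans th)//.
  by have := le_mx_norm (w - v) 0 k; rewrite !mxE.
have [h0|h0] := leP 0 h.
  have [|c /andP[c0 ch] Ec] := @derive_line_MVT _ f (mix v w k) (delta_mx 0 k) h h0.
    move=> t /andP[t0 th]; apply: (Hp _ (mid _ _) k).1.
    by rewrite !ger0_norm// th mulr_ge0.
  exists (c *: delta_mx 0 k + mix v w k); last by rewrite mixS.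
  by apply: mid; rewrite !ger0_norm// ch mulr_ge0.
(* [derive_line_MVT] runs in the positive direction only, so for a negative increment the segment
   starts from its other end. *)
have h0' : 0 <= - h by rewrite oppr_ge0 ltW.
have Emid t : t *: delta_mx 0 k + mix v w k.+1 = (t + h) *: delta_mx 0 k + mix v w k.
  by rewrite mixS addrA -scalerDl.
have [|c /andP[c0 ch] Ec] := @derive_line_MVT _ f (mix v w k.+1) (delta_mx 0 k) (- h) h0'.
  move=> t /andP[t0 th]; rewrite Emid; apply: (Hp _ (mid _ _) k).1.
  rewrite !ler0_norm//; [|exact: ltW|lra].
  by apply/andP; split; [lra|apply: mulr_le0; lra].
exists (c *: delta_mx 0 k + mix v w k.+1).
  rewrite Emid; apply: mid; rewrite !ler0_norm//; [|exact: ltW|lra].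
  by apply/andP; split; [lra|apply: mulr_le0; lra].
move: Ec; rewrite Emid addNr scale0r add0r => Ec.
by rewrite -opprB Ec mulNr opprK.
Unshelve. all: by end_near. Qed.

Lemma is_derive_C1_curve (n : nat) (f : 'rV[R]_n -> R) (c : R -> 'rV[R]_n) (t : R) :
  (forall a : 'I_n, \forall w \near c t, derivable f w (delta_mx 0 a)) ->
  (forall a : 'I_n, {for c t, continuous (fun w => 'D_(delta_mx 0 a) f w)}) ->
  derivable c t 1 ->
  is_derive t 1 (f \o c) (\sum_a ('D_1 c t) 0 a * 'D_(delta_mx 0 a) f (c t)).
Proof.
move=> df cf dc.
set L := \sum_a _.
suff H : h^-1 *: ((f \o c) (h *: (1:R) + t) - (f \o c) t) @[h --> 0^'] --> L.
  by apply: DeriveDef; [apply/cvg_ex; exists L|exact: cvg_lim].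
pose G (h : R) := h^-1 *: (c (h *: (1:R) + t) - c t).
have GL : G h @[h --> 0^'] --> 'D_1 c t by exact: dc.
pose S (h : R) := \sum_a (G h) 0 a * 'D_(delta_mx 0 a) f (c t).
have SL : S h @[h --> 0^'] --> L.
  apply: (cvg_big add_continuous) => a _; apply: cvgMr_tmp.
  apply: (@cvg_comp _ _ _ G (fun M : 'rV[R]_n => M 0 a) _ (nbhs ('D_1 c t)) _ GL).
  exact: (@coord_continuous R 1 n 0 a ('D_1 c t)).
rewrite -[X in _ --> X]subr0.
(* The quotient is [S h], which tends to [L], minus the remainder of [C1_estimate], which has to
   tend to 0. *)
pose Q (h : R) := S h - (S h - h^-1 *: ((f \o c) (h *: (1:R) + t) - (f \o c) t)).
rewrite (_ : (fun h => _) = Q); last first.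
  by apply/funext => h; rewrite /Q subKr.
apply: cvgB => //.
apply/cvgrPdist_le => e e0.
have cc : {for t, continuous c}.
  by apply: differentiable_continuous; apply/derivable1_diffP.
(* [B] bounds the difference quotients of [c] near [t], so a remainder of [e / B] times the
   displacement is at most [e] after division by [h]. *)
pose B := `|'D_1 c t| + 1.
have B0 : 0 < B by rewrite /B ltr_wpDl.
have e'0 : 0 < e / B by rewrite divr_gt0.
have Est := C1_estimate df cf e'0.
have cth : c (h *: (1:R) + t) @[h --> 0^'] --> c t.
  have : (h *: (1:R) + t) @[h --> 0^'] --> t.
    rewrite -[X in _ --> X]add0r; apply: cvgD; last exact: cvg_cst.
    rewrite -[X in _ --> X](scale0r (1:R)); apply: cvgZr_tmp.
    exact: cvg_within.
  by move=> /cvg_comp; apply.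
near=> h; rewrite sub0r normrN.
have h0 : h != 0 by near: h; exact: nbhs_dnbhs_neq.
have GB : `|G h| <= B.
  have : `|'D_1 c t - G h| <= 1 by near: h; move/cvgrPdist_le : GL => /(_ _ ltr01).
  move=> G1; rewrite -[G h](subrK ('D_1 c t)) (le_trans (ler_normD _ _))//.
  by rewrite addrC /B lerD2l distrC.
have : `|f (c (h *: (1:R) + t)) - f (c t) - \sum_a (c (h *: (1:R) + t) 0 a - c t 0 a) * 'D_(delta_mx 0 a) f (c t)|
    <= (e / B) * `|c (h *: (1:R) + t) - c t|.
  by near: h; exact: (cth _ Est).
set D := f _ - f _; set Sm := \sum_a _ => DS.
have -> : S h = h^-1 * Sm.
  rewrite /S /Sm mulr_sumr; apply: eq_bigr => a _.
  by rewrite /G !mxE mulrA.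
have cG : c (h *: (1:R) + t) - c t = h *: G h by rewrite /G scalerA mulfV// scale1r.
move: DS; rewrite cG normrZ distrC => DS.
rewrite [h^-1 *: _]/(h^-1 * D) -mulrBr normrM normfV.
rewrite ler_pdivrMl ?normr_gt0// (le_trans DS)//.
rewrite mulrCA ler_wpM2l// -[leRHS](divfK (lt0r_neq0 B0)).
by rewrite ler_wpM2l// ltW.
Unshelve. all: by end_near. Qed.

End C1_calculus.

Section C1_vector.
Context {R : realType}.

Lemma C1_derive_dir (n : nat) (f : 'rV[R]_n -> R) (v u : 'rV[R]_n) :
  (forall a : 'I_n, \forall w \near v, derivable f w (delta_mx 0 a)) ->
  (forall a : 'I_n, {for v, continuous (fun w => 'D_(delta_mx 0 a) f w)}) ->
  is_derive v u f (\sum_a u 0 a * 'D_(delta_mx 0 a) f v).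
Proof.
move=> df cf.
pose c (s : R) := s *: u + v.
have c0 : c 0 = v by rewrite /c scale0r add0r.
have dc : is_derive (0 : R) (1 : R) c u.
  have h := @is_derive_line R 'rV[R]_n 'rV[R]_n id v u 0 (@derivable_id _ _ _ _).
  by apply: is_derive_eq; rewrite derive_id.
have [dfc Dfc] : is_derive (0:R) (1:R) (f \o c) (\sum_a ('D_1 c 0) 0 a * 'D_(delta_mx 0 a) f (c 0)).
  by apply: is_derive_C1_curve; rewrite ?c0.
have E : (fun h : R => h^-1 *: ((f \o c) (h *: (1:R) + 0) - (f \o c) 0))
   = (fun h : R => h^-1 *: (f (h *: u + v) - f v)).
  by apply/funext => h; rewrite addr0 [h *: 1]mulr1 /= c0.
apply: DeriveDef.
  by move: dfc; rewrite /derivable E.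
move: Dfc; rewrite /derive E => ->.
by rewrite -/(derive c 0 1) derive_val c0.
Qed.

Variables (n m : nat) (A : set 'rV[R]_n) (f : 'rV[R]_n -> 'rV[R]_m).
Hypotheses (oA : open A) (Cf : Ck_on 1 A f).

Let fb (b : 'I_m) (v : 'rV[R]_n) : R := f v 0 b.

Let dfb (b : 'I_m) v a : A v -> derivable (fb b) v (delta_mx 0 a).
Proof.
by move=> Av; have := (derivable_mxP f v (delta_mx 0 a)).1 ((Cf.2 a).1 v Av); apply.
Qed.

Let Dfb (b : 'I_m) v a : A v ->
  'D_(delta_mx 0 a) (fb b) v = ('D_(delta_mx 0 a) f v) 0 b.
Proof. by move=> Av; rewrite derive_mx ?mxE//; exact: (Cf.2 a).1. Qed.

Let dfbn (b : 'I_m) v a : A v -> \forall w \near v, derivable (fb b) w (delta_mx 0 a).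
Proof.
move=> Av; have : \forall w \near v, A w by exact: open_nbhs_nbhs.
by apply: filterS => w; exact: dfb.
Qed.

Let cfb (b : 'I_m) v a : A v -> {for v, continuous (fun w => 'D_(delta_mx 0 a) (fb b) w)}.
Proof.
move=> Av; rewrite /prop_for /continuous_at Dfb//.
have An : \forall w \near v, A w by exact: open_nbhs_nbhs.
have E : {near v, (fun w => ('D_(delta_mx 0 a) f w) 0 b) =1
    (fun w => 'D_(delta_mx 0 a) (fb b) w)}.
  by move: An; apply: filterS => w Aw; rewrite Dfb.
apply: cvg_trans; first exact: (near_eq_cvg E).
have cv := (Cf.2 a).2.1 v Av.
apply: (@cvg_comp _ _ _ (fun w => 'D_(delta_mx 0 a) f w) (fun M : 'rV[R]_m => M 0 b) _
  (nbhs ('D_(delta_mx 0 a) f v)) _ cv).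
exact: (@coord_continuous R 1 m 0 b ('D_(delta_mx 0 a) f v)).
Qed.

Lemma C1_chain (c : R -> 'rV[R]_n) t : A (c t) -> derivable c t 1 ->
  derivable (f \o c) t 1 /\
  'D_1 (f \o c) t = \sum_a ('D_1 c t) 0 a *: 'D_(delta_mx 0 a) f (c t).
Proof.
move=> Act dc.
have h b := is_derive_C1_curve (fun a => @dfbn b _ a Act) (fun a => @cfb b _ a Act) dc.
have d : derivable (f \o c) t 1.
  by apply/derivable_mxP => i b; rewrite ord1; exact: (@ex_derive _ _ _ _ _ _ _ (h b)).
split=> //; rewrite derive_mx//; apply/rowP => b; rewrite !mxE.
have -> : (fun t0 => (f \o c) t0 0 b) = fb b \o c by [].
rewrite (@derive_val _ _ _ _ _ _ _ (h b)) summxE.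
by apply: eq_bigr => a _; rewrite Dfb// mxE.
Qed.

Lemma C1_dir (v u : 'rV[R]_n) : A v ->
  'D_u f v = \sum_a u 0 a *: 'D_(delta_mx 0 a) f v.
Proof.
move=> Av.
have h b := C1_derive_dir u (fun a => @dfbn b _ a Av) (fun a => @cfb b _ a Av).
have d : derivable f v u.
  by apply/derivable_mxP => i b; rewrite ord1; exact: (@ex_derive _ _ _ _ _ _ _ (h b)).
rewrite derive_mx//; apply/rowP => b; rewrite !mxE.
have -> : (fun t0 => f t0 0 b) = fb b by [].
rewrite (@derive_val _ _ _ _ _ _ _ (h b)) summxE.
by apply: eq_bigr => a _; rewrite Dfb// mxE.
Qed.

Lemma C1_partial_continuous v a : A v -> {for v, continuous (fun w => 'D_(delta_mx 0 a) f w)}.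
Proof. by move=> Av; exact: (Cf.2 a).2.1. Qed.

End C1_vector.

Section bilinear.
Context {R : realType} (n : nat).
Implicit Types (G : 'M[R]_n) (u w : 'rV[R]_n).

Lemma bilinear_mxE G u w :
  bilinear_mx G u w = \sum_a \sum_b u 0 a * G a b * w 0 b.
Proof.
rewrite /bilinear_mx mxE exchange_big/=; apply: eq_bigr => b _.
by rewrite !mxE mulr_suml.
Qed.

Lemma bilinear_mxZ G (k : R) u : bilinear_mx G (k *: u) (k *: u) = k ^+ 2 * bilinear_mx G u u.
Proof.
rewrite !bilinear_mxE mulr_sumr; apply: eq_bigr => a _.
rewrite mulr_sumr; apply: eq_bigr => b _; rewrite !mxE; ring.
Qed.

Lemma bilinear_mxN G u : bilinear_mx G (- u) (- u) = bilinear_mx G u u.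
Proof. by rewrite -(scaleN1r u) bilinear_mxZ sqrrN expr1n mul1r. Qed.

Lemma bilinear_mxB G G' u : bilinear_mx G u u - bilinear_mx G' u u = bilinear_mx (G - G') u u.
Proof.
rewrite !bilinear_mxE -sumrB; apply: eq_bigr => a _.
rewrite -sumrB; apply: eq_bigr => b _; rewrite !mxE; ring.
Qed.

Lemma bilinear_mx_le G u (e : R) : (forall a b, `|G a b| <= e) ->
  `|bilinear_mx G u u| <= n%:R ^+ 2 * e * `|u| ^+ 2.
Proof.
move=> Ge; rewrite bilinear_mxE (le_trans (ler_norm_sum _ _ _))//.
apply: (@le_trans _ _ (\sum_(a < n) \sum_(b < n) e * `|u| ^+ 2)); last first.
  rewrite sumr_const sumr_const card_ord -[leLHS]mulr_natl -[X in _ * X <= _]mulr_natl.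
  by rewrite !mulrA -expr2.
apply: ler_sum => a _; rewrite (le_trans (ler_norm_sum _ _ _))//.
apply: ler_sum => b _.
rewrite !normrM mulrAC mulrC expr2 ler_pM//.
by rewrite ler_pM// le_mx_norm.
Qed.

Lemma bilinear_mx_continuous (T : topologicalType) (G : T -> 'M[R]_n) (u w : T -> 'rV[R]_n) (t : T)
   (F : set_system T) : Filter F ->
  (forall a b, G s a b @[s --> F] --> G t a b) ->
  u s @[s --> F] --> u t -> w s @[s --> F] --> w t ->
  bilinear_mx (G s) (u s) (w s) @[s --> F] --> bilinear_mx (G t) (u t) (w t).
Proof.
move=> FF cG cu cw.
rewrite (_ : (fun s => _) = (fun s => \sum_a \sum_b u s 0 a * G s a b * w s 0 b)); last first.
  by apply/funext => s; exact: bilinear_mxE.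
rewrite bilinear_mxE.
apply: (cvg_big add_continuous) => a _; apply: (cvg_big add_continuous) => b _.
apply: cvgM; first apply: cvgM => //.
- apply: (@cvg_comp _ _ _ u (fun M : 'rV[R]_n => M 0 a) _ (nbhs (u t)) _ cu).
  exact: (@coord_continuous R 1 n 0 a (u t)).
- apply: (@cvg_comp _ _ _ w (fun M : 'rV[R]_n => M 0 b) _ (nbhs (w t)) _ cw).
  exact: (@coord_continuous R 1 n 0 b (w t)).
Qed.

(** The form has a positive minimum on the unit sphere, which is compact, and homogeneity extends
    the bound. *)
Lemma posdef_lower_bound G : (forall u, u != 0 -> 0 < bilinear_mx G u u) ->
  exists2 k : R, 0 < k & forall u, k * `|u| ^+ 2 <= bilinear_mx G u u.
Proof.
move=> Gp; pose S := [set u : 'rV[R]_n | `|u| = 1].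
have red k : (forall u, S u -> k <= bilinear_mx G u u) ->
    forall u, k * `|u| ^+ 2 <= bilinear_mx G u u.
  move=> h u; have [->|u0] := eqVneq u 0.
    rewrite normr0 expr0n mulr0 bilinear_mxE big1// => a _.
    by rewrite big1// => b _; rewrite mxE !mul0r.
  have nu0 : `|u| != 0 by rewrite normr_eq0.
  have : S (`|u|^-1 *: u) by rewrite /S/= normrZ normfV normr_id mulVf.
  move/h; rewrite bilinear_mxZ exprVn mulrC ler_pdivlMr ?exprn_gt0 ?normr_gt0//.
have [Sn0|S0] := pselect (S !=set0); last first.
  (* For [n = 0] the sphere is empty. *)
  exists 1 => //; apply: red => u Su; exfalso; apply: S0; by exists u.
have cS : compact S.
  apply: bounded_closed_compact.
    by exists 1; split => // x x1 u /= ->; exact: ltW.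
  apply: (@closed_comp _ _ (fun u : 'rV[R]_n => `|u|) [set 1]).
    by move=> u _; exact: norm_continuous.
  exact: accessible_closed_set1 (hausdorff_accessible (@Rhausdorff R)) 1.
have [|u Su Hu] := @EVT_min_rV R n (fun u => bilinear_mx G u u) S Sn0 cS.
  apply: continuous_subspaceT => u.
  apply: (@bilinear_mx_continuous _ (fun=> G) id id u (nbhs u) (nbhs_filter u)) => [a b||].
  - exact: cvg_cst.
  - exact: cvg_id.
  - exact: cvg_id.
exists (bilinear_mx G u u).
  apply: Gp; rewrite -normr_eq0.
  by move: Su; rewrite inE /S/= => ->.
by apply: red => w Sw; apply: Hu; rewrite inE.
Qed.

End bilinear.

(** * Velocity, speed and bounds on the metric in charts *)

Section charts.
Context (R : realType) (n : nat) (M : closed_riemannian_manifold R n).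
Notation A := (atlas M).
Notation G := (gram (metric M)).
Implicit Types (i j k : chart_index A) (x y z : M) (c : R -> M).

Lemma near_dom i x : dom i x -> \forall y \near x, dom i y.
Proof. by move=> ix; apply: open_nbhs_nbhs; split=> //; exact: open_dom. Qed.

Lemma open_overlap i j : open (chart (s := A) i @` (dom i `&` dom j)).
Proof.
rewrite openE => v [x [ix jx] <-].
have im : \forall w \near chart i x, (chart i @` dom i) w.
  by apply: open_nbhs_nbhs; split; [exact: open_chart_image|exists x].
have : \forall w \near chart i x, dom j (chart_inv i w).
  have ci : {for chart i x, continuous (chart_inv i)}.
    by apply: chart_inv_continuous; exists x.
  by apply: ci; rewrite chartK//; exact: near_dom.
rewrite /interior/=; apply: filter_app; near=> w => jw.
have [y iy yw] : (chart i @` dom i) w by near: w.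
by exists y => //; split=> //; rewrite -(chartK iy) yw.
Unshelve. all: by end_near. Qed.

Let tr i j := chart (s := A) j \o chart_inv i.

Lemma transition_C1 i j : Ck_on 1 (chart (s := A) i @` (dom i `&` dom j)) (tr i j).
Proof. exact: transition_smooth. Qed.

Lemma velocity_change c t i j : {for t, continuous c} ->
  dom i (c t) -> dom j (c t) -> derivable (chart i \o c) t 1 ->
  derivable (chart j \o c) t 1 /\
  velocity j c t = 'D_(velocity i c t) (tr i j) (chart i (c t)).
Proof.
move=> ct it jt dc.
have Act : (chart i @` (dom i `&` dom j)) ((chart i \o c) t) by exists (c t).
have [dtr Dtr] := C1_chain (@open_overlap i j) (@transition_C1 i j) Act dc.
have E : {near t, (tr i j \o (chart i \o c)) =1 chart j \o c}.
  have : \forall s \near t, dom i (c s) by apply: ct; exact: near_dom.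
  by apply: filterS => s is_; rewrite /tr/= chartK.
split; first exact: near_eq_derivable dtr.
rewrite /velocity !derive1E -(near_eq_derive _ E) ?oner_neq0// Dtr.
by rewrite (C1_dir (@open_overlap i j) (@transition_C1 i j) _ Act).
Qed.

Lemma speed_chart c t i : {for t, continuous c} ->
  dom i (c t) -> derivable (chart i \o c) t 1 ->
  speed c t = Num.sqrt (bilinear_mx (G i (chart i (c t))) (velocity i c t) (velocity i c t)).
Proof.
move=> ct it dc.
have kt := mem_chart_at A (c t).
have [_ V] := velocity_change ct it kt dc.
by rewrite (gram_compat (metric M) it kt) -V.
Qed.

Lemma C1_curve_derivable c t i : C1_curve c -> 0 <= t <= 1 -> dom i (c t) ->
  derivable (chart i \o c) t 1.
Proof.
by move=> Cc t01 it; have [_ /(_ i it)[h _]] := Cc t t01; exact: nbhs_singleton h.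
Qed.

Lemma C1_curve_continuous c t : C1_curve c -> 0 <= t <= 1 -> {for t, continuous c}.
Proof. by move=> Cc /Cc[]. Qed.

Lemma gram_continuous i x a b : dom i x -> {for chart i x, continuous (fun v => G i v a b)}.
Proof.
move=> ix; have [h _] := gram_smooth (metric M) i a b 0.
by apply: h; exists x.
Qed.

(** [speed] selects a chart at each point without any continuity, so near [t] it is computed in one
    fixed chart, which [speed_chart] permits. *)
Lemma speed_continuous c : C1_curve c -> {within `[0, 1], continuous (speed c)}.
Proof.
move=> Cc; apply/subspace_continuousP => t; rewrite /= in_itv/= => t01.
suff : speed c s @[s --> within `[0, 1] (nbhs (t : R))] --> speed c (t : R) by [].
pose i := chart_at A (c t).
have it := mem_chart_at A (c t) : dom i (c t).
have ct := C1_curve_continuous Cc t01.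
have [_ /(_ i it)[_ vt]] := Cc t t01.
pose f s := Num.sqrt (bilinear_mx (G i (chart i (c s))) (velocity i c s) (velocity i c s)).
have ft : speed c t = f t := speed_chart ct it (C1_curve_derivable Cc t01 it).
have E : {near within `[0, 1] (nbhs t), f =1 speed c}.
  have : \forall s \near t, dom i (c s) by apply: ct; exact: near_dom.
  apply: filterS => s is_; rewrite /= in_itv/= => s01.
  have cs := C1_curve_continuous Cc s01.
  exact: (esym (speed_chart cs is_ (C1_curve_derivable Cc s01 is_))).
rewrite ft; apply: cvg_trans; first exact: (near_eq_cvg E).
apply: cvg_within_filter; rewrite /f.
apply: (@cvg_comp _ _ _ (fun s => bilinear_mx (G i (chart i (c s))) (velocity i c s) (velocity i c s)) Num.sqrt _
   (nbhs (bilinear_mx (G i (chart i (c t))) (velocity i c t) (velocity i c t)))); last first.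
  exact: sqrt_continuous.
apply: (@bilinear_mx_continuous R n _ (fun s => G i (chart i (c s))) (velocity i c) (velocity i c) t
  (nbhs t) (nbhs_filter t)) => // a b.
have cc : (chart i \o c) s @[s --> t] --> chart i (c t).
  apply: (@cvg_comp _ _ _ c (chart i) (nbhs t) (nbhs (c t))); first exact: ct.
  exact: chart_continuous.
apply: (@cvg_comp _ _ _ (chart i \o c) (fun v => G i v a b) (nbhs t) (nbhs (chart i (c t)))) => //.
exact: (@gram_continuous i (c t) a b it).
Qed.

Lemma speed_ge0 c t : 0 <= speed c t.
Proof. exact: sqrtr_ge0. Qed.

Lemma speed_integrable c (a b : R) : C1_curve c -> 0 <= a -> b <= 1 ->
  (@lebesgue_measure R).-integrable `[a, b] (EFin \o speed c).
Proof.
move=> Cc a0 b1.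
have I01 : (@lebesgue_measure R).-integrable `[0, 1] (EFin \o speed c).
  by apply: continuous_compact_integrable; [exact: segment_compact|exact: speed_continuous].
apply: integrableS I01 => //.
by apply: subset_itvScc; rewrite bnd_simp.
Qed.

Lemma chart_ball i x : dom i x -> exists rho lam Lam : R,
  [/\ 0 < rho, 0 < lam, 0 < Lam,
   (forall v, `|v - chart i x| <= 2 * rho -> (chart i @` dom i) v) &
   forall v, `|v - chart i x| <= 2 * rho -> forall u,
     lam * `|u| <= Num.sqrt (bilinear_mx (G i v) u u) <= Lam * `|u| ].
Proof.
move=> ix; set v0 := chart i x.
have imx : (chart i @` dom i) v0 by exists x.
have [k k0 Hk] := posdef_lower_bound (@gram_pos _ _ _ _ (metric M) i v0 imx).
pose N : R := n%:R ^+ 2 + 1.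
have N0 : 0 < N by rewrite ltr_wpDl// sqr_ge0.
(* Entries perturbed by at most [e] change the form by at most [k / 2] times the squared norm, so
   half of the lower bound survives. *)
pose e := k / (2 * N).
have e0 : 0 < e by rewrite divr_gt0// mulr_gt0.
have Hn : \forall v \near v0, (chart i @` dom i) v /\
    forall a, forall b, `|G i v a b - G i v0 a b| <= e.
  have h (a b : 'I_n) : \forall v \near v0, `|G i v a b - G i v0 a b| <= e.
    have /cvgrPdist_le /(_ _ e0) := @gram_continuous i x a b ix.
    by apply: filterS => w; rewrite distrC.
  have h' a := @filter_forall _ _ _ (nbhs v0) (nbhs_filter v0) (h a).
  have h'' := @filter_forall _ _ _ (nbhs v0) (nbhs_filter v0) h'.
  apply: filterI h''.
  by apply: open_nbhs_nbhs; split=> //; exact: open_chart_image.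
move/nbhs_ballP : Hn => [d /= d0 Hd].
pose S := \big[Num.max/0]_(p : 'I_n * 'I_n) `|G i v0 p.1 p.2|.
have S0 : 0 <= S by exact: bigmax_ge_id.
have HS a b : `|G i v0 a b| <= S by exact: (le_bigmax _ (fun p : 'I_n * 'I_n => `|G i v0 p.1 p.2|) (a, b)).
pose B : R := N * (S + e).
have B0 : 0 < B by rewrite mulr_gt0// ltr_wpDl.
exists (d / 4), (Num.sqrt (k / 2)), (Num.sqrt B); split.
- by rewrite divr_gt0.
- by rewrite sqrtr_gt0 divr_gt0.
- by rewrite sqrtr_gt0.
- move=> v vd; apply: (Hd _ _).1; rewrite -ball_normE/= distrC (le_lt_trans vd)//.
  lra.
move=> v vd u.
have [_ Gv] : (chart i @` dom i) v /\ forall a, forall b, `|G i v a b - G i v0 a b| <= e.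
  apply: Hd; rewrite -ball_normE/= distrC (le_lt_trans vd)//; lra.
have nN : n%:R ^+ 2 <= N by rewrite /N lerDl.
have u0 : 0 <= `|u| ^+ 2 by rewrite sqr_ge0.
have sq (r : R) : 0 <= r -> Num.sqrt r * `|u| = Num.sqrt (r * `|u| ^+ 2).
  by move=> r0; rewrite sqrtrM// sqrtr_sqr normr_id.
have Q1 : `|bilinear_mx (G i v) u u - bilinear_mx (G i v0) u u| <= k / 2 * `|u| ^+ 2.
  rewrite bilinear_mxB.
  have := @bilinear_mx_le _ _ (G i v - G i v0) u e.
  move=> /(_ _)/le_trans; apply; first by move=> a b; rewrite !mxE; exact: Gv.
  rewrite ler_wpM2r// (@le_trans _ _ (N * e))//; first by rewrite ler_wpM2r// ltW.
  rewrite /e le_eqVlt; apply/orP; left; apply/eqP; field; exact: lt0r_neq0.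
have Q0 := Hk u.
have QB : bilinear_mx (G i v) u u <= B * `|u| ^+ 2.
  apply: (le_trans (ler_norm _)).
  have := @bilinear_mx_le _ _ (G i v) u (S + e).
  move=> /(_ _)/le_trans; apply.
    move=> a b; rewrite -[G i v a b](subrK (G i v0 a b)) addrC (le_trans (ler_normD _ _))//.
    exact: lerD.
  by rewrite ler_wpM2r// ler_wpM2r// addr_ge0// ltW.
have Qlow : k / 2 * `|u| ^+ 2 <= bilinear_mx (G i v) u u.
  move: Q1 Q0; rewrite ler_norml; lra.
have k20 : 0 <= k / 2 by rewrite divr_ge0// ltW.
rewrite (sq _ k20) (sq _ (ltW B0)).
by apply/andP; split; exact: ler_wsqrtr.
Qed.

End charts.

(** * Lengths of curves and functions that are Lipschitz along them *)

Section curve_lengths.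
Context (R : realType) (n : nat) (M : closed_riemannian_manifold R n).
Notation A := (atlas M).
Notation G := (gram (metric M)).
Implicit Types (i j k : chart_index A) (x y z : M) (c : R -> M).
Local Notation lebesgue := (@lebesgue_measure R).

Lemma cst_integrable_itv (a b B : R) : lebesgue.-integrable `[a, b] (EFin \o cst B).
Proof.
apply: continuous_compact_integrable; first exact: segment_compact.
by apply: continuous_subspaceT => ?; exact: cvg_cst.
Qed.

Lemma Rintegral_cst_itv (a b B : R) : a <= b -> \int[lebesgue]_(t in `[a, b]) B = B * (b - a).
Proof.
rewrite le_eqVlt => /predU1P[->|ab].
  by rewrite subrr mulr0 set_itv1 Rintegral_set1.
by rewrite Rintegral_cst//= lebesgue_measure_itv/= lte_fin ab.
Qed.

Lemma curve_length_le c B : C1_curve c -> (forall t, 0 <= t <= 1 -> speed c t <= B) ->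
  curve_length c <= B.
Proof.
move=> Cc sB.
rewrite -[B]mulr1 -[X in _ * X]subr0 -(@Rintegral_cst_itv 0 1)//.
apply: le_Rintegral => //.
- exact: speed_integrable.
- exact: cst_integrable_itv.
Qed.

Lemma curve_length_ge0 c : 0 <= curve_length c.
Proof. by apply: Rintegral_ge0 => t _; exact: speed_ge0. Qed.

Lemma integral_speed_ge c (a b B : R) : C1_curve c -> 0 <= a -> a <= b -> b <= 1 ->
  (forall t, a <= t <= b -> B <= speed c t) ->
  B * (b - a) <= \int[lebesgue]_(t in `[a, b]) speed c t.
Proof.
move=> Cc a0 ab b1 sB; rewrite -Rintegral_cst_itv//; apply: le_Rintegral => //.
- exact: cst_integrable_itv.
- exact: speed_integrable.
Qed.

Lemma integral_speedB c (a b : R) : C1_curve c -> 0 <= a -> a <= b -> b <= 1 ->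
  \int[lebesgue]_(t in `[0, b]) speed c t - \int[lebesgue]_(t in `[0, a]) speed c t =
  \int[lebesgue]_(t in `[a, b]) speed c t.
Proof.
move=> Cc a0 ab b1; rewrite Rintegral_itvB ?bnd_simp//; last exact: speed_integrable.
rewrite Rintegral_itv_obnd_cbnd//.
have h := @speed_integrable _ _ _ c a b Cc a0 b1.
by apply: integrableS h => // x; rewrite /= !in_itv/= => /andP[/ltW -> ->].
Qed.

(** A mean value inequality for functions that need not be differentiable. The bound propagates from
    0: at the supremum [T] of the times reached, a time just before [T] where it holds and a time
    just after are compared through the local estimate at [T], so [T] cannot be less than 1. *)
Lemma local_bound_integrates (u F : R -> R) :
  (forall t e : R, 0 <= t <= 1 -> 0 < e -> exists2 d : R, 0 < d &
     forall s s', 0 <= s -> s <= t -> t <= s' -> s' <= 1 -> t - s < d -> s' - t < d ->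
       `|u s' - u s| <= F s' - F s + e * (s' - s)) ->
  `|u 1 - u 0| <= F 1 - F 0.
Proof.
move=> H; apply/ler_addgt0Pr => e e0.
pose S := [set t : R | 0 <= t <= 1 /\ `|u t - u 0| <= F t - F 0 + e * t].
have S0 : S 0 by rewrite /S/= lexx ler01 !subrr normr0 mulr0 addr0.
have hS : has_sup S by split; [exists 0|exists 1 => t [/andP[]]].
set T := sup S.
have T0 : 0 <= T by apply: sup_upper_bound.
have T1 : T <= 1 by apply: ge_sup; [exists 0|move=> t [/andP[]]].
have [|d d0 Hd] := H T e _ e0; first by rewrite T0.
have [s [/andP[s0 s1] Ss] sT] := sup_adherent d0 hS.
have sT' : s <= T by apply: sup_upper_bound => //; split=> //; rewrite s0.
pose s' := Num.min 1 (T + d / 2).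
have Ts' : T <= s' by rewrite le_min T1 lerDl divr_ge0// ltW.
have Ss' : `|u s' - u 0| <= F s' - F 0 + e * s'.
  have := Hd s s' s0 sT' Ts' _ _ _.
  rewrite ge_min lexx ltrBlDr -ltrBlDl => /(_ isT sT).
  have -> : s' - T < d.
    rewrite ltrBlDl (@le_lt_trans _ _ (T + d / 2))// ?ge_min ?lexx ?orbT//.
    by rewrite ltrD2l; lra.
  move=> /(_ isT) h; have -> : u s' - u 0 = (u s' - u s) + (u s - u 0) by ring.
  rewrite (le_trans (ler_normD _ _))// (le_trans (lerD h Ss))// le_eqVlt.
  by apply/orP; left; apply/eqP; ring.
have s'1 : s' = 1.
  have : s' <= T.
    apply: sup_upper_bound => //; split=> //.
    by rewrite (le_trans T0 Ts') ge_min lexx.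
  by rewrite /s'; case: (leP 1 (T + d / 2)) => // _; lra.
by rewrite s'1 mulr1 in Ss'.
Qed.

(** The intended [h] is not differentiable, so its increment is not the integral of a derivative.
    Instead the local bound by the speed is compared with the length integral on short intervals,
    where the speed is nearly constant. *)
Lemma curve_lipschitz (h : M -> R) (K : R) c : 0 <= K -> C1_curve c ->
  (forall t e : R, 0 <= t <= 1 -> 0 < e -> exists2 d : R, 0 < d &
     forall s, `|s - t| < d -> `|h (c s) - h (c t)| <= (K * speed c t + e) * `|s - t|) ->
  `|h (c 1) - h (c 0)| <= K * curve_length c.
Proof.
move=> K0 Cc H.
pose F t := K * \int[lebesgue]_(x in `[0, t]) speed c x.
have -> : K * curve_length c = F 1 - F 0.
  by rewrite /F set_itv1 Rintegral_set1 mulr0 subr0.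
apply: (@local_bound_integrates (h \o c) F) => t e t01 e0.
have e20 : 0 < e / 2 by rewrite divr_gt0.
have [d d0 Hd] := H t (e / 2) t01 e20.
(* The oscillation of the speed tolerated near [t]; it costs [K * eta], at most [e / 2]. *)
pose eta := e / (2 * (K + 1)).
have K1 : 0 < K + 1 by rewrite ltr_wpDl.
have eta0 : 0 < eta by rewrite divr_gt0// mulr_gt0.
have Keta : K * eta <= e / 2.
  have : eta * (K + 1) = e / 2 by rewrite /eta; field; exact: lt0r_neq0.
  move: eta0; lra.
clearbody eta.
have sc : speed c x @[x --> within `[0, 1] (nbhs t)] --> speed c t.
  by have /subspace_continuousP := speed_continuous Cc; apply; rewrite /= in_itv.
have /nbhs_ballP[r /= r0 Hr] : nbhs t [set x | `[0, 1]%classic x -> `|speed c t - speed c x| <= eta].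
  by have /cvgrPdist_le /(_ _ eta0) := sc.
exists (Num.min d r); first by rewrite lt_min d0.
move=> s s' s0 st ts' s'1; rewrite !lt_min => /andP[tsd tsr] /andP[std str].
have ss' : s <= s' by exact: le_trans ts'.
have h1 : `|h (c s') - h (c t)| <= (K * speed c t + e / 2) * (s' - t).
  by have := Hd s'; rewrite ger0_norm ?subr_ge0// => /(_ std).
have h2 : `|h (c t) - h (c s)| <= (K * speed c t + e / 2) * (t - s).
  by have := Hd s; rewrite distrC ger0_norm ?subr_ge0// => /(_ tsd); rewrite distrC.
have hh : `|h (c s') - h (c s)| <= (K * speed c t + e / 2) * (s' - s).
  have -> : h (c s') - h (c s) = (h (c s') - h (c t)) + (h (c t) - h (c s)) by ring.
  rewrite (le_trans (ler_normD _ _))// (le_trans (lerD h1 h2))// -mulrDr.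
  by rewrite addrA subrK.
rewrite /= (le_trans hh)// /F -mulrBr integral_speedB//.
have Ig : (speed c t - eta) * (s' - s) <= \int[lebesgue]_(x in `[s, s']) speed c x.
  apply: integral_speed_ge => // x /andP[sx xs'].
  have : `|speed c t - speed c x| <= eta.
    apply: Hr; last by rewrite /= in_itv/=; apply/andP; split; lra.
    by rewrite /ball/=/ball_/= ltr_norml; apply/andP; split; lra.
  by rewrite ler_norml => /andP[_]; move: (speed c t) (speed c x) => p q; clear; lra.
have ss0 : 0 <= s' - s by rewrite subr_ge0.
move: (ler_wpM2l K0 Ig) (ler_wpM2r ss0 Keta).
set I := Rintegral _ _ _; move: (speed c t) I => q I; clear; lra.
Qed.

Lemma piecewise_C1_lipschitz (h : M -> R) (K : R) : 0 <= K ->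
  (forall c, C1_curve c -> `|h (c 1) - h (c 0)| <= K * curve_length c) ->
  forall s x y, piecewise_C1 x s y -> `|h y - h x| <= K * \sum_(c <- s) curve_length c.
Proof.
move=> K0 H; elim=> [x y /= ->|c s IH x y /= [Cc c0 p]].
  by rewrite subrr normr0 big_nil mulr0.
rewrite big_cons mulrDr [leRHS]addrC.
have -> : h y - h x = (h y - h (c 1)) + (h (c 1) - h (c 0)) by rewrite c0 addrA subrK.
by rewrite (le_trans (ler_normD _ _))// lerD// ?IH// H.
Qed.

Lemma cvg_lincomb (V : normedModType R) (I : finType) (T : Type) (F : set_system T)
    (k : I -> R) (f : I -> T -> V) (l : I -> V) : Filter F ->
  (forall a, f a s @[s --> F] --> l a) ->
  (\sum_a k a *: f a s) @[s --> F] --> \sum_a k a *: l a.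
Proof.
by move=> FF fl; apply: (cvg_big add_continuous) => a _; exact: cvgZl_tmp.
Qed.

(** A segment in the chart [i] must be C^1 in every chart that it meets, hence the velocity formula
    in an arbitrary chart [j]. *)
Lemma line_curve i (v u : 'rV[R]_n) :
  (forall t : R, 0 <= t <= 1 -> (chart i @` dom i) (t *: u + v)) ->
  let c := fun t : R => chart_inv i (t *: u + v) in
  C1_curve c /\ forall t : R, 0 <= t <= 1 ->
    [/\ dom i (c t), chart i (c t) = t *: u + v & velocity i c t = u].
Proof.
move=> im c.
pose l (t : R) := t *: u + v.
have dl t : is_derive t (1 : R) l u.
  have h := @is_derive_line R 'rV[R]_n 'rV[R]_n id v u t (@derivable_id _ _ _ _).
  by apply: is_derive_eq; rewrite derive_id.
have cl t : {for t, continuous l}.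
  by apply: differentiable_continuous; apply/derivable1_diffP; exact: ex_derive.
have key t : 0 <= t <= 1 -> dom i (c t) /\ chart i (c t) = l t.
  by move=> /im[x ix E]; rewrite /c /l -E chartK.
have cc t : 0 <= t <= 1 -> {for t, continuous c}.
  move=> t01; apply: (@continuous_comp _ _ _ l (chart_inv i)); first exact: cl.
  by apply: chart_inv_continuous; exact: im.
have chain j t : 0 <= t <= 1 -> dom j (c t) ->
   \forall s \near t, derivable (chart j \o c) s 1 /\
     velocity j c s = \sum_a u 0 a *: 'D_(delta_mx 0 a) (chart j \o chart_inv i) (l s).
  move=> t01 jt.
  have Bt : (chart i @` (dom i `&` dom j)) (l t).
    by have [it E] := key t t01; exists (c t).
  have nB : \forall s \near t, (chart i @` (dom i `&` dom j)) (l s).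
    by apply: cl; apply: open_nbhs_nbhs; split=> //; exact: open_overlap.
  apply: filterS nB => s Bs.
  have [d D] := C1_chain (@open_overlap _ _ _ i j) (@transition_C1 _ _ _ i j) Bs (@ex_derive _ _ _ _ _ _ _ (dl s)).
  split; first exact: d.
  by rewrite /velocity derive1E D (@derive_val _ _ _ _ _ _ _ (dl s)).
split.
  move=> t t01; split; first exact: cc.
  move=> j jt; have ch := chain j t t01 jt.
  split; first by apply: filterS ch => s [].
  have Et : velocity j c t = \sum_a u 0 a *: 'D_(delta_mx 0 a) (chart j \o chart_inv i) (l t).
    by have [] := nbhs_singleton ch.
  have E : {near t, (fun s => \sum_a u 0 a *: 'D_(delta_mx 0 a) (chart j \o chart_inv i) (l s))
      =1 velocity j c} by apply: filterS ch => s [].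
  have Bt : (chart i @` (dom i `&` dom j)) (l t).
    by have [it Eq] := key t t01; exists (c t).
  rewrite /prop_for /continuous_at Et; apply: cvg_trans; first exact: (near_eq_cvg E).
  apply: cvg_lincomb => a.
  apply: (@cvg_comp _ _ _ l (fun w => 'D_(delta_mx 0 a) (chart j \o chart_inv i) w)
    (nbhs t) (nbhs (l t))); first exact: cl.
  exact: (C1_partial_continuous (@transition_C1 _ _ _ i j)).
move=> t t01; have [it E] := key t t01; split=> //.
have En : {near t, l =1 chart i \o c}.
  have nB : \forall s \near t, (chart i @` dom i) (l s).
    by apply: cl; apply: open_nbhs_nbhs; split; [exact: open_chart_image|exact: im].
  by apply: filterS nB => s [x ix Ex]; rewrite /= /c -/(l s) -Ex chartK.
rewrite /velocity derive1E -(near_eq_derive _ En) ?oner_neq0//.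
exact: (@derive_val _ _ _ _ _ _ _ (dl t)).
Qed.

End curve_lengths.

(** * The Riemannian distance is a metric and induces the topology *)

Section riemannian_distance.
Context (R : realType) (n : nat) (M : closed_riemannian_manifold R n).
Notation A := (atlas M).
Notation G := (gram (metric M)).
Implicit Types (i j k : chart_index A) (x y z : M) (c : R -> M).
Local Notation lebesgue := (@lebesgue_measure R).
Local Notation lengths s := (\sum_(c <- s) curve_length c).

Lemma derive_reverse (g : R -> 'rV[R]_n) t : derivable g (1 - t) 1 ->
  derivable (fun s : R => g (1 - s)) t 1 /\
  'D_1 (fun s : R => g (1 - s)) t = - 'D_1 g (1 - t).
Proof.
move=> dg; pose r (s : R) := 1 - s.
have dr : is_derive t 1 r (-1).
  have h : is_derive t (1 : R) ((cst 1 : R -> R) - id) (0 - 1) by exact: is_deriveB.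
  by rewrite sub0r in h; exact: h.
have Dr : differentiable r t by apply/derivable1_diffP; exact: ex_derive.
have Dg : differentiable g (r t) by apply/derivable1_diffP.
have Dgr : differentiable (g \o r) t by exact: differentiable_comp.
split; first exact/derivable1_diffP.
have -> : (fun s : R => g (1 - s)) = g \o r by [].
have E1 : 'd r t 1 = -1 :> R by rewrite -(@deriveE R R R r t 1 Dr) derive_val.
by rewrite (deriveE _ Dgr) (diff_comp Dr Dg)/= E1 linearN/= (deriveE _ Dg).
Qed.

Lemma near_reverse (P : R -> Prop) (t : R) :
  (\forall s \near 1 - t, P s) -> \forall s \near t, P (1 - s).
Proof.
move=> /nbhs_ballP[d d0 Bd]; apply/nbhs_ballP; exists d => // s ts.
apply: Bd; move: ts; rewrite /ball/=/ball_/=.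
have -> : 1 - t - (1 - s) = - (t - s) by ring.
by rewrite normrN.
Qed.

Lemma reverse_curve c : C1_curve c ->
  C1_curve (fun t : R => c (1 - t)) /\ curve_length (fun t : R => c (1 - t)) = curve_length c.
Proof.
move=> Cc.
have r01 (t : R) : 0 <= t <= 1 -> 0 <= 1 - t <= 1.
  by move=> /andP[? ?]; apply/andP; split; lra.
have cr (t : R) : {for t, continuous (fun s : R => 1 - s)}.
  by apply: cvgB; [exact: cvg_cst|exact: cvg_id].
have vel i t : derivable (chart i \o c) (1 - t) 1 ->
   velocity i (fun t : R => c (1 - t)) t = - velocity i c (1 - t).
  by move=> /derive_reverse[_ h]; rewrite /velocity !derive1E.
have Cr : C1_curve (fun t : R => c (1 - t)).
  move=> t /r01 t01; have [ct H] := Cc _ t01; split.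
    exact: (@continuous_comp _ _ _ (fun s : R => 1 - s) c).
  move=> i it; have [Hd Hv] := H i it.
  have Hd' : \forall s \near t, derivable (chart i \o c) (1 - s) 1.
    by move: Hd; exact: near_reverse.
  split; first by apply: filterS Hd' => s /derive_reverse[].
  rewrite /prop_for /continuous_at (vel _ _ (nbhs_singleton Hd')).
  have E : {near t, (fun s : R => - velocity i c (1 - s)) =1 velocity i (fun s : R => c (1 - s))}.
    by apply: filterS Hd' => s /vel.
  apply: cvg_trans; first exact: (near_eq_cvg E).
  apply: cvgN.
  by apply: (@cvg_comp _ _ _ (fun s : R => 1 - s) (velocity i c) _ (nbhs (1 - t)));
    [exact: cr|exact: Hv].
split; first exact: Cr.
have sr t : 0 <= t <= 1 -> speed (fun t : R => c (1 - t)) t = speed c (1 - t).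
  move=> /r01 t01; rewrite /speed vel; last first.
    apply: C1_curve_derivable => //; exact: mem_chart_at.
  by rewrite bilinear_mxN.
have h01 : 0 <= (1 : R) <= 1 by rewrite ler01 lexx.
have E := @Rintegration_by_substitution_onem R (speed c) 1 h01 (speed_continuous Cc).
have o1 : unstable.onem (1 : R) = 0 by exact: subrr.
rewrite o1 in E.
transitivity (\int[lebesgue]_(t in `[0, 1]) speed c (unstable.onem t)); last exact: esym E.
by apply: eq_Rintegral => t; rewrite inE/= in_itv/= => t01; exact: sr.
Qed.

Lemma piecewise_C1_cat s1 s2 x y z : piecewise_C1 x s1 y -> piecewise_C1 y s2 z ->
  piecewise_C1 x (s1 ++ s2) z.
Proof.
elim: s1 x => [x /= -> //|c s1 IH x /= [Cc c0 p] q]; split=> //; exact: IH.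
Qed.

Lemma piecewise_C1_rev s x y : piecewise_C1 x s y ->
  exists2 s', piecewise_C1 y s' x & lengths s' = lengths s.
Proof.
elim: s x => [x /= ->|c s IH x /= [Cc c0 /IH[s' ps' ls']]]; first by exists [::].
have [Cr lr] := reverse_curve Cc.
exists (s' ++ [:: fun t : R => c (1 - t)]).
  by apply: piecewise_C1_cat ps' _ => /=; split; rewrite ?subr0 ?subrr.
by rewrite big_cat big_seq1 big_cons ls' lr/= addrC.
Qed.

Lemma lengths_ge0 (s : seq (R -> M)) : 0 <= lengths s.
Proof. by apply: sumr_ge0 => c _; exact: curve_length_ge0. Qed.

Definition path_lengths x y : set R :=
  [set lengths s | s in [set s | piecewise_C1 x s y]].

Lemma path_lengths_lb x y : has_lbound (path_lengths x y).
Proof. by exists 0 => _ [s _ <-]; exact: lengths_ge0. Qed.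

Lemma chart_segment i x y rho : dom i x -> dom i y ->
  (forall v, `|v - chart i x| <= rho -> (chart i @` dom i) v) ->
  `|chart i y - chart i x| <= rho ->
  exists c, [/\ C1_curve c, c 0 = x, c 1 = y &
    forall t : R, 0 <= t <= 1 -> [/\ dom i (c t), `|chart i (c t) - chart i x| <= rho &
      velocity i c t = chart i y - chart i x]].
Proof.
move=> ix iy im xy; set u := chart i y - chart i x.
have le t : 0 <= t <= 1 -> `|t *: u + chart i x - chart i x| <= rho.
  move=> /andP[t0 t1]; rewrite addrK normrZ ger0_norm// (le_trans _ xy)//.
  by rewrite -[leRHS]mul1r ler_wpM2r.
have := @line_curve R n M i (chart i x) u (fun t t01 => im _ (le t t01)).
set c := fun t : R => _ => /= -[Cc Hc].
exists c; split=> //.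
- by rewrite /c scale0r add0r chartK.
- by rewrite /c scale1r /u subrK chartK.
- move=> t t01; have [? E ?] := Hc t t01; split=> //.
  by rewrite E; exact: le.
Qed.

Lemma near_chart i x (rho : R) : dom i x -> 0 < rho ->
  \forall y \near x, dom i y /\ `|chart i y - chart i x| < rho.
Proof.
move=> ix r0; near=> y; split; near: y; first exact: near_dom.
have := @chart_continuous R n M A i x ix; move=> /cvgrPdist_lt /(_ _ r0).
by apply: filterS => y; rewrite distrC.
Unshelve. all: by end_near. Qed.

(** The points reached from [x] form an open set, and so do the others, since a reversed segment
    would lead back from a reachable neighbour. This makes [rdist] an infimum over a nonempty
    set. *)
Lemma piecewise_C1_connected x y : exists s, piecewise_C1 x s y.
Proof.
pose B := [set y | exists s, piecewise_C1 x s y].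
have loc y0 : \forall z \near y0, exists2 c, C1_curve c & c 0 = y0 /\ c 1 = z.
  have iy := mem_chart_at A y0; set i := chart_at A y0 in iy.
  have [rho [lam [Lam [r0 _ _ im _]]]] := chart_ball iy.
  have r20 : 0 < 2 * rho by rewrite mulr_gt0.
  apply: filterS (near_chart iy r20) => z [iz zr].
  by have [c [Cc c0 c1 _]] := chart_segment iy iz im (ltW zr); exists c.
suff : B = setT by move=> BT; have : B y by rewrite BT.
apply: (@manifold_connected R n M).
- by exists x; exists [::].
- exists B; last by rewrite setTI.
  rewrite openE => y0 [s ps]; apply: filterS (loc y0) => z [c Cc [c0 c1]].
  exists (s ++ [:: c]); apply: piecewise_C1_cat ps _; by split.
- exists B; last by rewrite setTI.
  rewrite -[B]setCK closedC openE => y0 nB.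
  apply: filterS (loc y0) => z [c Cc [c0 c1]] [s ps]; apply: nB.
  have [s' ps' _] := @piecewise_C1_rev [:: c] y0 z (And3 Cc c0 c1).
  by exists (s ++ s'); apply: piecewise_C1_cat ps ps'.
Qed.

Lemma path_lengths_neq0 x y : path_lengths x y !=set0.
Proof. by have [s ps] := piecewise_C1_connected x y; exists (lengths s); exists s. Qed.

Lemma rdist_le s x y : piecewise_C1 x s y -> rdist x y <= lengths s.
Proof. by move=> ps; apply: ge_inf; [exact: path_lengths_lb|exists s]. Qed.

Lemma rdist_ge x y (r : R) : (forall s, piecewise_C1 x s y -> r <= lengths s) -> r <= rdist x y.
Proof.
by move=> h; apply: lb_le_inf; [exact: path_lengths_neq0|move=> _ [s ps <-]; exact: h].
Qed.

Lemma rdist_ge0 x y : 0 <= rdist x y.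
Proof. by apply: rdist_ge => s _; exact: lengths_ge0. Qed.

Lemma rdistxx x : rdist x x = 0.
Proof.
apply/le_anti; rewrite rdist_ge0 andbT.
by have := @rdist_le [::] x x erefl; rewrite big_nil.
Qed.

Lemma rdistC x y : rdist x y = rdist y x.
Proof.
suff h (a b : M) : rdist a b <= rdist b a by apply/le_anti; rewrite !h.
apply: rdist_ge => s /piecewise_C1_rev[s' ps' <-]; exact: rdist_le.
Qed.

Lemma rdist_triangle y x z : rdist x z <= rdist x y + rdist y z.
Proof.
rewrite -lerBlDr; apply: rdist_ge => s ps.
rewrite lerBlDr -lerBlDl; apply: rdist_ge => s' ps'.
rewrite lerBlDl -big_cat; apply: rdist_le; exact: piecewise_C1_cat ps ps'.
Qed.

Lemma rdist_le_chart i x y (rho Lam : R) : dom i x -> dom i y ->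
  (forall v, `|v - chart i x| <= rho -> (chart i @` dom i) v) ->
  (forall v, `|v - chart i x| <= rho -> forall u,
     Num.sqrt (bilinear_mx (G i v) u u) <= Lam * `|u|) ->
  `|chart i y - chart i x| <= rho ->
  rdist x y <= Lam * `|chart i y - chart i x|.
Proof.
move=> ix iy im Gle xy.
have [c [Cc c0 c1 Hc]] := chart_segment ix iy im xy.
have := @rdist_le [:: c] x y (And3 Cc c0 c1).
rewrite big_seq1 => /le_trans; apply; apply: curve_length_le => // t t01.
have [it E V] := Hc t t01.
rewrite (speed_chart (C1_curve_continuous Cc t01) it (C1_curve_derivable Cc t01 it)) V.
exact: Gle.
Qed.

Section test_function.
Variables (i : chart_index A) (y : M) (rho lam : R).
Hypotheses (iy : dom i y) (rho0 : 0 < rho) (lam0 : 0 < lam).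
Hypothesis im : forall v, `|v - chart i y| <= rho -> (chart i @` dom i) v.
Hypothesis Gge : forall v, `|v - chart i y| <= rho -> forall u,
     lam * `|u| <= Num.sqrt (bilinear_mx (G i v) u u).

(** A cone of height [rho] over the chart ball around [y]. Along curves it is Lipschitz with
    constant [lam^-1], so it bounds from below the length of any curve descending it; the time at
    which the curve leaves the chart never has to be located. *)
Definition bump z : R :=
  if `[< dom i z >] then Num.max 0 (rho - `|chart i z - chart i y|) else 0.

Lemma closed_chart_ball : closed (chart_inv i @` [set v | `|v - chart i y| <= rho]).
Proof.
apply: compact_closed; first exact: manifold_hausdorff.
apply: continuous_compact.
  apply: continuous_in_subspaceT => v; rewrite inE/= => /im.
  exact: chart_inv_continuous.
apply: bounded_closed_compact.
  exists (`|chart i y| + rho); split => [|r hr v /= vr]; first exact: num_real.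
  rewrite -[v](subrK (chart i y)) (le_trans (ler_normD _ _))//.
  by rewrite addrC (le_trans _ (ltW hr))// lerD2l.
have cn (v : 'rV[R]_n) : `|w - chart i y| @[w --> v] --> `|v - chart i y|.
  apply/(@cvgrPdist_le _ _ _ (nbhs v) (nbhs_filter v)) => e e0; apply/nbhs_ballP; exists e => // w.
  rewrite -ball_normE/= => /ltW h; rewrite (le_trans (ler_dist_dist _ _))//.
  by rewrite opprB addrA subrK.
apply: (@closed_comp _ _ (fun v : 'rV[R]_n => `|v - chart i y|) [set r | r <= rho]).
  by move=> v _; exact: cn.
exact: closed_le.
Qed.

Lemma bump_out z : ~ (chart_inv i @` [set v | `|v - chart i y| <= rho]) z -> bump z = 0.
Proof.
move=> nz; rewrite /bump; case: asboolP => // iz; apply/max_idPl.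
rewrite leNgt subr_gt0; apply/negP => /ltW h; apply: nz.
by exists (chart i z); rewrite ?chartK.
Qed.

Lemma bump_curve c : C1_curve c ->
  (forall t e : R, 0 <= t <= 1 -> 0 < e -> exists2 d : R, 0 < d &
     forall s, `|s - t| < d ->
      `|bump (c s) - bump (c t)| <= (lam^-1 * speed c t + e) * `|s - t|).
Proof.
move=> Cc t e t01 e0.
suff : \forall s \near t, `|bump (c s) - bump (c t)| <= (lam^-1 * speed c t + e) * `|s - t|.
  move=> /nbhs_ballP[d d0 Hd]; exists d => // s st.
  by apply: Hd; rewrite /ball/=/ball_/= distrC.
have ct := C1_curve_continuous Cc t01.
have [[v /= vr vc]|nK] := pselect ((chart_inv i @` [set v | `|v - chart i y| <= rho]) (c t)); last first.
  have : \forall s \near t, ~ (chart_inv i @` [set v | `|v - chart i y| <= rho]) (c s).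
    have nb : nbhs (c t) (~` (chart_inv i @` [set v | `|v - chart i y| <= rho])).
      by apply: open_nbhs_nbhs; split => //; rewrite openC; exact: closed_chart_ball.
    exact: (ct _ nb).
  apply: filterS => s ns; rewrite !bump_out// subrr normr0.
  apply: mulr_ge0 => //; apply: addr_ge0; last exact: ltW.
  by apply: mulr_ge0; [rewrite invr_ge0 ltW|exact: speed_ge0].
have [x ix xv] := im vr.
have cx : c t = x by rewrite -vc -xv chartK.
have it : dom i (c t) by rewrite cx.
have dc := C1_curve_derivable Cc t01 it.
have vE : chart i (c t) = v by rewrite cx.
have Vle : `|velocity i c t| <= lam^-1 * speed c t.
  by rewrite ler_pdivlMl// (speed_chart ct it dc) vE; exact: Gge.
have /nbhs_ballP[d d0 Hd] : nbhs t [set s | s != t -> `|(s - t)^-1 *: (chart i (c s) - chart i (c t))| <= `|velocity i c t| + e].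
  have := dc; rewrite /derivable => /cvgrPdist_le /(_ _ e0) /nbhs_ballP[d d0 Hd].
  apply/nbhs_ballP; exists d => // s st /= nst.
  have := Hd (s - t); rewrite /ball/=/ball_/= sub0r normrN.
  have -> : `|s - t| < d by move: st; rewrite /ball/=/ball_/= distrC.
  move=> /(_ isT); rewrite subr_eq0 => /(_ nst).
  rewrite [_ *: 1]mulr1 subrK => h.
  rewrite -[X in `|X|](subrK (velocity i c t)) (le_trans (ler_normD _ _))//.
  rewrite addrC lerD2l distrC /velocity derive1E; exact: h.
have ni : \forall s \near t, dom i (c s) by apply: ct; exact: near_dom.
have nd : \forall s \near t, ball t d s by apply/nbhs_ballP; exists d.
near=> s.
have is_ : dom i (c s) by near: s.
have st : ball t d s by near: s.
have [->|nst] := eqVneq s t; first by rewrite !subrr !normr0 mulr0.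
have L : `|chart i (c s) - chart i (c t)| <= (`|velocity i c t| + e) * `|s - t|.
  have := Hd s st nst; rewrite normrZ normfV ler_pdivrMl ?normr_gt0 ?subr_eq0//.
  by rewrite mulrC.
apply: (le_trans _ (le_trans L _)); last first.
  by rewrite ler_wpM2r// lerD2r.
rewrite /bump !asboolT//.
set a := `|chart i (c s) - _|; set b := `|chart i (c t) - _|.
have ab : `|a - b| <= `|chart i (c s) - chart i (c t)|.
  rewrite (le_trans (ler_dist_dist _ _))//.
  by rewrite opprB addrA subrK.
apply: le_trans ab.
rewrite /Num.max; case: ltP => h1; case: ltP => h2; rewrite ?subrr ?normr0//.
- have -> : rho - a - (rho - b) = - (a - b) by ring.
  by rewrite normrN.
- by rewrite subr0 gtr0_norm// ler_normr; apply/orP; right; lra.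
- by rewrite sub0r normrN gtr0_norm// ler_normr; apply/orP; left; lra.
Unshelve. all: by end_near. Qed.

(** The cone has height [rho] at [y], so a point where it has lost less than [r <= rho] lies in the
    chart domain and within [r] of the centre. *)
Lemma rdist_chart_lower z (r : R) : r <= rho -> rdist y z < lam * r ->
  dom i z /\ `|chart i z - chart i y| < r.
Proof.
move=> rrho yz.
have h : `|bump z - bump y| <= lam^-1 * rdist y z.
  rewrite -ler_pdivrMl ?invr_gt0// invrK; apply: rdist_ge => s ps.
  rewrite -ler_pdivlMl//.
  apply: piecewise_C1_lipschitz ps; first by rewrite invr_ge0 ltW.
  move=> c Cc; apply: curve_lipschitz => //; first by rewrite invr_ge0 ltW.
  exact: bump_curve.
have by_ : bump y = rho.
  by rewrite /bump asboolT// subrr normr0 subr0; apply/max_idPr; exact: ltW.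
have lt : lam^-1 * rdist y z < r by rewrite ltr_pdivrMl.
have : rho - r < bump z.
  move: h; rewrite by_ ler_norml => /andP[h _]; lra.
rewrite {1}/bump; case: asboolP => [iz|_]; last by rewrite ltNge subr_ge0 rrho.
by rewrite lt_max => /orP[|]; [lra|move=> ?; split => //; lra].
Qed.

End test_function.

Lemma rdist_near x (e : R) : 0 < e -> \forall y \near x, rdist x y < e.
Proof.
move=> e0; have ix := mem_chart_at A x; set i := chart_at A x in ix.
have [rho [lam [Lam [r0 _ L0 im Gb]]]] := chart_ball ix.
have d0 : 0 < Num.min (2 * rho) (e / Lam) by rewrite lt_min mulr_gt0//= divr_gt0.
apply: filterS (near_chart ix d0) => y [iy]; rewrite lt_min => /andP[yr ye].
apply: (le_lt_trans (@rdist_le_chart i x y (2 * rho) Lam ix iy im _ (ltW yr))).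
  by move=> v /Gb h u; have /andP[] := h u.
by rewrite mulrC -ltr_pdivlMr.
Qed.

Lemma nbhs_rdist x (U : set M) : nbhs x U <-> exists2 e : R, 0 < e & forall y, rdist x y < e -> U y.
Proof.
split=> [xU|[e e0 h]]; last by apply: filterS (rdist_near x e0).
have ix := mem_chart_at A x; set i := chart_at A x in ix.
have [rho [lam [Lam [r0 l0 L0 im Gb]]]] := chart_ball ix.
have ci : {for chart i x, continuous (chart_inv i)} by apply: chart_inv_continuous; exists x.
have : nbhs (chart i x) (chart_inv i @^-1` U) by apply: ci; rewrite chartK.
move=> /nbhs_ballP[d d0 Hd].
have r20 : 0 < 2 * rho by rewrite mulr_gt0.
exists (lam * Num.min (2 * rho) d); first by rewrite mulr_gt0// lt_min r20.
move=> y xy.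
have mle : Num.min (2 * rho) d <= 2 * rho by rewrite ge_min lexx.
have [iy] := @rdist_chart_lower i x (2 * rho) lam ix r20 l0 im
  (fun v h u => (andP (Gb v h u)).1) y _ mle xy.
rewrite lt_min => /andP[_ yd].
rewrite -(chartK iy); apply: Hd.
by rewrite -ball_normE/= distrC.
Qed.

Lemma rdist_eq0 x y : rdist x y = 0 -> x = y.
Proof.
move=> xy; have := @manifold_hausdorff R n M; apply => U V xU yV.
have /nbhs_rdist[e e0 h] := xU.
by exists y; split; [apply: h; rewrite xy|exact: nbhs_singleton].
Qed.

End riemannian_distance.

(** * Compactness: uniform continuity and finite nets *)

Section compactness.
Context (R : realType) (n : nat) (M : closed_riemannian_manifold R n).
Notation A := (atlas M).
Notation G := (gram (metric M)).
Implicit Types (x y z : M).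

Lemma finite_cover (U : M -> set M) : (forall x, nbhs x (U x)) ->
  exists s : seq M, forall z, exists2 x, x \in s & U x z.
Proof.
move=> nU; have := @manifold_compact R n M; rewrite compact_cover => /(_ M setT (fun x => (U x)^°)).
case.
- by move=> i _; exact: open_interior.
- by move=> z _; exists z => //; exact: nU.
- move=> D _ cov; exists (finmap.enum_fset D) => z.
  have [x xD Uz] := cov z I; exists x => //.
  exact: (@interior_subset _ (U x)).
Qed.

Lemma lebesgue_number (V : M -> set M) : (forall x, nbhs x (V x)) ->
  exists2 d : R, 0 < d & forall y z, rdist y z < d -> exists x, V x y /\ V x z.
Proof.
move=> nV.
have H x : {d : R | 0 < d & forall y, rdist x y < 2 * d -> V x y}.
  apply: cid2; have /nbhs_rdist[d d0 Hd] := nV x.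
  by exists (d / 2) => [|y yd]; [rewrite divr_gt0|apply: Hd; lra].
pose d x := s2val (H x).
have d0 x : 0 < d x := s2valP (H x).
have Hd x : forall y, rdist x y < 2 * d x -> V x y := s2valP' (H x).
have [s Hs] := @finite_cover (fun x => [set y | rdist x y < d x])
  (fun x => rdist_near x (d0 x)).
pose dm := \big[Num.min/1]_(x <- s) d x.
have dm0 : 0 < dm.
  rewrite /dm; elim: s {Hs dm} => [|x s IH]; first by rewrite big_nil.
  by rewrite big_cons lt_min d0.
have dmle x : x \in s -> dm <= d x.
  rewrite /dm; elim: s {Hs dm dm0} => [//|y s IH].
  rewrite inE big_cons ge_min => /predU1P[->|/IH ->]; first by rewrite lexx.
  by rewrite orbT.
exists dm => // y z yz; have [x xs /= xy] := Hs y.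
exists x; split; apply: Hd; first by have := d0 x; lra.
by have := rdist_triangle y x z; have := dmle x xs; lra.
Qed.

Lemma continuous_uniformly (g : M -> R) : continuous g -> forall e : R, 0 < e ->
  exists2 d : R, 0 < d & forall x y, rdist x y < d -> `|g x - g y| < e.
Proof.
move=> cg e e0; have e20 : 0 < e / 2 by rewrite divr_gt0.
have [d d0 Hd] := @lebesgue_number (fun x => [set y | `|g x - g y| < e / 2])
  (fun x => (cvgrPdist_lt _ _).1 (cg x) _ e20).
exists d => // y z /Hd[x /= [xy xz]].
have -> : g y - g z = (g x - g z) - (g x - g y) by ring.
by rewrite (le_lt_trans (ler_normB _ _))// (splitr e) addrC ltrD.
Qed.

Lemma continuous_bounded (g : M -> R) : continuous g ->
  exists2 B : R, 0 < B & forall x, `|g x| <= B.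
Proof.
move=> cg.
have near1 x : nbhs x [set y | `|g x - g y| < 1].
  by have /cvgrPdist_lt /(_ _ ltr01) := cg x.
have [s Hs] := finite_cover near1.
exists (1 + \sum_(x <- s) `|g x|).
  by rewrite ltr_pwDl// sumr_ge0.
move=> z; have [x xs /= xz] := Hs z.
have : `|g x| <= \sum_(x <- s) `|g x|.
  rewrite (big_rem x xs)/= lerDl sumr_ge0//.
have -> : g z = g x - (g x - g z) by ring.
have := ler_normB (g x) (g x - g z); lra.
Qed.

Lemma ler_rdist_dist x y z : `|rdist x y - rdist x z| <= rdist y z.
Proof.
rewrite ler_norml; have := rdist_triangle y x z; have := rdist_triangle z x y.
rewrite (rdistC z y); move: (rdist x y) (rdist x z) (rdist y z) => a b c; clear => ? ?.
by apply/andP; split; lra.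
Qed.

Lemma rdist_continuous x : continuous (rdist x).
Proof.
move=> y; apply/cvgrPdist_lt => e e0; apply/nbhs_rdist; exists e => // z.
by apply: le_lt_trans; exact: ler_rdist_dist.
Qed.

Lemma rdist_bounded : exists2 D : R, 0 < D & forall x y, rdist x y <= D.
Proof.
have [B B0 HB] := continuous_bounded (@rdist_continuous point).
exists (B + B) => [|x y]; first by rewrite addr_gt0.
apply: (le_trans (rdist_triangle point x y)).
by rewrite (rdistC x); apply: lerD; apply: le_trans (HB _); exact: ler_norm.
Qed.

(** [Z] is a cubic grid in the coordinates of a chart, with [m] points per axis. *)
Lemma chart_grid x : exists2 K : R, 0 < K & exists2 U : set M, nbhs x U &
  forall m : nat, (1 < m)%N -> exists2 Z : seq M, size Z = (m ^ n)%N &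
    forall z, U z -> exists2 w, w \in Z & rdist z w <= K / m%:R.
Proof.
have ix := mem_chart_at A x; set i := chart_at A x in ix.
have [rho [lam [Lam [r0 _ L0 im Gb]]]] := chart_ball ix.
set v0 := chart i x in im Gb.
exists (Lam * (2 * rho)); first by rewrite !mulr_gt0.
exists [set z | dom i z /\ `|chart i z - v0| < rho]; first exact: near_chart.
move=> m m1.
have m0 : (0 < m)%N by exact: ltn_trans m1.
have mR0 : 0 < m%:R :> R by rewrite ltr0n.
pose g (f : {ffun 'I_n -> 'I_m}) : 'rV[R]_n :=
  \row_a (v0 0 a - rho + 2 * rho * (f a : nat)%:R / m%:R).
exists [seq chart_inv i (g f) | f <- enum {ffun 'I_n -> 'I_m}].
  by rewrite size_map -cardT card_ffun !card_ord.
move=> z [iz zr].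
pose t a := (chart i z 0 a - v0 0 a + rho) / (2 * rho) * m%:R.
have za a : `|chart i z 0 a - v0 0 a| < rho.
  by apply: le_lt_trans zr; have := le_mx_norm (chart i z - v0) 0 a; rewrite !mxE.
have t01 a : 0 <= t a < m%:R.
  have := za a; rewrite ltr_norml /t => /andP[h1 h2]; apply/andP; split.
    by apply: mulr_ge0 => //; apply: divr_ge0; lra.
  rewrite gtr_pMl// ltr_pdivrMr; lra.
have kt a : (Num.truncn (t a) < m)%N.
  by have /andP[h1 h2] := t01 a; rewrite truncn_lt_nat.
pose f : {ffun 'I_n -> 'I_m} := [ffun a => Ordinal (kt a)].
have gz : `|g f - chart i z| <= 2 * rho / m%:R.
  apply: mx_norm_le => [|j a]; first by rewrite divr_ge0 ?mulr_ge0// ltW.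
  rewrite ord1 !mxE ffunE/=.
  have /andP[h1 h2] := t01 a; have /andP[l1 l2] := truncn_itv h1.
  set k := (Num.truncn _)%:R in l1 *; rewrite -natr1 in l2.
  have Et : chart i z 0 a = v0 0 a - rho + 2 * rho * (t a) / m%:R.
    by rewrite /t; field; rewrite !lt0r_neq0.
  rewrite Et.
  have -> : v0 0 a - rho + 2 * rho * k / m%:R - (v0 0 a - rho + 2 * rho * t a / m%:R)
     = (2 * rho / m%:R) * (k - t a) by field; exact: lt0r_neq0.
  have rm0 : 0 <= 2 * rho / m%:R by rewrite divr_ge0// mulr_ge0// ltW.
  rewrite normrM (ger0_norm rm0) -[leRHS]mulr1 ler_wpM2l//.
  by rewrite ler_norml; apply/andP; split; lra.
(* Here [1 < m] matters: the chosen grid point is within [rho] of [chart i z], so the segment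
   joining them stays in the ball of radius [2 * rho] where the metric is controlled. *)
have small : 2 * rho / m%:R <= rho.
  rewrite ler_pdivrMr// mulrC ler_wpM2l//; first exact: ltW.
  by rewrite ler_nat.
have inball v : `|v - chart i z| <= rho -> `|v - v0| <= 2 * rho.
  move=> h; rewrite -[v](subrK (chart i z)) -addrA (le_trans (ler_normD _ _))//.
  by rewrite mulr_natl mulr2n lerD// ltW.
have gim : (chart i @` dom i) (g f) by apply: im; apply: inball; exact: le_trans small.
have [w iw wg] := gim.
exists (chart_inv i (g f)); first by apply: map_f; rewrite mem_enum.
rewrite -wg chartK//.
apply: le_trans.
  apply: (@rdist_le_chart _ _ _ i z w rho Lam iz iw).
  - by move=> v /inball/im.
  - by move=> v /inball/Gb h u; have /andP[] := h u.
  - by rewrite wg; exact: le_trans small.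
by rewrite wg -mulrA ler_wpM2l// ltW.
Qed.

Lemma polynomial_nets : exists D : nat, exists2 K : R, 0 < K &
  forall m : nat, (1 < m)%N -> exists2 Z : seq M, (size Z <= D * m ^ n)%N &
    forall z, exists2 w, w \in Z & rdist z w <= K / m%:R.
Proof.
have H x : {KU : R * set M | [/\ 0 < KU.1, nbhs x KU.2 &
    forall m : nat, (1 < m)%N -> exists2 Z : seq M, size Z = (m ^ n)%N &
    forall z, KU.2 z -> exists2 w, w \in Z & rdist z w <= KU.1 / m%:R]}.
  by apply: cid; have [K K0 [U xU HU]] := chart_grid x; exists (K, U).
pose K x := (sval (H x)).1; pose U x := (sval (H x)).2.
have K0 x : 0 < K x by have [] := svalP (H x).
have nU x : nbhs x (U x) by have [] := svalP (H x).
have [s Hs] := finite_cover nU.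
exists (size s), (1 + \sum_(x <- s) K x).
  by rewrite ltr_pwDl// sumr_ge0// => x _; exact: ltW.
move=> m m1.
have Z x : {Z : seq M | size Z = (m ^ n)%N & forall z, U x z -> exists2 w, w \in Z & rdist z w <= K x / m%:R}.
  by apply: cid2; have [_ _] := svalP (H x); apply.
exists (flatten [seq s2val (Z x) | x <- s]).
  rewrite size_flatten /shape -map_comp.
  rewrite (eq_map (g := fun=> (m ^ n)%N)); last by move=> x /=; exact: (s2valP (Z x)).
  by elim: (s) => //= _ s' IH; rewrite mulSn leq_add2l.
move=> z; have [x xs Uz] := Hs z.
have [w wZ zw] := s2valP' (Z x) z Uz.
exists w; first by apply/flattenP; exists (s2val (Z x)) => //; exact: map_f.
apply: (le_trans zw); rewrite ler_wpM2r// (big_rem x xs)/=.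
by rewrite addrCA lerDl addr_ge0// sumr_ge0// => y _; exact: ltW.
Qed.

(** The radius is half of the scale so that, seen from any point, some net point is clearly closer
    than those at distance [expR (- j%:R)]; the softmax then favours it. *)
Lemma exponential_nets : exists2 B : R, 0 <= B &
  forall j : nat, exists Z : seq M, [/\ (0 < size Z)%N,
    (size Z)%:R <= expR (n%:R * j%:R + B) &
    forall z, exists2 w, w \in Z & rdist z w <= expR (- j%:R) / 2].
Proof.
have [D [K K0 HD]] := polynomial_nets.
pose C : R := D%:R * (2 * K + 2) ^+ n + 1.
have C0 : 1 <= C by rewrite lerDr mulr_ge0// exprn_ge0//; lra.
have C0' : 0 < C by exact: lt_le_trans C0.
exists (ln C); first exact: ln_ge0.
(* [m] is of order 2 K e^j, so that K / m is at most half of e^-j; adding 2 also ensures [1 < m]. *)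
move=> j; pose m := (Num.truncn (2 * K * expR j%:R)).+2.
have [Z sZ HZ] := HD m isT.
have E0 : 0 < expR (j%:R : R) by exact: expR_gt0.
have E1 : 1 <= expR (j%:R : R) by rewrite -expR0 ler_expR.
have KE0 : 0 <= 2 * K * expR j%:R by rewrite !mulr_ge0// ltW.
have mge : 2 * K * expR j%:R <= m%:R.
  rewrite /m -natr1; have := truncnS_gt (2 * K * expR j%:R); lra.
have mle : m%:R <= (2 * K + 2) * expR j%:R.
  rewrite /m -addn2 natrD.
  have : (Num.truncn (2 * K * expR j%:R))%:R <= 2 * K * expR j%:R by rewrite truncn_le.
  lra.
have mR0 : 0 < m%:R :> R by rewrite ltr0n.
exists Z; split.
- by have [w] := HZ point; case: (Z).
- apply: (@le_trans _ _ (D%:R * m%:R ^+ n)); first by rewrite -natrX -natrM ler_nat.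
  rewrite expRD lnK ?posrE// expRM_natl.
  apply: (@le_trans _ _ (D%:R * ((2 * K + 2) * expR j%:R) ^+ n)).
    rewrite ler_wpM2l// lerXn2r// nnegrE; first exact: ltW.
    by apply: mulr_ge0; [lra|exact: ltW].
  rewrite exprMn mulrA [leRHS]mulrC ler_wpM2r//.
  by rewrite /C lerDl.
- move=> z; have [w wZ zw] := HZ z; exists w => //.
  apply: (le_trans zw); rewrite ler_pdivrMr// expRN.
  by rewrite mulrAC ler_pdivlMr// ler_pdivlMl//; lra.
Qed.

End compactness.

(** * Averages of bounded continuous functions *)

Section bounded_continuous.
Context {R : realType} {T : topologicalType}.
Implicit Types f g : T -> R.

Definition bcont f := continuous f /\ exists B : R, forall x, `|f x| <= B.

Lemma bcont_cst (a : R) : bcont (fun=> a).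
Proof. by split; [move=> x; exact: cvg_cst|exists `|a|]. Qed.

Lemma bcontD f g : bcont f -> bcont g -> bcont (fun x => f x + g x).
Proof.
move=> [cf [B fB]] [cg [C gC]]; split; first by move=> x; apply: cvgD; [exact: cf|exact: cg].
by exists (B + C) => x; rewrite (le_trans (ler_normD _ _))// lerD.
Qed.

Lemma bcontM f g : bcont f -> bcont g -> bcont (fun x => f x * g x).
Proof.
move=> [cf [B fB]] [cg [C gC]]; split; first by move=> x; apply: cvgM; [exact: cf|exact: cg].
by exists (B * C) => x; rewrite normrM ler_pM.
Qed.

Lemma bcontZ (a : R) f : bcont f -> bcont (fun x => a * f x).
Proof. by move=> bf; apply: bcontM => //; exact: bcont_cst. Qed.

Lemma bcontN f : bcont f -> bcont (fun x => - f x).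
Proof.
move=> /(bcontZ (-1)); congr bcont; apply/funext => x; by rewrite mulN1r.
Qed.

Lemma bcontB f g : bcont f -> bcont g -> bcont (fun x => f x - g x).
Proof. by move=> bf bg; apply: bcontD => //; exact: bcontN. Qed.

Lemma bcont_norm f : bcont f -> bcont (fun x => `|f x|).
Proof.
move=> [cf [B fB]]; split; first by move=> x; apply: cvg_norm; exact: cf.
by exists B => x; rewrite normr_id.
Qed.

Lemma bcont_pos f : bcont f -> bcont (fun x => Num.max 0 (f x)).
Proof.
move=> bf; have E : (fun x => Num.max 0 (f x)) = (fun x => 2^-1 * (f x + `|f x|)).
  apply/funext => x; case: (leP 0 (f x)) => h.
    by rewrite ger0_norm//; lra.
  by rewrite ltr0_norm//; lra.
by rewrite E; apply: bcontZ; apply: bcontD => //; exact: bcont_norm.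
Qed.

Lemma bcont_sum (I : Type) (r : seq I) (F : I -> T -> R) :
  (forall i, bcont (F i)) -> bcont (fun x => \sum_(i <- r) F i x).
Proof.
move=> bF; elim: r => [|i r IH].
  have -> : (fun x => \sum_(i <- [::]) F i x) = (fun=> 0).
    by apply/funext => x; rewrite big_nil.
  exact: bcont_cst.
have -> : (fun x => \sum_(j <- i :: r) F j x) = (fun x => F i x + \sum_(j <- r) F j x).
  by apply/funext => x; rewrite big_cons.
exact: bcontD.
Qed.

Lemma bcontX f (k : nat) : bcont f -> bcont (fun x => f x ^+ k).
Proof.
move=> bf; elim: k => [|k IH]; first exact: bcont_cst.
have -> : (fun x => f x ^+ k.+1) = (fun x => f x * f x ^+ k).
  by apply/funext => x; rewrite exprS.
exact: bcontM.
Qed.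

Lemma bcont_min1 f (k : R) : bcont f -> bcont (fun x => Num.min k (f x)).
Proof.
move=> bf; have E : (fun x => Num.min k (f x)) = (fun x => f x - Num.max 0 (f x - k)).
  by apply/funext => x; case: leP => h1; case: leP => h2; lra.
by rewrite E; apply: bcontB => //; apply: bcont_pos; apply: bcontB => //; exact: bcont_cst.
Qed.

(* Measures enter the argument only through the averages of bounded continuous functions, for which ultralimits are pointwise limits; they are turned back into measures at the very end. *)
Definition averaging (J : (T -> R) -> R) : Prop :=
  [/\ forall (a : R) f g, bcont f -> bcont g -> J (fun x => a * f x + g x) = a * J f + J g,
      forall f, bcont f -> (forall x, 0 <= f x) -> 0 <= J f &
      J (fun=> 1) = 1].

Section averaging_theory.
Variables (J : (T -> R) -> R) (EJ : averaging J).

Lemma averaging_cst (a : R) : J (fun=> a) = a.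
Proof.
have [L _ J1] := EJ.
have J0 : J (fun=> 0) = 0.
  have := L 1 (fun=> 0) (fun=> 0) (bcont_cst 0) (bcont_cst 0).
  have -> : (fun _ : T => 1 * 0 + 0 : R) = (fun=> 0) by apply/funext => x; rewrite mulr0 addr0.
  lra.
have := L a (fun=> 1) (fun=> 0) (bcont_cst 1) (bcont_cst 0).
have -> : (fun _ : T => a * 1 + 0 : R) = (fun=> a) by apply/funext => x; rewrite mulr1 addr0.
by rewrite J1 J0 mulr1 addr0.
Qed.

Lemma averagingD f g : bcont f -> bcont g -> J (fun x => f x + g x) = J f + J g.
Proof.
have [L _ _] := EJ => bf bg; rewrite -[J f]mul1r -L//; congr J.
by apply/funext => x; rewrite mul1r.
Qed.

Lemma averagingZ (a : R) f : bcont f -> J (fun x => a * f x) = a * J f.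
Proof.
have [L _ _] := EJ => bf.
rewrite -[RHS]addr0 -(averaging_cst 0) -L//; last exact: bcont_cst.
by congr J; apply/funext => x; rewrite addr0.
Qed.

Lemma averagingZr (a : R) f : bcont f -> J (fun x => f x * a) = J f * a.
Proof.
move=> bf; rewrite mulrC -averagingZ//; congr J; apply/funext => x; exact: mulrC.
Qed.

Lemma averagingB f g : bcont f -> bcont g -> J (fun x => f x - g x) = J f - J g.
Proof.
move=> bf bg; rewrite -[- J g]mulN1r -averagingZ// -averagingD//; last exact: bcontZ.
by congr J; apply/funext => x; rewrite mulN1r.
Qed.

Lemma averaging_ge0 f : bcont f -> (forall x, 0 <= f x) -> 0 <= J f.
Proof. by have [_ P _] := EJ; exact: P. Qed.

Lemma le_averaging f g : bcont f -> bcont g -> (forall x, f x <= g x) -> J f <= J g.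
Proof.
move=> bf bg fg; rewrite -subr_ge0 -averagingB//; apply: averaging_ge0.
  exact: bcontB.
by move=> x; rewrite subr_ge0.
Qed.

Lemma averaging_le f (b : R) : bcont f -> (forall x, f x <= b) -> J f <= b.
Proof.
move=> bf fb; rewrite -(averaging_cst b); apply: le_averaging => //; exact: bcont_cst.
Qed.

Lemma le_norm_averaging f : bcont f -> `|J f| <= J (fun x => `|f x|).
Proof.
move=> bf; have bn := bcont_norm bf; rewrite ler_norml; apply/andP; split.
  rewrite -mulN1r -averagingZ//; apply: le_averaging => //; first exact: bcontZ.
  by move=> x; rewrite mulN1r lerNl -normrN; exact: ler_norm.
by apply: le_averaging => // x; exact: ler_norm.
Qed.

Lemma averaging_sum (I : Type) (r : seq I) (F : I -> T -> R) :
  (forall i, bcont (F i)) ->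
  J (fun x => \sum_(i <- r) F i x) = \sum_(i <- r) J (F i).
Proof.
move=> bF; elim: r => [|i r IH].
  rewrite big_nil -[RHS](averaging_cst 0); congr J.
  by apply/funext => x; rewrite big_nil.
rewrite big_cons -IH -averagingD//; last exact: bcont_sum.
by congr J; apply/funext => x; rewrite big_cons.
Qed.

End averaging_theory.
End bounded_continuous.

Section borel_averaging.
Context {R : realType} {T : ptopologicalType}.

Lemma open_borel (U : set T) : open U -> measurable (U : set (borel T)).
Proof. by move=> oU; apply: sub_sigma_algebra. Qed.

Lemma continuous_borel (g : T -> R) : continuous g ->
  measurable_fun setT (g : borel T -> R).
Proof.
move=> /continuousP cg; apply: (measurability _ (RGenOpens.measurableE R)).
move=> _ [_ [a [b ->] <-]]; rewrite setTI; apply: open_borel.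
by apply: cg; exact: interval_open.
Qed.

Variable mu : borel_prob T R.

Lemma bcont_integrable (g : T -> R) : bcont g -> mu.-integrable setT (EFin \o g).
Proof.
move=> [cg [B gB]]; apply: measurable_bounded_integrable => //.
- exact: (le_lt_trans (probability_le1 mu measurableT) (ltry 1)).
- exact: continuous_borel.
- exists B; split; first exact: num_real.
  by move=> C BC x _ /=; apply: le_trans (gB x) _; exact: ltW.
Qed.

Definition mean (g : T -> R) : R := \int[mu]_x g x.

Lemma mean_averaging : averaging mean.
Proof.
split.
- move=> a f g bf bg; rewrite /mean RintegralD//.
  + by rewrite RintegralZl//; exact: bcont_integrable.
  + by have := bcont_integrable (bcontZ a bf).
  + exact: bcont_integrable.
- by move=> f bf f0; apply: Rintegral_ge0.
- by rewrite /mean Rintegral_cst//= probability_setT mulr1.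
Qed.

Lemma meanE (g : T -> R) : bcont g -> (\int[mu]_x (g x)%:E)%E = (mean g)%:E.
Proof.
move=> bg; rewrite /mean /Rintegral fineK//.
exact: integrable_fin_num (bcont_integrable bg).
Qed.

End borel_averaging.

(* The integral of a nonnegative function is monotone even without measurability, being a supremum over simple functions. *)
Lemma ge0_le_integral_nomeas d (T : measurableType d) (R : realType) (mu : {measure set T -> \bar R})
    (D : set T) (f g : T -> \bar R) :
  (forall x, D x -> 0 <= f x)%E -> (forall x, D x -> f x <= g x)%E ->
  (\int[mu]_(x in D) f x <= \int[mu]_(x in D) g x)%E.
Proof.
move=> f0 fg.
have g0 x : D x -> (0 <= g x)%E by move=> Dx; apply: le_trans (fg _ Dx); exact: f0.
rewrite integral_mkcond [leRHS]integral_mkcond.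
have p0 (h : T -> \bar R) : (forall x, D x -> 0 <= h x)%E -> forall x, (0 <= (h \_ D) x)%E.
  by move=> h0 x; rewrite patchE; case: ifPn => //; rewrite inE => /h0.
rewrite !ge0_integralTE; [|exact: p0|exact: p0].
apply: ereal_sup_le => _ [h hf <-]; exists h => //= x; apply: le_trans (hf x) _.
by rewrite !patchE; case: ifPn => //; rewrite inE => /fg.
Qed.

(** * The homeomorphism group: separability, push-forwards and supports *)

Section homeomorphisms.
Context (R : realType) (n : nat) (M : closed_riemannian_manifold R n).
Implicit Types (f g : homeo M) (x y z : M) (J : (M -> R) -> R).

Lemma open_homeoE (O : set (homeo M)) : open O <-> uniform_open O.
Proof. by []. Qed.

Lemma nbhs_homeo f (U : set (homeo M)) : nbhs f U <->
  exists2 e : R, 0 < e & forall g, (forall x, rdist (f x) (g x) < e) -> U g.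
Proof.
split=> [|[e e0 H]].
  rewrite nbhsE => -[V [oV Vf] VU].
  have [e e0 H] := (open_homeoE V).1 oV f Vf.
  by exists e => // g /H/VU.
(* The slack between [r] and [e] makes this set visibly open: a move by half of it stays inside. *)
pose V := [set g : homeo M | exists2 r : R, r < e & forall x, rdist (f x) (g x) <= r].
have oV : open V.
  apply/open_homeoE => g [r re Hr]; exists ((e - r) / 2).
    by rewrite divr_gt0// subr_gt0.
  move=> h gh; exists ((e + r) / 2); first lra.
  move=> x; have := rdist_triangle (g x) (f x) (h x); have := Hr x; have := gh x; lra.
rewrite nbhsE; exists V.
  by split=> //; exists 0 => // x; rewrite rdistxx.
by move=> g [r re Hr]; apply: H => x; exact: le_lt_trans (Hr x) re.
Qed.

Lemma homeo_uniformly f (e : R) : 0 < e ->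
  exists2 d : R, 0 < d & forall x y, rdist x y < d -> rdist (f x) (f y) < e.
Proof.
move=> e0; have e20 : 0 < e / 2 by rewrite divr_gt0.
have nf x : nbhs x [set y | rdist (f x) (f y) < e / 2].
  exact: (@homeo_continuous _ _ _ f x _ (rdist_near (f x) e20)).
have [d d0 Hd] := lebesgue_number nf.
exists d => // y z /Hd[x /= [xy xz]].
have := rdist_triangle (f x) (f y) (f z); rewrite (rdistC (f y) (f x)); lra.
Qed.

Lemma finite_net (e : R) : 0 < e -> exists Z : seq M, forall x, exists2 z, z \in Z & rdist z x < e.
Proof. by move=> e0; have := finite_cover (fun x : M => rdist_near x e0). Qed.

(* A homeomorphism is determined up to e by a modulus of continuity and a choice of net points for the images of a finite net; there are countably many such data. *)
Lemma homeo_nets (e : R) : 0 < e -> exists F : nat -> homeo M,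
  forall f, exists i, forall x, rdist (F i x) (f x) < e.
Proof.
move=> e0; have e80 : 0 < e / 8 by rewrite divr_gt0.
have e40 : 0 < e / 4 by rewrite divr_gt0.
have [W HW] := finite_net e80.
pose idx y := find (fun w => rdist w y < e / 8) W.
have Hidx y : rdist (nth point W (idx y)) y < e / 8.
  have [w wW wy] := HW y.
  have : has (fun w => rdist w y < e / 8) W by apply/hasP; exists w.
  by move=> /(nth_find point).
have net m : {Z : seq M | forall x, exists2 z, z \in Z & rdist z x < m.+1%:R^-1}.
  by apply: cid; apply: finite_net; rewrite invr_gt0.
pose good (f : homeo M) m (s : seq nat) :=
  (forall x y, rdist x y < m.+1%:R^-1 -> rdist (f x) (f y) < e / 4) /\
  s = [seq idx (f z) | z <- sval (net m)].
(* Some homeomorphism whose data are encoded by [k], if there is one; the identity is a filler. *)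
pose F k := if unpickle k is Some (m, s) then
  (if pselect (exists f, good f m s) is left h then sval (cid h) else homeo_id M)
  else homeo_id M.
exists F => f.
have [d d0 Hd] := homeo_uniformly f e40.
pose m := Num.truncn d^-1.
have md : m.+1%:R^-1 < d.
  by rewrite invf_plt ?posrE//; exact: truncnS_gt.
pose s := [seq idx (f z) | z <- sval (net m)].
have gf : good f m s by split=> // x y xy; apply: Hd; exact: lt_trans md.
exists (pickle (m, s)) => x; rewrite /F pickleK.
case: pselect => [h|]; last by case; exists f.
have [mod_ codes] := svalP (cid h); set g := sval (cid h) in mod_ codes *.
have [z zZ zx] := svalP (net m) x.
have gz : idx (g z) = idx (f z).
  have := codes; rewrite /s => /esym /eq_in_map; exact.
have zx' : rdist z x < d by exact: lt_trans md.
have := mod_ z x zx; have := Hd z x zx'.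
have := Hidx (g z); have := Hidx (f z); rewrite gz; set w := nth _ _ _.
have := rdist_triangle (g z) (g x) (f x); have := rdist_triangle w (g z) (f x).
have := rdist_triangle (f z) w (f x).
rewrite (rdistC (g x) (g z)) (rdistC (g z) w); lra.
Qed.

Lemma bcont_continuous (g : M -> R) : continuous g -> bcont g.
Proof. by move=> cg; split=> //; have [B B0 HB] := continuous_bounded cg; exists B. Qed.

Lemma homeo_comp_continuous (g : M -> R) f : continuous g -> continuous (g \o f).
Proof.
by move=> cg x; apply: continuous_comp; [exact: homeo_continuous|exact: cg].
Qed.

Lemma bcont_homeo (g : M -> R) f : bcont g -> bcont (g \o f).
Proof. by move=> [cg _]; apply: bcont_continuous; exact: homeo_comp_continuous. Qed.

Lemma push_averaging J f : averaging J -> averaging (fun g : M -> R => J (g \o f)).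
Proof.
move=> EJ; split.
- by move=> a g h bg bh; have [L _ _] := EJ; apply: L; exact: bcont_homeo.
- move=> g bg g0; apply: (averaging_ge0 EJ); first exact: bcont_homeo.
  by move=> x; exact: g0.
- by have [_ _ J1] := EJ.
Qed.

(** [d] depends neither on [J] nor on [f]. This is what later turns closeness on average into
    closeness at each point of a support. *)
Lemma push_equicontinuous (g : M -> R) (e : R) : continuous g -> 0 < e ->
  exists2 d : R, 0 < d & forall J f f', averaging J ->
    (forall x, rdist (f x) (f' x) < d) -> `|J (g \o f) - J (g \o f')| <= e.
Proof.
move=> cg e0; have [d d0 Hd] := continuous_uniformly cg e0.
exists d => // J f f' EJ ff'.
have bg := bcont_continuous cg.
have b1 := bcont_homeo f bg; have b2 := bcont_homeo f' bg.
rewrite -(averagingB EJ b1 b2).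
apply: le_trans (le_norm_averaging EJ _) _; first exact: bcontB.
apply: (averaging_le EJ); first by apply: bcont_norm; exact: bcontB.
by move=> x; apply: ltW; exact: Hd.
Qed.

Lemma bcont_push J (g : M -> R) : averaging J -> bcont g ->
  bcont (fun f => J (g \o f)).
Proof.
move=> EJ bg; have [cg [B gB]] := bg; split.
  move=> f; apply/(@cvgrPdist_le _ _ _ (nbhs f) (nbhs_filter f)) => e e0; have [d d0 Hd] := push_equicontinuous cg e0.
  by apply/nbhs_homeo; exists d => // f' ff'; exact: Hd.
exists B => f; have bgf := bcont_homeo f bg.
apply: (le_trans (le_norm_averaging EJ bgf)).
apply: (averaging_le EJ) => [|x]; first exact: bcont_norm.
exact: gB.
Qed.

Definition conv_mean (P : (homeo M -> R) -> R) J (g : M -> R) : R :=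
  P (fun f => J (g \o f)).

Lemma conv_averaging (P : (homeo M -> R) -> R) J :
  averaging P -> averaging J -> averaging (conv_mean P J).
Proof.
move=> EP EJ; split.
- move=> a g h bg bh; have [L _ _] := EP; rewrite /conv_mean -L; try exact: bcont_push.
  congr P; apply/funext => f; have [L' _ _] := EJ; rewrite -L'//; exact: bcont_homeo.
- move=> g bg g0; apply: (averaging_ge0 EP); first exact: bcont_push.
  by move=> f; apply: (averaging_ge0 EJ); [exact: bcont_homeo|move=> x; exact: g0].
- rewrite /conv_mean -[RHS](averaging_cst EP); congr P; apply/funext => f.
  by have [_ _ J1] := EJ; exact: J1.
Qed.

(** The interior is taken so that openness is immediate; [mem_hball] recovers the ball of half the
    radius. *)
Definition hball f (e : R) : set (homeo M) := (fun g => forall x, rdist (f x) (g x) < e)^°.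

Lemma open_hball f e : open (hball f e).
Proof. exact: open_interior. Qed.

Lemma hball_sub f g e x : hball f e g -> rdist (f x) (g x) < e.
Proof. by move=> /interior_subset. Qed.

Lemma mem_hball f g (e : R) : (forall x, rdist (f x) (g x) < e / 2) -> hball f e g.
Proof.
move=> fg; have e0 : 0 < e.
  by have := fg point; have := rdist_ge0 (f point) (g point); lra.
apply/nbhs_homeo; exists (e / 2); first by rewrite divr_gt0.
move=> h gh x; have := rdist_triangle (g x) (f x) (h x); have := fg x; have := gh x; lra.
Qed.

Variable mu : borel_prob (homeo M) R.

Lemma open_msupportC : open (~` msupport mu).
Proof.
rewrite openE => f nf.
have [U [oU [Uf mU]]] : exists U : set (homeo M), open U /\ U f /\ ~ (0 < mu U)%E.
  apply: contrapT => H; apply: nf => U oU Uf; apply: contrapT => mU; apply: H.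
  by exists U.
rewrite /interior nbhsE; exists U; first by split.
by move=> g Ug /(_ U oU Ug).
Qed.

(** True because the group is separable: a point off the support has a null neighbourhood, inside
    which one of the countably many balls [B m i] contains the point, and the null ones among these
    balls have a null union. *)
Lemma msupportC0 : mu (~` msupport mu) = 0%E.
Proof.
have mS : measurable (~` msupport mu : set (borel (homeo M))).
  by apply: open_borel; exact: open_msupportC.
apply/(negligibleP mu mS).
have nets m : {F : nat -> homeo M | forall f, exists i, forall x, rdist (F i x) (f x) < m.+1%:R^-1}.
  by apply: cid; apply: homeo_nets; rewrite invr_gt0.
pose B m i : set (homeo M) := hball (sval (nets m) i) (2 / m.+1%:R).
pose N m i : set (homeo M) := if mu (B m i) == 0%E then B m i else set0.
have NN : mu.-negligible (\bigcup_m \bigcup_i N m i : set (borel (homeo M))).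
  apply: negligible_bigcup => m; apply: negligible_bigcup => i; rewrite /N.
  case: eqP => [h|_]; last exact: negligible_set0.
  by apply/negligibleP => //; apply: open_borel; exact: open_hball.
suff sub (f : homeo M) : (~` msupport mu) f -> (\bigcup_m \bigcup_i N m i) f.
  by apply: (negligibleS _ NN); exact: sub.
move=> nf.
have [U [oU [Uf mU]]] : exists U : set (homeo M), open U /\ U f /\ ~ (0 < mu U)%E.
  apply: contrapT => H; apply: nf => U oU Uf; apply: contrapT => mU; apply: H.
  by exists U.
have [e e0 HU] := (open_homeoE U).1 oU f Uf.
pose m := Num.truncn (4 / e).
have m0 : 0 < m.+1%:R^-1 :> R by rewrite invr_gt0.
have me : 4 * m.+1%:R^-1 < e.
  have : 4 / e < m.+1%:R by exact: truncnS_gt.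
  by rewrite ltr_pdivrMr// mulrC -ltr_pdivrMr.
have [i Hi] := svalP (nets m) f.
exists m => //; exists i => //.
have Bf : B m i f.
  by apply: mem_hball => x; rewrite mulrAC mulfV// mul1r; exact: Hi.
have BU : B m i `<=` U.
  move=> g Bg; apply: HU => x.
  pose q : R := m.+1%:R^-1.
  have h1 : rdist (sval (nets m) i x) (g x) < 2 * q := hball_sub x Bg.
  have h2 : rdist (sval (nets m) i x) (f x) < q := Hi x.
  have h3 := rdist_triangle (sval (nets m) i x) (f x) (g x).
  rewrite (rdistC (f x) (sval (nets m) i x)) in h3.
  have h4 : 4 * q < e := me.
  have h5 : 0 < q := m0.
  clearbody q; move: h1 h2 h3 h4 h5; clear; lra.
rewrite /N; case: eqP => // nz; exfalso; apply: mU.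
rewrite lt0e measure_ge0 andbT; apply/eqP => U0; apply: nz.
apply/eqP; rewrite eq_le measure_ge0 andbT -U0; apply: le_measure; rewrite ?inE//.
- by apply: open_borel; exact: open_hball.
- exact: open_borel.
Qed.

(** The support is a convenient domain of integration: it is closed, hence measurable, and carries
    all the mass. *)
Lemma mean_msupport (h : homeo M -> R) : bcont h -> (forall f, 0 <= h f) ->
  ((mean mu h)%:E = \int[mu]_(f in msupport mu) (h f)%:E)%E.
Proof.
move=> bh h0; rewrite -meanE//.
have mS : measurable (~` msupport mu : set (borel (homeo M))).
  by apply: open_borel; exact: open_msupportC.
rewrite (negligible_integral mS _ (bcont_integrable mu bh) msupportC0)//.
by rewrite setTD setCK.
Qed.

End homeomorphisms.

(** * Convolutions as Borel probability measures *)

Section convolution_measure.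
Context (R : realType) (n : nat) (M : closed_riemannian_manifold R n).
Variable mu : borel_prob (homeo M) R.

Definition evaluation (p : borel (homeo M) * borel M) : borel M := (p.1 : homeo M) p.2.

(** Measurability refers to the product of the two Borel sigma-algebras, so continuity alone does
    not give it. By separability the preimage of an open set is a countable union of measurable
    rectangles. *)
Lemma measurable_evaluation : measurable_fun setT evaluation.
Proof.
apply: (@measurability _ _ _ _ setT evaluation (@open M) erefl).
move=> _ [U oU <-]; rewrite setTI.
have nets m : {F : nat -> homeo M | forall f : homeo M, exists i, forall x, rdist (F i x) (f x) < (2 * m.+1%:R)^-1}.
  by apply: cid; apply: homeo_nets; rewrite invr_gt0.
pose r m : R := m.+1%:R^-1.
pose B m i : set (borel (homeo M)) := hball (sval (nets m) i) (r m).
(* For [f] in [B m i] and [y] in [Y m i], the point [f y] is within [r m] of the image of [y] under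
   the net element, hence in [U]. *)
pose Y m i : set (borel M) := [set y | forall w, rdist (sval (nets m) i y) w < r m -> U w].
have mB m i : measurable (B m i) by apply: open_borel; exact: open_hball.
have mY m i : measurable (Y m i).
  rewrite -[Y m i]setCK; apply: measurableC; apply: open_borel.
  have -> : ~` Y m i = \bigcup_(w in ~` U) (sval (nets m) i @^-1` [set z | rdist w z < r m]).
    apply/seteqP; split => y /=.
      move=> nY; apply: contrapT => H; apply: nY => w yw; apply: contrapT => nUw.
      by apply: H; exists w => //=; rewrite rdistC.
    by move=> [w nUw /= yw] H; apply: nUw; apply: H; rewrite rdistC.
  apply: bigcup_open => w _; apply: open_comp => [x _|]; first exact: homeo_continuous.
  have := @rdist_continuous _ _ _ w => /continuousP /(_ _ (@open_lt R (r m))).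
  exact.
have -> : evaluation @^-1` U = \bigcup_m \bigcup_i (B m i `*` Y m i).
  apply/seteqP; split => -[f x] /=.
    rewrite /evaluation/= => Ufx.
    have /nbhs_rdist[e e0 He] : nbhs ((f : homeo M) x) U by apply: open_nbhs_nbhs.
    pose m := Num.truncn (4 / e).
    have m0 : 0 < m.+1%:R^-1 :> R by rewrite invr_gt0.
    have me : 4 * m.+1%:R^-1 < e.
      have : 4 / e < m.+1%:R by exact: truncnS_gt.
      by rewrite ltr_pdivrMr// mulrC -ltr_pdivrMr.
    have [i Hi] := svalP (nets m) f.
    have H2 : (2 * m.+1%:R)^-1 = m.+1%:R^-1 / 2 :> R by rewrite invfM mulrC.
    exists m => //; exists i => //; split=> /=.
      by apply: mem_hball => y; rewrite -H2; exact: Hi.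
    move=> w wr; apply: He.
    pose q : R := m.+1%:R^-1; pose F := sval (nets m) i.
    have h1 : rdist (F x) ((f : homeo M) x) < q / 2 by rewrite -H2; exact: Hi.
    have h2 : rdist (F x) w < q := wr.
    have h3 := rdist_triangle (F x) ((f : homeo M) x) w.
    rewrite (rdistC ((f : homeo M) x) (F x)) in h3.
    have h4 : 4 * q < e := me.
    have h5 : 0 < q := m0.
    clearbody q; move: h1 h2 h3 h4 h5; clear; lra.
  move=> [m _ [i _ /= [Bf Yx]]]; rewrite /evaluation/=; apply: Yx.
  exact: hball_sub.
apply: bigcupT_measurable => m; apply: bigcupT_measurable => i.
exact: measurableX.
Qed.

Variable nu : borel_prob M R.

(** The law of [f x] for independent [f] and [x]; it equals the convolution because the product
    measure is defined through sections. *)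
Let P := pushforward (mu \x nu)%E evaluation.

Let me (A : set (borel M)) : measurable A -> measurable (evaluation @^-1` A).
Proof. by move=> mA; rewrite -[X in measurable X]setTI; exact: measurable_evaluation. Qed.

Let P0 : P set0 = 0%E.
Proof. by rewrite /P /pushforward preimage_set0 measure0. Qed.

Let P_ge0 A : (0 <= P A)%E.
Proof. exact: (@measure_ge0 _ _ _ (mu \x nu)%E). Qed.

Let P_sigma_additive : semi_sigma_additive P.
Proof.
move=> F mF tF mUF; rewrite /P /pushforward preimage_bigcup.
apply: measure_semi_sigma_additive.
- by move=> i; exact: me.
- apply/trivIsetP => /= i j _ _ ij; rewrite -preimage_setI.
  by move/trivIsetP : tF => /(_ _ _ _ _ ij) ->//; rewrite preimage_set0.
- by rewrite -preimage_bigcup; exact: me.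
Qed.

HB.instance Definition _ := isMeasure.Build _ _ _ P P0 P_ge0 P_sigma_additive.

Let convolE : convol mu nu = P.
Proof.
apply/funext => A; rewrite /convol /P /pushforward /product_measure1 /=.
apply: eq_integral => f _ /=; congr (nu _); apply/seteqP; split=> x.
  by rewrite /xsection/= => Afx; rewrite inE.
by rewrite /xsection/= inE.
Qed.

Let P_setT : P setT = 1%E.
Proof.
rewrite -convolE /convol (eq_integral (cst 1%E)).
  by rewrite integral_cst// mul1e; exact: probability_setT.
by move=> f _; rewrite preimage_setT; exact: probability_setT.
Qed.

HB.instance Definition _ := Measure_isProbability.Build _ _ _ P P_setT.

Lemma convol_probability : exists Q : borel_prob M R, convol mu nu = Q /\
  forall g : M -> R, continuous g -> mean Q g = conv_mean (mean mu) (mean nu) g.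
Proof.
exists P; split=> [|g cg]; first exact: convolE.
have bg := bcont_continuous cg.
(* Tonelli handles nonnegative functions; adding to [g] a bound [B] of its absolute value reduces to
   them. *)
have pos (h : M -> R) : continuous h -> (forall x, 0 <= h x) ->
    mean P h = conv_mean (mean mu) (mean nu) h.
  move=> ch h0; have bh := bcont_continuous ch.
  apply: EFin_inj; rewrite -(meanE P bh).
  have mh : measurable_fun setT (fun x : borel M => (h x)%:E).
    by apply/measurable_EFinP; exact: continuous_borel.
  rewrite (ge0_integral_pushforward measurable_evaluation)//; last by move=> x _; rewrite lee_fin.
  rewrite preimage_setT fubini_tonelli1//; first last.
  - by move=> p; rewrite lee_fin.
  - by apply: measurableT_comp => //; exact: measurable_evaluation.
  rewrite /conv_mean -(meanE mu); last first.
    exact: (bcont_push (mean_averaging nu) bh).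
  apply: eq_integral => f _; rewrite /fubini_F/= -(meanE nu).
    by [].
  exact: (bcont_homeo (f : homeo M) bh).
have [B B0 gB] := continuous_bounded cg.
have EP := mean_averaging P; have Enu := mean_averaging nu.
have EC := conv_averaging (mean_averaging mu) Enu.
have cgB : continuous (fun x => g x + B) by have [] := bcontD bg (bcont_cst B).
have := pos _ cgB.
rewrite (averagingD EP bg (bcont_cst B)) (averagingD EC bg (bcont_cst B)).
rewrite (averaging_cst EP) (averaging_cst EC) => H; apply: (addIr B); apply: H => x.
have := gB x; rewrite ler_norml => /andP[h _]; lra.
Qed.

End convolution_measure.

Section iterated_convolution.
Context (R : realType) (n : nat) (M : closed_riemannian_manifold R n).

Fixpoint iter_mean (mu : nat -> borel_prob (homeo M) R) (J : (M -> R) -> R) (k : nat) :=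
  match k with
  | 0 => J
  | j.+1 => conv_mean (mean (mu j.+1)) (iter_mean mu J j)
  end.

Lemma iter_mean_averaging mu J k : averaging J -> averaging (iter_mean mu J k).
Proof.
by move=> EJ; elim: k => //= k IH; apply: conv_averaging => //; exact: mean_averaging.
Qed.

Lemma iter_convol_probability (mu : nat -> borel_prob (homeo M) R) (nu0 : borel_prob M R) k :
  exists Q : borel_prob M R, iter_convol mu nu0 k = Q /\
  forall g : M -> R, continuous g -> mean Q g = iter_mean mu (mean nu0) k g.
Proof.
elim: k => [|k [Q [EQ HQ]]]; first by exists nu0.
have [Q' [EQ' HQ']] := convol_probability (mu k.+1) Q.
exists Q'; split=> [|g cg]; first by rewrite /= EQ.
rewrite HQ'//= /conv_mean; congr (mean _ _); apply/funext => f.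
by rewrite HQ//; exact: homeo_comp_continuous.
Qed.

End iterated_convolution.

(** * The measure of a positive functional *)

Section measure_of_functional.
Context (R : realType) (n : nat) (M : closed_riemannian_manifold R n).
Implicit Types (x y z : M) (O U V : set M) (g h : M -> R).

(** The cap 1 keeps the set nonempty when [C] is empty. *)
Definition dist_outside (C : set M) x : R := inf ([set 1] `|` [set rdist x c | c in C]).

Lemma dist_outside_lb (C : set M) x : has_lbound ([set 1] `|` [set rdist x c | c in C]).
Proof. by exists 0 => r [->//|[c _ <-]]; exact: rdist_ge0. Qed.

Lemma dist_outside_ge0 (C : set M) x : 0 <= dist_outside C x.
Proof.
by apply: lb_le_inf; [exists 1; left|move=> r [->//|[c _ <-]]; exact: rdist_ge0].
Qed.

Lemma dist_outside_lip (C : set M) x y : dist_outside C x <= dist_outside C y + rdist x y.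
Proof.
rewrite -lerBlDr; apply: lb_le_inf; first by exists 1; left.
move=> r [->|[c Cc <-]].
  rewrite lerBlDr; apply: (@le_trans _ _ 1); last by rewrite lerDl rdist_ge0.
  by apply: ge_inf; [exact: dist_outside_lb|left].
rewrite lerBlDr addrC; apply: le_trans (rdist_triangle y x c).
by apply: ge_inf; [exact: dist_outside_lb|right; exists c].
Qed.

Lemma dist_outside_continuous (C : set M) : continuous (dist_outside C).
Proof.
move=> x; apply/cvgrPdist_le => e e0; apply/nbhs_rdist; exists e => // y /ltW xy.
have := dist_outside_lip C x y; have := dist_outside_lip C y x.
by rewrite (rdistC y x) ler_norml => h1 h2; apply/andP; split; lra.
Qed.

Lemma dist_outside0 (C : set M) x : C x -> dist_outside C x = 0.
Proof.
move=> Cx; apply/le_anti; rewrite dist_outside_ge0 andbT.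
by apply: ge_inf; [exact: dist_outside_lb|right; exists x => //; rewrite rdistxx].
Qed.

Lemma dist_outside_gt0 O x : open O -> O x -> 0 < dist_outside (~` O) x.
Proof.
move=> oO Ox; have /nbhs_rdist[e e0 He] : nbhs x O by exact: open_nbhs_nbhs.
apply: (@lt_le_trans _ _ (Num.min 1 e)); first by rewrite lt_min ltr01.
apply: lb_le_inf; first by exists 1; left.
move=> r [->|[c nOc <-]]; first by rewrite ge_min lexx.
by rewrite ge_min; apply/orP; right; rewrite leNgt; apply/negP => /He; exact: nOc.
Qed.

Definition carried O : set (M -> R) :=
  [set g : M -> R | [/\ continuous g, forall x, 0 <= g x <= 1 & forall x, ~ O x -> g x = 0]].

(* A continuous function carried by a union of open sets is dominated, up to any error, by finitely many functions carried by the pieces: no partition of unity is needed. *)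
Lemma under_bigcup (F : nat -> set M) g (e : R) : (forall i, open (F i)) ->
  carried (\bigcup_i F i) g -> 0 < e ->
  exists N (G : nat -> M -> R), (forall i, carried (F i) (G i)) /\
    forall x, g x <= e + \sum_(i < N) G i x.
Proof.
move=> oF [cg g01 g0] e0.
(* As [k] grows these functions increase to the indicator of [F i]; the same number then serves as
   slope and as number of pieces. *)
pose G (k i : nat) x := Num.min 1 (k%:R * dist_outside (~` F i) x).
have uG k i : carried (F i) (G k i).
  split.
  - have [] // := @bcont_min1 R M (fun x => k%:R * dist_outside (~` F i) x) 1 _.
    by apply: bcontZ; apply: bcont_continuous; exact: dist_outside_continuous.
  - by move=> x; rewrite le_min ler01 ge_min lexx mulr_ge0//= dist_outside_ge0.
  - by move=> x nF; rewrite /G dist_outside0// mulr0; apply/min_idPr.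
have loc x : exists N, nbhs x [set y | forall k, (N <= k)%N -> g y <= e + \sum_(i < k) G k i y].
  have [[i _ Fx]|nF] := pselect ((\bigcup_i F i) x); last first.
    exists 0%N; have gx := g0 x nF.
    have /cvgrPdist_lt /(_ _ e0) := cg x; apply: filterS => y; rewrite gx sub0r normrN => gy k _.
    rewrite (le_trans (ler_norm _))// (le_trans (ltW gy))// lerDl sumr_ge0// => i _.
    by have [_ /(_ y) /andP[]] := uG k i.
  have d0 := dist_outside_gt0 (oF i) Fx; set d := dist_outside _ _ in d0.
  exists (maxn i.+1 (Num.truncn (2 / d)).+1).
  have d20 : 0 < d / 2 by rewrite divr_gt0.
  have /cvgrPdist_lt /(_ _ d20) := @dist_outside_continuous (~` F i) x.
  apply: filterS => y; rewrite -/d => dy k; rewrite geq_max => /andP[ik Nk].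
  have Gy : G k i y = 1.
    apply/min_idPl; have h : d / 2 <= dist_outside (~` F i) y.
      by move: dy; rewrite ltr_norml; lra.
    have kd : 2 / d <= k%:R.
      by rewrite ltW// (lt_le_trans (truncnS_gt _))// ler_nat.
    rewrite (@le_trans _ _ (2 / d * (d / 2)))//.
      by rewrite le_eqVlt; apply/orP; left; apply/eqP; field; exact: lt0r_neq0.
    by apply: ler_pM => //; [rewrite divr_ge0// ltW|exact: ltW].
  have : 1 <= \sum_(i < k) G k i y.
    rewrite (bigD1 (Ordinal ik))//= Gy lerDl sumr_ge0// => j _.
    by have [_ /(_ y) /andP[]] := uG k j.
  have /andP[_ g1] := g01 y; lra.
have H x : {N | nbhs x [set y | forall k, (N <= k)%N -> g y <= e + \sum_(i < k) G k i y]}.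
  exact: cid (loc x).
have [s Hs] := finite_cover (fun x => svalP (H x)).
pose N := \max_(x <- s) sval (H x).
exists N, (G N); split=> // y; have [x xs Hx] := Hs y; apply: Hx.
by rewrite /N (big_rem x xs)/= leq_maxl.
Qed.

Variables (I : (M -> R) -> R) (EI : averaging I).

(** The value on open sets in the Riesz representation; [outer] extends it to all sets. *)
Definition mass O : R := sup [set I g | g in carried O].

Lemma under0 O : carried O (fun=> 0).
Proof. by split=> // x; [exact: cvg_cst|rewrite lexx ler01]. Qed.

Lemma under_le1 O g : carried O g -> I g <= 1.
Proof.
move=> [cg g01 _]; apply: (averaging_le EI); first exact: bcont_continuous.
by move=> x; have /andP[] := g01 x.
Qed.

Lemma has_sup_mass O : has_sup [set I g | g in carried O].
Proof.
split; first by exists (I (fun=> 0)), (fun=> 0) => //; exact: under0.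
by exists 1 => _ [g ug <-]; exact: under_le1 ug.
Qed.

Lemma mass_ge O g : carried O g -> I g <= mass O.
Proof. by move=> ug; apply: (sup_upper_bound (has_sup_mass O)); exists g. Qed.

Lemma mass_le O (r : R) : (forall g, carried O g -> I g <= r) -> mass O <= r.
Proof.
move=> h; apply: ge_sup; first by have [] := has_sup_mass O.
by move=> _ [g ug <-]; exact: h.
Qed.

Lemma mass_ge0 O : 0 <= mass O.
Proof. by rewrite -(averaging_cst EI 0); apply: mass_ge; exact: under0. Qed.

Lemma le_mass O U : O `<=` U -> mass O <= mass U.
Proof.
move=> OU; apply: mass_le => g [cg g01 g0]; apply: mass_ge; split=> // x nU.
by apply: g0 => Ox; apply: nU; exact: OU.
Qed.

Lemma massT : mass setT = 1.
Proof.
apply/le_anti/andP; split; first by apply: mass_le => g; exact: under_le1.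
rewrite -{1}(averaging_cst EI 1); apply: mass_ge; split=> //.
- by move=> x; exact: cvg_cst.
- by move=> x; rewrite ler01 lexx.
- by move=> x nT; exfalso; apply: nT.
Qed.

Lemma mass0 : mass set0 = 0.
Proof.
apply/le_anti; rewrite mass_ge0 andbT; apply: mass_le => g [_ _ g0].
have -> : g = (fun=> 0) by apply/funext => x; apply: g0.
by rewrite (averaging_cst EI).
Qed.

Lemma mass_bigcup (F : nat -> set M) : (forall i, open (F i)) ->
  ((mass (\bigcup_i F i))%:E <= \sum_(i <oo) (mass (F i))%:E)%E.
Proof.
move=> oF; apply/lee_addgt0Pr => e e0.
pose S := (\sum_(i <oo) (mass (F i))%:E)%E.
suff H g : carried (\bigcup_i F i) g -> ((I g)%:E <= S + e%:E)%E.
  have [SF|] := boolP (S \is a fin_num); last first.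
    rewrite ge0_fin_numE; last by apply: nneseries_ge0 => i _ _; rewrite lee_fin mass_ge0.
    by rewrite -leNgt leye_eq => /eqP; rewrite -/S => ->; rewrite addye// leey.
  rewrite -/S -(fineK SF) -EFinD lee_fin; apply: mass_le => g /H.
  by rewrite -(fineK SF) -EFinD lee_fin.
move=> ug; have [N [G [uG gG]]] := under_bigcup oF ug e0.
have bG i : bcont (G i) by have [cG _ _] := uG i; exact: bcont_continuous.
have bg : bcont g by have [cg _ _] := ug; exact: bcont_continuous.
have bS : bcont (fun x => \sum_(i < N) G i x) by exact: bcont_sum.
have h1 : I g <= e + \sum_(i < N) I (G i).
  rewrite -(averaging_sum EI (index_enum _) (fun i : 'I_N => bG i)) -{1}(averaging_cst EI e).
  rewrite -(averagingD EI (bcont_cst e) bS); apply: (le_averaging EI) => //.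
  by apply: bcontD => //; exact: bcont_cst.
apply: (@le_trans _ _ (e + \sum_(i < N) mass (F i))%:E).
  by rewrite lee_fin (le_trans h1)// lerD2l ler_sum// => i _; exact: mass_ge.
rewrite EFinD addeC leeD2r// -sumEFin.
rewrite -(big_mkord xpredT (fun i => (mass (F i))%:E)).
by apply: nneseries_lim_ge => i _ _; rewrite lee_fin mass_ge0.
Qed.

Definition outer (A : set M) : R := inf [set mass O | O in [set O | open O /\ A `<=` O]].

Let outer_lb A : has_lbound [set mass O | O in [set O | open O /\ A `<=` O]].
Proof. by exists 0 => _ [V _ <-]; exact: mass_ge0. Qed.

Let outer_ne A : [set mass O | O in [set O | open O /\ A `<=` O]] !=set0.
Proof. by exists (mass setT), setT => //; split=> //; exact: openT. Qed.

Lemma outer_le A O : open O -> A `<=` O -> outer A <= mass O.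
Proof. by move=> oO AO; apply: ge_inf; [exact: outer_lb|exists O]. Qed.

Lemma outer_ge A (r : R) : (forall O, open O -> A `<=` O -> r <= mass O) -> r <= outer A.
Proof. by move=> h; apply: lb_le_inf => // _ [V [oV AV] <-]; exact: h. Qed.

Lemma outer_open O : open O -> outer O = mass O.
Proof.
move=> oO; apply/le_anti; rewrite outer_le//=; apply: outer_ge => U _; exact: le_mass.
Qed.

Definition outerE (A : set (borel M)) : \bar R := (outer A)%:E.

Let outerE0 : outerE set0 = 0%E.
Proof. by rewrite /outerE outer_open ?mass0//; exact: open0. Qed.

Let outerE_ge0 A : (0 <= outerE A)%E.
Proof. by rewrite lee_fin; apply: outer_ge => O _ _; exact: mass_ge0. Qed.

Let le_outerE : {homo outerE : A B / A `<=` B >-> (A <= B)%E}.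
Proof.
move=> A B AB; rewrite lee_fin; apply: outer_ge => O oO BO; apply: outer_le => //.
exact: subset_trans BO.
Qed.

Let outerE_sigma_subadditive : sigma_subadditive outerE.
Proof.
move=> A; apply/lee_addgt0Pr => e e0.
apply: le_trans (@epsilon_trick R (fun i => outerE (A i)) e xpredT (fun i => outerE_ge0 (A i)) (ltW e0)).
have H i : {O | open O /\ A i `<=` O & mass O <= outer (A i) + e / (2 ^ i.+1)%:R}.
  apply: cid2; have ei : 0 < e / (2 ^ i.+1)%:R by rewrite divr_gt0// ltr0n expn_gt0.
  have [|_ [V [oV AV] <-] h] := inf_adherent ei (_ : has_inf [set mass O | O in [set O | open O /\ A i `<=` O]]).
    by split.
  by exists V => //; exact: ltW.
pose O i := s2val (H i).
have oO i : open (O i) by have [] := s2valP (H i).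
have AO i : A i `<=` O i by have [] := s2valP (H i).
apply: (@le_trans _ _ (mass (\bigcup_i O i))%:E).
  rewrite lee_fin; apply: outer_le; first exact: bigcup_open.
  by apply: subset_bigcup => i _; exact: AO.
apply: le_trans (mass_bigcup oO) _.
apply: lee_nneseries => i _; first by rewrite lee_fin mass_ge0.
by rewrite /outerE -EFinD lee_fin; exact: (s2valP' (H i)).
Qed.

HB.instance Definition _ := isOuterMeasure.Build R (borel M) outerE
  outerE0 outerE_ge0 le_outerE outerE_sigma_subadditive.

(** The Caratheodory inequality for an open set. A nearly optimal [g] on the intersection is lowered
    by [e / 2] and cut at 0; it then lives where [g] exceeds [e / 2], away from every [h] carried by
    [V], so their sum is carried by [O]. The part of [O] outside [U] lies in [V], since [g] vanishes
    there. *)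
Lemma mass_split O U : open O -> open U -> mass (O `&` U) + outer (O `&` ~` U) <= mass O.
Proof.
move=> oO oU; apply/ler_addgt0Pr => e e0.
have e20 : 0 < e / 2 by rewrite divr_gt0.
have [_ [g ug <-] hg] := sup_adherent e20 (has_sup_mass (O `&` U)).
have [cg g01 g0] := ug.
pose V := O `&` [set x | g x < e / 2].
have oV : open V.
  by apply: openI => //; move/continuousP : cg => /(_ _ (@open_lt R (e / 2))).
have OUV : O `&` ~` U `<=` V.
  by move=> x [Ox nUx]; split=> //=; rewrite g0// => -[].
have key h : carried V h -> I g - e / 2 + I h <= mass O.
  move=> [ch h01 h0].
  have bg := bcont_continuous cg; have bh := bcont_continuous ch.
  have bgp : bcont (fun x => Num.max 0 (g x - e / 2)).
    by apply: bcont_pos; apply: bcontB => //; exact: bcont_cst.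
  have bsum := bcontD bgp bh.
  have uS : carried O (fun x => Num.max 0 (g x - e / 2) + h x).
    split.
    - by case: bsum.
    - move=> x; have /andP[gx0 gx1] := g01 x; have /andP[hx0 hx1] := h01 x.
      have [ge|ge] := ltP (g x) (e / 2).
        have -> : Num.max 0 (g x - e / 2) = 0 by apply/max_idPl; lra.
        by rewrite add0r hx0.
      rewrite h0; last by move=> [_ /=]; rewrite ltNge ge.
      have -> : Num.max 0 (g x - e / 2) = g x - e / 2 by apply/max_idPr; lra.
      by apply/andP; split; lra.
    - move=> x nO; rewrite h0; last by case.
      rewrite g0; last by case.
      by rewrite addr0; apply/max_idPl; lra.
  apply: le_trans (mass_ge uS); rewrite (averagingD EI bgp bh) lerD2r.
  rewrite -{1}(averaging_cst EI (e / 2)) -(averagingB EI bg (bcont_cst _)).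
  apply: (le_averaging EI) => //; first by apply: bcontB => //; exact: bcont_cst.
  by move=> x; rewrite le_max lexx orbT.
have : mass V <= mass O - I g + e / 2.
  by apply: mass_le => h /key; lra.
have hg' : mass (O `&` U) - e / 2 < I g := hg.
have := outer_le oV OUV; lra.
Qed.

Let caratheodory_open U : open U -> (outerE : {outer_measure set (borel M) -> \bar R}).-caratheodory U.
Proof.
move=> oU; apply: le_caratheodory_measurable => X.
rewrite /= /outerE -EFinD lee_fin; apply: outer_ge => O oO XO.
apply: le_trans (mass_split oO oU); apply: lerD.
  by apply: outer_le; [exact: openI|exact: setSI].
by rewrite -lee_fin; apply: le_outerE; exact: setSI.
Qed.

Let borel_caratheodory (A : set (borel M)) : measurable A ->
  (outerE : {outer_measure set (borel M) -> \bar R}).-cara.-measurable A.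
Proof.
apply: smallest_sub; last by move=> U; exact: caratheodory_open.
exact: sigma_algebra_measurable.
Qed.

Definition functional_measure (A : set (borel M)) : \bar R := outerE A.

Let fm_sigma_additive : semi_sigma_additive functional_measure.
Proof.
move=> F mF tF mUF.
apply: (@caratheodory_measure_sigma_additive R (borel M) outerE F) => //.
- by move=> i; exact: borel_caratheodory.
- exact: borel_caratheodory.
Qed.

HB.instance Definition _ := isMeasure.Build _ _ _ functional_measure
  outerE0 outerE_ge0 fm_sigma_additive.

Let fmT : functional_measure setT = 1%E.
Proof. by rewrite /functional_measure /outerE outer_open ?massT//; exact: openT. Qed.

HB.instance Definition _ := Measure_isProbability.Build _ _ _ functional_measure fmT.

Lemma functional_probability : exists Q : borel_prob M R,
  forall O, open O -> Q O = (mass O)%:E.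
Proof.
by exists functional_measure => O oO; rewrite /= /functional_measure /outerE outer_open.
Qed.

End measure_of_functional.

Section transport.
Context (R : realType) (n : nat) (M : closed_riemannian_manifold R n).

Lemma homeo_measurable (f : homeo M) : measurable_fun setT (f : borel M -> borel M).
Proof.
apply: (@measurability _ _ _ _ setT (f : borel M -> borel M) (@open M) erefl).
move=> _ [U oU <-]; rewrite setTI; apply: open_borel.
by apply: open_comp => // x _; exact: homeo_continuous.
Qed.

(** Composition with [f] and with its inverse exchanges the functions carried by the two sets. *)
Lemma mass_transport (I1 I2 : (M -> R) -> R) (f : homeo M) (O : set M) :
  (forall g : M -> R, continuous g -> I1 (g \o f) = I2 g) ->
  mass I1 (f @^-1` O) = mass I2 O.
Proof.
move=> H; congr sup; apply/seteqP; split=> _ [g [cg g01 g0] <-].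
  have cgf : continuous (g \o homeo_inv f).
    by move=> x; apply: continuous_comp; [exact: homeo_inv_continuous|exact: cg].
  exists (g \o homeo_inv f).
    split=> // x; first by apply: g01.
    by move=> nO; apply: g0 => /=; rewrite homeo_invK.
  rewrite -H//; congr I1; apply/funext => x /=; by rewrite homeoK.
exists (g \o f); last exact: H.
split; first exact: homeo_comp_continuous.
- by move=> x; exact: g01.
- by move=> x nO; exact: g0.
Qed.

(** The measures are built from [I1] and [I2] alone, so a single pair serves every [f]; equality on
    open sets suffices because they form a generating pi-system. *)
Lemma transport_measures (I1 I2 : (M -> R) -> R) : averaging I1 -> averaging I2 ->
  exists m1 m2 : borel_prob M R, forall f : homeo M,
  (forall g : M -> R, continuous g -> I1 (g \o f) = I2 g) ->
  forall A : set (borel M), measurable A -> m1 (f @^-1` A) = m2 A.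
Proof.
move=> E1 E2.
have [m1 H1] := functional_probability E1; have [m2 H2] := functional_probability E2.
exists m1, m2 => f Hf.
have := @measure_unique _ R (borel M) (@open M) (fun=> setT) erefl _ _ _
  (giry_map (homeo_measurable f) m1) m2 _ _.
apply.
- by move=> U V; exact: openI.
- by move=> _; exact: openT.
- by rewrite bigcup_const//; exists 0%N.
- move=> U oU; suff : m1 (f @^-1` U) = m2 U by [].
  rewrite H2// -(mass_transport U Hf).
  by rewrite -H1//; apply: open_comp => // x _; exact: homeo_continuous.
- by move=> _; rewrite /= /pushforward preimage_setT; exact: (le_lt_trans (probability_le1 m1 measurableT) (ltry 1)).
Qed.

End transport.

(** * The energy kernel *)

Section powers.
Context {R : realType}.
Implicit Types (p q a e : R).

(** Plays the part of subadditivity or convexity for all exponents at once: if [q <= eta * p] the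
    first term suffices, otherwise the second does. The constant of the main term tends to 1 with
    [eta]. *)
Lemma powR_add_le a eta p q : 0 <= a -> 0 < eta -> 0 <= p -> 0 <= q ->
  (p + q) `^ a <= (1 + eta) `^ a * p `^ a + (1 + eta^-1) `^ a * q `^ a.
Proof.
move=> a0 e0 p0 q0.
have e1 : 0 <= 1 + eta by rewrite addr_ge0// ltW.
have e2 : 0 <= 1 + eta^-1 by rewrite addr_ge0// invr_ge0 ltW.
rewrite -!powRM//.
have mono u v : 0 <= u -> u <= v -> u `^ a <= v `^ a.
  by move=> u0 uv; apply: ge0_ler_powR; rewrite ?nnegrE//; exact: le_trans uv.
have [h|h] := leP q (eta * p).
  apply: (@le_trans _ _ (((1 + eta) * p) `^ a)); last by rewrite lerDl powR_ge0.
  by apply: mono; [rewrite addr_ge0|rewrite mulrDl mul1r lerD2l].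
apply: (@le_trans _ _ (((1 + eta^-1) * q) `^ a)); last by rewrite lerDr powR_ge0.
apply: mono; first by rewrite addr_ge0.
by rewrite mulrDl mul1r addrC lerD2l ler_pdivlMl// ltW.
Qed.

Lemma powR_near1 a e : 0 < a -> 0 < e -> exists2 eta : R, 0 < eta & (1 + eta) `^ a <= 1 + e.
Proof.
move=> a0 e0; have e1 : 0 < 1 + e by rewrite addr_gt0.
exists (expR (ln (1 + e) / a) - 1).
  have l0 : 0 < ln (1 + e) by apply: ln_gt0; lra.
  by rewrite subr_gt0 -[X in X < _]expR0 ltr_expR divr_gt0.
rewrite addrC subrK -expRM mulfVK ?lnK//; exact: lt0r_neq0.
Qed.

(** Three successive comparisons will each lose a factor at most [1 + d]. The 7 is 3 + 3 + 1, from
    expanding the cube with [d <= 1]. *)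
Lemma cube_near1 e : 0 < e -> exists2 d : R, 0 < d <= 1 & (1 + d) ^+ 3 <= 1 + e.
Proof.
move=> e0; exists (Num.min 1 (e / 7)).
  by rewrite lt_min ltr01 divr_gt0//= ge_min lexx.
set d := Num.min _ _.
have d0 : 0 <= d by rewrite le_min ler01 divr_ge0// ltW.
have d1 : d <= 1 by rewrite ge_min lexx.
have d7 : d <= e / 7 by rewrite ge_min lexx orbT.
have -> : (1 + d) ^+ 3 = 1 + (3 * d + 3 * (d * d) + d * (d * d)) by ring.
have dd : d * d <= d by rewrite ler_piMl.
have ddd : d * (d * d) <= d by rewrite ler_piMr// (le_trans dd).
lra.
Qed.

Lemma ltr_linear_expR (A B eta : R) : 0 <= A -> 0 <= B -> 0 < eta ->
  forall t : R, 0 <= t -> A * t + B <= (A / eta + B) * expR (eta * t).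
Proof.
move=> A0 B0 e0 t t0.
have h : 1 + eta * t <= expR (eta * t) by exact: expR_ge1Dx.
have et0 : 0 <= eta * t by rewrite mulr_ge0// ltW.
rewrite mulrDl; apply: lerD.
  rewrite -mulrA ler_wpM2l// ler_pdivlMl//; lra.
by rewrite -[leLHS]mulr1 ler_wpM2l//; lra.
Qed.

Lemma mul_le_mean_sq (a b : R) : a * b <= 2^-1 * (a ^+ 2 + b ^+ 2).
Proof. by have := sqr_ge0 (a - b); rewrite sqrrB mulr2n; lra. Qed.

Lemma ratio_le (E a b s t : R) : 0 < E -> 0 <= a -> 0 < s -> 0 < t ->
  a <= E * b -> t <= E * s -> (E * E)^-1 * (a / s) <= b / t.
Proof.
move=> E0 a0 s0 t0 ab ts.
have h : a * t <= (E * b) * (E * s) by apply: ler_pM => //; exact: ltW.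
have -> : (E * E)^-1 * (a / s) = (a * t) / (E * E * s * t) by field; rewrite !lt0r_neq0.
have -> : b / t = (E * b * (E * s)) / (E * E * s * t) by field; rewrite !lt0r_neq0.
by rewrite ler_wpM2r// invr_ge0 !mulr_ge0// ltW.
Qed.

Lemma concentration_arith (b d E Ec C1 C2 C3 c F S Y : R) : 0 <= b -> 0 <= d ->
  F <= 2 * E + C1 * (1 + Y) -> Ec <= 2 * E + C3 * (1 + c) ->
  b * (d * E + C1 * (1 + Y)) + (d * F + C2) + b * (S / d + d * (F + Ec)) <=
  b / d * S + ((5 * b + 2) * d * E + C1 * (b + d + b * d) + C2 + b * d * C3 * (1 + c) +
    C1 * (b + d + b * d) * Y).
Proof.
move=> b0 d0 hF hE.
have m1 := ler_wpM2l d0 hF; have m2 := ler_wpM2l (mulr_ge0 b0 d0) (lerD hF hE).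
have -> : b * (S / d + d * (F + Ec)) = b / d * S + b * d * (F + Ec) by ring.
move: m1 m2 => {hF hE}; move: (b / d * S) => u; lra.
Qed.

End powers.

Section kernel.
Context (R : realType) (n : nat) (M : closed_riemannian_manifold R n).
Variables (alpha B : R) (net : nat -> seq M).
Hypotheses (alpha0 : 0 < alpha) (B0 : 0 <= B).
Hypothesis net_size : forall j, (0 < size (net j))%N.
Hypothesis net_le : forall j, (size (net j))%:R <= expR (n%:R * j%:R + B).
Hypothesis net_cover : forall j z, exists2 w, w \in net j & rdist z w <= expR (- j%:R) / 2.
Implicit Types (x y z : M) (j m : nat).

Definition weight j : R := j.+1%:R `^ alpha - j%:R `^ alpha.

Lemma weight_ge0 j : 0 <= weight j.
Proof.
rewrite subr_ge0; apply: ge0_ler_powR; rewrite ?nnegrE ?ler_nat// ltW//.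
Qed.

Lemma sum_weight m : \sum_(j < m) weight j = m%:R `^ alpha.
Proof.
elim: m => [|m IH]; first by rewrite big_ord0 powR0// lt0r_neq0.
by rewrite big_ord_recr/= IH /weight addrC subrK.
Qed.

(** Dividing by [1 + weight j] compensates the weight, and [2 ^- j] makes the series converge: all
    the scales that separate a pair add at most 2 to the kernel, whatever [m] is. *)
Definition tail j : R := 2 ^- j / (1 + weight j).

Lemma tail_gt0 j : 0 < tail j.
Proof. by rewrite divr_gt0 ?invr_gt0 ?exprn_gt0// ltr_wpDr// weight_ge0. Qed.

Lemma weight_tail j : weight j * tail j <= 2 ^- j.
Proof.
have w1 : 0 < 1 + weight j by rewrite ltr_wpDr// weight_ge0.
rewrite /tail mulrCA ler_piMr ?invr_ge0 ?exprn_ge0//.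
by rewrite ler_pdivrMr// mul1r lerDr.
Qed.

Lemma sum_half m : \sum_(j < m) (2 : R) ^- j <= 2.
Proof.
suff -> : \sum_(j < m) (2 : R) ^- j = 2 - 2 * 2 ^- m.
  by rewrite gerBl mulr_ge0// invr_ge0 exprn_ge0.
elim: m => [|m IH]; first by rewrite big_ord0 expr0 invr1 mulr1 subrr.
rewrite big_ord_recr/= IH exprS invfM mulrA divff ?mul1r; last by rewrite pnatr_eq0.
ring.
Qed.

Lemma sum_weight_tail m : \sum_(j < m) weight j * tail j <= 2.
Proof.
by apply: le_trans (sum_half m); apply: ler_sum => j _; exact: weight_tail.
Qed.

Definition card_net j : R := (size (net j))%:R.

Lemma card_net_ge1 j : 1 <= card_net j.
Proof. by rewrite ler1n net_size. Qed.

Lemma card_net_gt0 j : 0 < card_net j.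
Proof. exact: lt_le_trans (card_net_ge1 j). Qed.

(* The inverse temperature of the softmax partition at scale e^-j; it makes the total mass beyond that scale at most [tail j]. *)
Definition beta j : R := 2 * expR j%:R * ln (card_net j / tail j).

Lemma tail_le1 j : tail j <= 1.
Proof.
rewrite /tail ler_pdivrMr ?mul1r; last by rewrite ltr_wpDr// weight_ge0.
apply: (@le_trans _ _ 1); last by rewrite lerDl weight_ge0.
by rewrite invf_le1 ?exprn_gt0// exprn_ege1// ler1n.
Qed.

Lemma ln_card_tail_ge0 j : 0 <= ln (card_net j / tail j).
Proof.
apply: ln_ge0; rewrite ler_pdivlMr ?tail_gt0// mul1r.
exact: le_trans (tail_le1 j) (card_net_ge1 j).
Qed.

Lemma beta_ge0 j : 0 <= beta j.
Proof. by rewrite /beta !mulr_ge0 ?expR_ge0 ?ln_card_tail_ge0. Qed.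

(** Apart from e^j, the growth of [beta j] is at most linear, because the nets and the inverse of
    [tail] grow at most exponentially. It is thus below every e^((1 + eta) j) up to a constant
    factor. *)
Lemma beta_le j : beta j <= 2 * expR j%:R * ((n%:R + 1 + alpha) * j%:R + (B + 1)).
Proof.
have w1 : 0 < 1 + weight j by rewrite ltr_wpDr// weight_ge0.
rewrite /beta ler_wpM2l// ?mulr_ge0 ?expR_ge0//.
rewrite lnM ?posrE ?card_net_gt0 ?invr_gt0 ?tail_gt0// lnV ?posrE ?tail_gt0//.
rewrite /tail lnM ?posrE ?invr_gt0 ?exprn_gt0// !lnV ?posrE ?exprn_gt0//.
have l1 : ln (card_net j) <= n%:R * j%:R + B.
  by rewrite -[leRHS]expRK ler_ln ?posrE ?card_net_gt0 ?expR_gt0// net_le.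
have l2 : ln (2 ^+ j) <= j%:R :> R.
  have : 2 ^+ j <= expR (j%:R : R).
    rewrite -[j%:R]mulr1 expRM_natl lerXn2r// ?nnegrE ?expR_ge0//.
    by have := expR_ge1Dx (1 : R); lra.
  by rewrite -[X in _ -> _ <= X]expRK ler_ln ?posrE ?exprn_gt0 ?expR_gt0.
have l3 : ln (1 + weight j) <= 1 + alpha * j%:R.
  rewrite -[leRHS]expRK ler_ln ?posrE ?expR_gt0//.
  have : weight j <= expR (alpha * j%:R).
    rewrite /weight; apply: (@le_trans _ _ (j.+1%:R `^ alpha)); first by rewrite gerBl powR_ge0.
    rewrite /powR pnatr_eq0/= ler_expR ler_wpM2l//; first exact: ltW.
    rewrite -[leRHS]expRK ler_ln ?posrE ?expR_gt0//.
    by rewrite -natr1 addrC expR_ge1Dx.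
  rewrite expRD; have e1 : 1 <= expR (alpha * j%:R) by rewrite -expR0 ler_expR mulr_ge0// ltW.
  have e2 : 2 <= expR (1 : R) by have := expR_ge1Dx (1 : R); lra.
  by nra.
lra.
Qed.

Definition bump_weight j z x : R := expR (- (beta j * rdist x z)).
Definition partition_sum j x : R := \sum_(z <- net j) bump_weight j z x ^+ 2.
(** The square root normalises the vector of features in the Euclidean norm, so that
    [scale_kernel j x x] is 1. *)
Definition feature j z x : R := bump_weight j z x / Num.sqrt (partition_sum j x).
Definition scale_kernel j x y : R := \sum_(z <- net j) feature j z x * feature j z y.

Lemma bump_weight_gt0 j z x : 0 < bump_weight j z x.
Proof. exact: expR_gt0. Qed.

Lemma bump_weight_le_partition j z x : z \in net j -> bump_weight j z x ^+ 2 <= partition_sum j x.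
Proof.
move=> zj; rewrite /partition_sum (big_rem z zj)/= lerDl sumr_ge0// => w _.
exact: sqr_ge0.
Qed.

Lemma partition_sum_gt0 j x : 0 < partition_sum j x.
Proof.
have [w wj _] := net_cover j x.
by apply: lt_le_trans (bump_weight_le_partition x wj); rewrite exprn_gt0// bump_weight_gt0.
Qed.

Lemma feature_ge0 j z x : 0 <= feature j z x.
Proof. by rewrite divr_ge0 ?sqrtr_ge0// ltW// bump_weight_gt0. Qed.

Lemma sum_feature_sq j x : \sum_(z <- net j) feature j z x ^+ 2 = 1.
Proof.
have D0 := partition_sum_gt0 j x.
under eq_bigr do rewrite expr_div_n sqr_sqrtr ?(ltW D0)//.
by rewrite -mulr_suml divff// lt0r_neq0.
Qed.

Lemma feature_le1 j z x : z \in net j -> feature j z x <= 1.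
Proof.
move=> zj; have D0 := partition_sum_gt0 j x.
rewrite ler_pdivrMr ?sqrtr_gt0// mul1r -[leLHS]ger0_norm ?(ltW (bump_weight_gt0 _ _ _))//.
by rewrite -sqrtr_sqr ler_wsqrtr// bump_weight_le_partition.
Qed.

Lemma feature_continuous j z : continuous (feature j z).
Proof.
have cb w : continuous (bump_weight j w).
  move=> x; apply: (@continuous_comp _ _ _ (fun x => - (beta j * rdist x w)) expR); last first.
    exact: continuous_expR.
  apply: cvgN; apply: cvgM; first exact: cvg_cst.
  have -> : (fun x => rdist x w) = rdist w by apply/funext => y; exact: rdistC.
  by rewrite (rdistC x w); exact: rdist_continuous.
have cp : continuous (partition_sum j).
  have [] // := @bcont_sum R M M (net j) (fun z x => bump_weight j z x ^+ 2) _.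
  by move=> w; apply: bcontX; apply: bcont_continuous; exact: cb.
move=> x; apply: cvgM; first exact: cb.
have D0 := partition_sum_gt0 j x.
apply: cvgV; first by rewrite lt0r_neq0// sqrtr_gt0.
apply: (@continuous_comp _ _ _ (partition_sum j) Num.sqrt); first exact: cp.
exact: sqrt_continuous.
Qed.

Lemma bcont_feature j z : bcont (feature j z).
Proof. by apply: bcont_continuous; exact: feature_continuous. Qed.

Lemma scale_kernel_ge0 j x y : 0 <= scale_kernel j x y.
Proof. by apply: sumr_ge0 => z _; rewrite mulr_ge0// feature_ge0. Qed.

Lemma scale_kernel_le1 j x y : scale_kernel j x y <= 1.
Proof.
have -> : 1 = \sum_(z <- net j) 2^-1 * (feature j z x ^+ 2 + feature j z y ^+ 2).
  by rewrite -mulr_sumr big_split/= !sum_feature_sq; field.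
by apply: ler_sum => z _; exact: mul_le_mean_sq.
Qed.

(** Between [x] and [y] the bumps and the normalisation each change by at most the factor [E], hence
    each feature by at most [E * E]; the sum of squares at [x] then gives the bound. *)
Lemma scale_kernel_near j x y : expR (- (2 * beta j * rdist x y)) <= scale_kernel j x y.
Proof.
set E := expR (beta j * rdist x y).
have E0 : 0 < E by exact: expR_gt0.
have Wle z : bump_weight j z y <= E * bump_weight j z x.
  rewrite /E /bump_weight -expRD ler_expR -mulrBr -mulrN.
  apply: ler_wpM2l; first exact: beta_ge0.
  have := rdist_triangle y x z; lra.
have Wge z : bump_weight j z x <= E * bump_weight j z y.
  rewrite /E /bump_weight -expRD ler_expR -mulrBr -mulrN.
  apply: ler_wpM2l; first exact: beta_ge0.
  have := rdist_triangle x y z; rewrite (rdistC y x); lra.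
have Dle : Num.sqrt (partition_sum j y) <= E * Num.sqrt (partition_sum j x).
  rewrite -[E]ger0_norm ?(ltW E0)// -sqrtr_sqr -sqrtrM ?sqr_ge0//.
  apply: ler_wsqrtr; rewrite /partition_sum mulr_sumr; apply: ler_sum => z _.
  rewrite -exprMn lerXn2r// nnegrE; last by rewrite mulr_ge0 ?(ltW E0)// ltW// bump_weight_gt0.
  by rewrite ltW// bump_weight_gt0.
have sx : 0 < Num.sqrt (partition_sum j x) by rewrite sqrtr_gt0 partition_sum_gt0.
have sy : 0 < Num.sqrt (partition_sum j y) by rewrite sqrtr_gt0 partition_sum_gt0.
have -> : expR (- (2 * beta j * rdist x y)) = (E * E)^-1.
  by rewrite /E -expRD -expRN; congr expR; ring.
have Fle z : (E * E)^-1 * feature j z x <= feature j z y.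
  by apply: ratio_le => //; exact: ltW (bump_weight_gt0 _ _ _).
rewrite -[leLHS]mulr1 -(sum_feature_sq j x) mulr_sumr; apply: ler_sum => z _.
by rewrite expr2 mulrCA ler_wpM2l// feature_ge0.
Qed.

(** A net point within half the scale bounds the normalisation from below, and the bump at [z] is at
    most the square of that bound; [beta] is chosen so that the quotient is exactly
    [tail j / card_net j]. *)
Lemma feature_far j z x : expR (- j%:R) <= rdist x z -> feature j z x <= tail j / card_net j.
Proof.
move=> xz; have [w wj xw] := net_cover j x.
have b0 := beta_ge0 j.
have c0 := card_net_gt0 j; have t0 := tail_gt0 j.
have h1 : expR (- (beta j * (expR (- j%:R) / 2))) <= Num.sqrt (partition_sum j x).
  rewrite -[leLHS]ger0_norm ?expR_ge0// -sqrtr_sqr; apply: ler_wsqrtr.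
  apply: le_trans (bump_weight_le_partition x wj).
  rewrite lerXn2r ?nnegrE ?expR_ge0//.
  by rewrite ler_expR lerN2 ler_wpM2l// rdistC.
have s0 : 0 < Num.sqrt (partition_sum j x) by rewrite sqrtr_gt0 partition_sum_gt0.
rewrite /feature ler_pdivrMr//.
apply: (@le_trans _ _ (tail j / card_net j * expR (- (beta j * (expR (- j%:R) / 2))))); last first.
  by rewrite ler_wpM2l// divr_ge0// ltW.
have E : beta j * (expR (- j%:R) / 2) = ln (card_net j / tail j).
  by rewrite /beta expRN; field; rewrite lt0r_neq0// expR_gt0.
have ct0 : 0 < card_net j / tail j by rewrite divr_gt0.
rewrite E expRN lnK ?posrE//.
have -> : tail j / card_net j / (card_net j / tail j) = expR (- (beta j * expR (- j%:R))).
  have -> : beta j * expR (- j%:R) = 2 * ln (card_net j / tail j).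
    by rewrite -E; field.
  rewrite mulr_natl -mulr_natr -mulNr mulr_natr mulr2n expRD !expRN lnK ?posrE//.
  by field; rewrite !lt0r_neq0.
by rewrite /bump_weight ler_expR lerN2 ler_wpM2l// rdistC.
Qed.

(** Each [z] is far from [x] or from [y], and summing over the net cancels the division by
    [card_net j]. *)
Lemma scale_kernel_far j x y : 2 * expR (- j%:R) <= rdist x y -> scale_kernel j x y <= tail j.
Proof.
move=> xy; have c0 := card_net_gt0 j; have t0 := tail_gt0 j.
have tc0 : 0 <= tail j / card_net j by rewrite divr_ge0// ltW.
have h z : z \in net j -> feature j z x * feature j z y <= tail j / card_net j.
  move=> zj; have [xz|xz] := leP (expR (- j%:R)) (rdist x z).
    apply: (@le_trans _ _ (tail j / card_net j * 1)); last by rewrite mulr1.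
    by apply: ler_pM; rewrite ?feature_ge0// ?feature_far// feature_le1.
  have yz : expR (- j%:R) <= rdist y z.
    have := rdist_triangle z x y; rewrite (rdistC z y); lra.
  apply: (@le_trans _ _ (1 * (tail j / card_net j))); last by rewrite mul1r.
  by apply: ler_pM; rewrite ?feature_ge0// ?feature_far// feature_le1.
apply: (@le_trans _ _ (\sum_(z <- net j) tail j / card_net j)).
  by rewrite /scale_kernel big_seq [leRHS]big_seq; apply: ler_sum => z /h.
rewrite big_const_seq count_predT iter_addr_0 -mulr_natr -/(card_net j).
by rewrite divfK// lt0r_neq0.
Qed.

(** Up to constants, the number of scales below [m] that do not separate the pair. *)
Definition level m x y : R := Num.max 0 (- ln (Num.max (rdist x y) (expR (- m%:R)))).

Definition energy_kernel m x y : R := \sum_(j < m) weight j * scale_kernel j x y.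

Let trunc_gt0 m x y : 0 < Num.max (rdist x y) (expR (- m%:R : R)).
Proof. by rewrite lt_max expR_gt0 orbT. Qed.

Lemma level_ge0 m x y : 0 <= level m x y.
Proof. by rewrite le_max lexx. Qed.

Lemma level_le m x y : level m x y <= m%:R.
Proof.
rewrite ge_max ler0n/= lerNl -[leLHS]expRK ler_ln ?posrE ?expR_gt0//.
by rewrite le_max lexx orbT.
Qed.

Lemma rdist_le_level m x y : 0 < level m x y -> rdist x y <= expR (- level m x y).
Proof.
rewrite {1}/level lt_max ltxx/= => h.
have -> : level m x y = - ln (Num.max (rdist x y) (expR (- m%:R))).
  by apply/max_idPr; exact: ltW.
by rewrite opprK lnK ?posrE// le_max lexx.
Qed.

Lemma level_ge m j x y : (j <= m)%N -> rdist x y < 2 * expR (- j%:R) -> j%:R <= level m x y + 1.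
Proof.
move=> jm xy.
have h : Num.max (rdist x y) (expR (- m%:R)) < expR (1 - j%:R).
  have e2 : 2 <= expR (1 : R) by have := expR_ge1Dx (1 : R); lra.
  have e0 := expR_gt0 (- j%:R : R).
  rewrite gt_max expRD; apply/andP; split.
    by apply: (lt_le_trans xy); rewrite ler_wpM2r// ltW.
  apply: (@le_lt_trans _ _ (expR (- j%:R))); first by rewrite ler_expR lerN2 ler_nat.
  by rewrite -[ltLHS]mul1r ltr_pM2r//; lra.
have : ln (Num.max (rdist x y) (expR (- m%:R))) < 1 - j%:R.
  by rewrite -[ltRHS]expRK ltr_ln ?posrE ?expR_gt0.
have : - ln (Num.max (rdist x y) (expR (- m%:R))) <= level m x y by rewrite le_max lexx orbT.
lra.
Qed.

Lemma level_quasi m (X : R) x y x' y' : 0 <= X -> rdist x y <= expR X * rdist x' y' ->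
  level m x' y' <= level m x y + X.
Proof.
move=> X0 h; rewrite ge_max addr_ge0 ?level_ge0//=.
apply: (@le_trans _ _ (- ln (Num.max (rdist x y) (expR (- m%:R))) + X)); last first.
  by rewrite lerD2r le_max lexx orbT.
rewrite lerNl opprD opprK lerBlDr -[X in _ + X]expRK -lnM ?posrE ?expR_gt0//.
rewrite ler_ln ?posrE ?mulr_gt0 ?expR_gt0//.
rewrite ge_max; apply/andP; split.
  apply: (le_trans h); rewrite mulrC ler_wpM2r ?expR_ge0//.
  by rewrite le_max lexx.
apply: (@le_trans _ _ (expR (- m%:R) * expR X)).
  by rewrite -[leLHS]mulr1 ler_wpM2l ?expR_ge0// -expR0 ler_expR.
by rewrite ler_wpM2r ?expR_ge0// le_max lexx orbT.
Qed.

Let powR_mono (u v : R) : 0 <= u -> u <= v -> u `^ alpha <= v `^ alpha.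
Proof.
move=> u0 uv; apply: ge0_ler_powR; rewrite ?nnegrE//; first exact: ltW.
exact: le_trans uv.
Qed.

Lemma sum_weight_cond_le (c : nat -> bool) m (K : R) : 0 <= K ->
  (forall j, (j < m)%N -> c j -> j%:R + 1 <= K) ->
  \sum_(j < m) (if c j then weight j else 0) <= K `^ alpha.
Proof.
move=> K0 cK; pose k := Num.truncn K.
have kK : k%:R <= K by rewrite truncn_le.
(* The induction needs this sharper bound: the weights telescope until [m] reaches [k], and
   afterwards nothing is added. *)
apply: (@le_trans _ _ ((minn m k)%:R `^ alpha)); last first.
  by apply: powR_mono => //; apply: le_trans kK; rewrite ler_nat geq_minr.
elim: m cK => [|m IH] cK; first by rewrite big_ord0 powR_ge0.
rewrite big_ord_recr/=.
have {}IH := IH (fun j jm => cK j (leqW jm)).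
case: ifPn => [cm|_]; last first.
  rewrite addr0 (le_trans IH)//; apply: powR_mono => //.
  by rewrite ler_nat leq_min geq_minr andbT (leq_trans (geq_minl _ _)).
have mk : (m < k)%N by rewrite /k truncn_gt_nat -natr1; exact: cK.
rewrite (minn_idPl mk); rewrite (minn_idPl (ltnW mk)) in IH.
by apply: (le_trans (lerD IH (lexx _))); rewrite /weight addrC subrK.
Qed.

Lemma sum_weight_ge (v : nat -> R) m k (th : R) : (k <= m)%N -> (forall j, 0 <= v j) ->
  (forall j, (j < k)%N -> th * weight j <= v j) -> th * k%:R `^ alpha <= \sum_(j < m) v j.
Proof.
move=> km v0 vk; rewrite -(subnKC km); elim: (m - k)%N => [|p IH].
  rewrite addn0 -sum_weight mulr_sumr; apply: ler_sum => j _; exact: vk.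
by rewrite addnS big_ord_recr/= (le_trans IH)// lerDl.
Qed.

(** A scale either does not separate the pair, and then [j + 1] is at most the level plus 2 while
    the term is at most its weight, or it contributes no more than its [tail]. *)
Lemma energy_kernel_upper m x y :
  energy_kernel m x y <= (level m x y + 2) `^ alpha + 2.
Proof.
pose c j := (rdist x y < 2 * expR (- j%:R)).
apply: (@le_trans _ _ (\sum_(j < m) (if c j then weight j else 0) + \sum_(j < m) weight j * tail j)).
  rewrite -big_split/=; apply: ler_sum => j _; case: ifPn => [_|]; rewrite /c.
    rewrite -[leLHS]addr0 lerD//; last by rewrite mulr_ge0 ?weight_ge0// ltW// tail_gt0.
    by rewrite -[leRHS]mulr1 ler_wpM2l ?weight_ge0// scale_kernel_le1.
  rewrite -leNgt => h; rewrite add0r ler_wpM2l ?weight_ge0//.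
  exact: scale_kernel_far.
apply: lerD; last exact: sum_weight_tail.
apply: sum_weight_cond_le; first by rewrite addr_ge0// level_ge0.
move=> j jm cj; have := level_ge (ltnW jm) cj; lra.
Qed.

(** For the scales [j] up to (level - C) / (1 + eta) one has 2 beta_j d(x, y) <= th, so they
    contribute almost their full weight. The loss [1 + eta] pays for the linear factor in
    [beta j]. *)
Lemma energy_kernel_lower (eta th : R) : 0 < eta -> 0 < th -> exists2 C : R, 0 <= C &
  forall m x y, expR (- th) * (Num.max 0 (level m x y - C) / (1 + eta)) `^ alpha <= energy_kernel m x y.
Proof.
move=> eta0 th0.
have A0 : 0 <= n%:R + 1 + alpha by rewrite !addr_ge0// ltW.
have B10 : 0 <= B + 1 by rewrite addr_ge0.
pose D := 4 * ((n%:R + 1 + alpha) / eta + (B + 1)).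
have D0 : 0 < D.
  by rewrite mulr_gt0// ltr_wpDl ?divr_ge0// ?ltr_wpDl//; exact: ltW.
have bD j : 2 * beta j <= D * expR ((1 + eta) * j%:R).
  have := ltr_linear_expR A0 B10 eta0 (ler0n R j) => h1.
  have h2 := beta_le j.
  have -> : (1 + eta) * j%:R = j%:R + eta * j%:R by rewrite mulrDl mul1r.
  rewrite expRD.
  have h3 := ler_wpM2l (ltW (expR_gt0 (j%:R : R))) h1.
  rewrite /D; move: h2 h3; set E := expR j%:R; set F := expR (eta * j%:R).
  set u := _ * j%:R + _; set v := _ / eta + _; nra.
(* Chosen so that [D * expR (- C) <= th]; for levels up to [C] the claimed lower bound is 0. *)
pose C := Num.max 0 (ln (D / th)).
have C0 : 0 <= C by rewrite le_max lexx.
exists C => // m x y.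
set b := Num.max 0 (level m x y - C) / (1 + eta).
have e1 : 0 < 1 + eta by rewrite ltr_wpDl.
have b0 : 0 <= b by rewrite divr_ge0 ?(ltW e1)// le_max lexx.
have [lC|Cl] := leP (level m x y) C.
  have -> : b = 0.
    rewrite /b (_ : Num.max 0 _ = 0) ?mul0r//; apply/max_idPl; lra.
  rewrite powR0 ?lt0r_neq0// mulr0; apply: sumr_ge0 => j _.
  by rewrite mulr_ge0 ?weight_ge0 ?scale_kernel_ge0.
have bE : (1 + eta) * b = level m x y - C.
  rewrite /b (_ : Num.max 0 _ = level m x y - C); last by apply/max_idPr; lra.
  by field; exact: lt0r_neq0.
have lpos : 0 < level m x y by exact: le_lt_trans Cl.
have bl : b <= m%:R.
  apply: le_trans (level_le m x y).
  have : b <= (1 + eta) * b by rewrite mulrDl mul1r lerDl mulr_ge0// ltW.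
  lra.
(* The number of scales [j < m] with [j <= b]. Scale 0 counts, hence the successor, and so [k] is at
   least [b]. *)
pose k := minn m (Num.truncn b).+1.
apply: (@le_trans _ _ (expR (- th) * k%:R `^ alpha)).
  rewrite ler_wpM2l ?expR_ge0//; apply: powR_mono => //.
  by rewrite /k /minn; case: ifP => _ //; exact: ltW (truncnS_gt _).
apply: (sum_weight_ge (v := fun j => weight j * scale_kernel j x y)).
- exact: geq_minl.
- by move=> j; rewrite mulr_ge0 ?weight_ge0 ?scale_kernel_ge0.
move=> j; rewrite leq_min => /andP[jm jb].
rewrite mulrC ler_wpM2l ?weight_ge0//.
apply: le_trans (scale_kernel_near j x y); rewrite ler_expR lerN2.
have jb' : j%:R <= b by rewrite -(truncn_ge_nat _ b0) -ltnS.
apply: (@le_trans _ _ (D * expR ((1 + eta) * j%:R) * expR (- level m x y))).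
  apply: ler_pM => //; first by rewrite mulr_ge0// beta_ge0.
  - exact: rdist_ge0.
  - exact: rdist_le_level.
rewrite -mulrA -expRD.
apply: (@le_trans _ _ (D * expR (- C))).
  rewrite ler_wpM2l ?(ltW D0)// ler_expR.
  have : (1 + eta) * j%:R <= (1 + eta) * b by rewrite ler_wpM2l// ltW.
  rewrite bE; lra.
rewrite expRN ler_pdivrMr ?expR_gt0// mulrC -ler_pdivrMr//.
have : ln (D / th) <= C by rewrite le_max lexx orbT.
by rewrite -ler_expR lnK// posrE divr_gt0.
Qed.

Lemma energy_kernel_level (e : R) : 0 < e -> exists2 C : R, 0 <= C & forall m x y,
  energy_kernel m x y <= (1 + e) * level m x y `^ alpha + C /\
  level m x y `^ alpha <= (1 + e) * energy_kernel m x y + C.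
Proof.
move=> e0; have [d /andP[d0 d1] d3] := cube_near1 e0.
have [eta eta0 heta] := powR_near1 alpha0 d0.
have d10 : 0 < 1 + d by rewrite addr_gt0.
have th0 : 0 < ln (1 + d) by rewrite ln_gt0// ltrDl.
have [C1 C10 HC1] := energy_kernel_lower eta0 th0.
have a0 := ltW alpha0.
have de : 1 + d <= 1 + e.
  apply: le_trans d3; rewrite -[leLHS]expr1; apply: ler_weXn2l => //; lra.
pose C2 := (1 + eta^-1) `^ alpha * 2 `^ alpha + 2.
pose C3 := (1 + eta^-1) `^ alpha * C1 `^ alpha.
have C20 : 0 <= C2 by rewrite addr_ge0// mulr_ge0 ?powR_ge0.
have C30 : 0 <= C3 by rewrite mulr_ge0 ?powR_ge0.
exists (C2 + C3) => [|m x y]; first exact: addr_ge0.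
have l0 := level_ge0 m x y; have lp := powR_ge0 (level m x y) alpha.
split.
  have h1 := energy_kernel_upper m x y.
  have h2 := @powR_add_le R alpha eta (level m x y) 2 a0 eta0 l0 (ler0n _ 2).
  have h3 : (1 + eta) `^ alpha * level m x y `^ alpha <= (1 + e) * level m x y `^ alpha.
    by rewrite ler_wpM2r// (le_trans heta).
  rewrite /C2; lra.
set b := Num.max 0 (level m x y - C1) / (1 + eta).
have e1 : 0 < 1 + eta by rewrite ltr_wpDl.
have b0 : 0 <= b by rewrite divr_ge0 ?(ltW e1)// le_max lexx.
have lb : level m x y <= (1 + eta) * b + C1.
  rewrite /b mulrC divfK ?lt0r_neq0// -lerBlDr le_max lexx orbT//.
have h1 := HC1 m x y; rewrite -/b expRN lnK ?posrE// in h1.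
have eb0 : 0 <= (1 + eta) * b by rewrite mulr_ge0// ltW.
have h2 := @powR_add_le R alpha eta ((1 + eta) * b) C1 a0 eta0 eb0 C10.
have h3 := powR_mono l0 lb.
rewrite powRM ?(ltW e1)// in h2.
have bp := powR_ge0 b alpha; have pp := powR_ge0 (1 + eta) alpha.
have h4 : b `^ alpha <= (1 + d) * energy_kernel m x y by rewrite -ler_pdivrMl.
have h5 : (1 + eta) `^ alpha * ((1 + eta) `^ alpha * b `^ alpha) <= (1 + d) ^+ 3 * energy_kernel m x y.
  rewrite exprS expr2 -!mulrA; apply: ler_pM => //; first exact: mulr_ge0.
  by apply: ler_pM.
have k0 : 0 <= energy_kernel m x y.
  by apply: sumr_ge0 => j _; rewrite mulr_ge0 ?weight_ge0 ?scale_kernel_ge0.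
have h6 : (1 + d) ^+ 3 * energy_kernel m x y <= (1 + e) * energy_kernel m x y.
  by rewrite ler_wpM2r.
rewrite /C3; lra.
Qed.

Lemma energy_kernel_ge0 m x y : 0 <= energy_kernel m x y.
Proof. by apply: sumr_ge0 => j _; rewrite mulr_ge0 ?weight_ge0 ?scale_kernel_ge0. Qed.

(** From kernel to level, from level to shifted level, and back to the kernel: three factors
    [1 + d]. The shift by [X] only adds a multiple of X^alpha. *)
Let half_quasi (e : R) : 0 < e -> exists2 C : R, 0 <= C &
  forall m (X : R) x y x' y', 0 <= X -> rdist x y <= expR X * rdist x' y' ->
   energy_kernel m x' y' <= (1 + e) * energy_kernel m x y + C * (1 + X `^ alpha).
Proof.
move=> e0; have [d /andP[d0 d1] d3] := cube_near1 e0.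
have [eta eta0 heta] := powR_near1 alpha0 d0.
have [C C0 HC] := energy_kernel_level d0.
have a0 := ltW alpha0.
have d10 : 0 < 1 + d by rewrite addr_gt0.
pose Q := (1 + eta^-1) `^ alpha.
have Q0 : 0 <= Q := powR_ge0 _ _.
exists (2 * Q + 4 * C + C).
  by rewrite !addr_ge0// mulr_ge0.
move=> m X x y x' y' X0 h.
have [h1 _] := HC m x' y'; have [_ h2] := HC m x y.
have l0 := level_ge0 m x y; have l0' := level_ge0 m x' y'.
have h3 := powR_mono l0' (level_quasi m X0 h).
have h4 := @powR_add_le R alpha eta (level m x y) X a0 eta0 l0 X0.
rewrite -/Q in h4.
have k0 := energy_kernel_ge0 m x y.
have Xp : 0 <= X `^ alpha := powR_ge0 _ _.
have lp : 0 <= level m x y `^ alpha := powR_ge0 _ _.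
move: h1 h2 h3 h4 heta d3 k0; set K := energy_kernel m x y; set K' := energy_kernel m x' y'.
set L := level m x y `^ alpha; set L' := level m x' y' `^ alpha; set S := (_ + X) `^ alpha.
set P := (1 + eta) `^ alpha => h1 h2 h3 h4 heta d3 k0.
have s1 : L' <= (1 + d) * L + Q * X `^ alpha.
  have : P * L <= (1 + d) * L by rewrite ler_wpM2r.
  lra.
have s2 : L' <= (1 + d) * ((1 + d) * K + C) + Q * X `^ alpha.
  apply: (le_trans s1); rewrite lerD2r ler_wpM2l// ltW//.
have s3 : K' <= (1 + d) * ((1 + d) * ((1 + d) * K + C) + Q * X `^ alpha) + C.
  apply: (le_trans h1); rewrite lerD2r ler_wpM2l// ltW//.
apply: (le_trans s3).
have -> : (1 + d) * ((1 + d) * ((1 + d) * K + C) + Q * X `^ alpha) + C =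
   (1 + d) ^+ 3 * K + (1 + d) * (1 + d) * C + (1 + d) * (Q * X `^ alpha) + C by ring.
have t1 : (1 + d) ^+ 3 * K <= (1 + e) * K by rewrite ler_wpM2r.
have t2 : (1 + d) * (1 + d) * C <= 4 * C.
  rewrite ler_wpM2r// (_ : 4 = 2 * 2); last by ring.
  by apply: ler_pM; lra.
have t3 : (1 + d) * (Q * X `^ alpha) <= 2 * (Q * X `^ alpha).
  by apply: ler_wpM2r; [exact: mulr_ge0|lra].
have t4 : 0 <= C * X `^ alpha by exact: mulr_ge0.
have -> : (2 * Q + 4 * C + C) * (1 + X `^ alpha) =
  2 * Q + 2 * (Q * X `^ alpha) + 4 * C + 4 * (C * X `^ alpha) + C + C * X `^ alpha by ring.
lra.
Qed.

Lemma energy_kernel_quasi (e : R) : 0 < e -> exists2 C : R, 0 <= C &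
  forall m (X : R) x y x' y', 0 <= X ->
   rdist x y <= expR X * rdist x' y' -> rdist x' y' <= expR X * rdist x y ->
   `|energy_kernel m x' y' - energy_kernel m x y| <= e * energy_kernel m x y + C * (1 + X `^ alpha).
Proof.
move=> e0.
(* Half of [e], because the bound from below uses the one-sided estimate in both directions, which
   doubles [d]. *)
have d0 : 0 < Num.min 1 (e / 2) by rewrite lt_min ltr01 divr_gt0.
set d := Num.min 1 (e / 2) in d0.
have d1 : d <= 1 by rewrite ge_min lexx.
have de : d <= e / 2 by rewrite ge_min lexx orbT.
have [C C0 HC] := half_quasi d0.
exists (2 * C); first by rewrite mulr_ge0.
move=> m X x y x' y' X0 h h'.
have h1 := HC m X x y x' y' X0 h; have h2 := HC m X x' y' x y X0 h'.
have k0 := energy_kernel_ge0 m x y; have k0' := energy_kernel_ge0 m x' y'.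
have Xp : 0 <= X `^ alpha := powR_ge0 _ _.
have T0 : 0 <= C * (1 + X `^ alpha) by rewrite mulr_ge0// addr_ge0.
rewrite -mulrA; move: (energy_kernel m x y) (energy_kernel m x' y') (C * (1 + X `^ alpha)) h1 h2 k0 k0' T0.
move=> K K' T h1 h2 k0 k0' T0.
clearbody d.
have dK : d * K <= e / 2 * K by rewrite ler_wpM2r.
have ddK : d * (d * K) <= d * K by rewrite ler_piMl// mulr_ge0// ltW.
have dT : d * T <= T by rewrite ler_piMl.
have dK' : d * K' <= d * ((1 + d) * K + T) by rewrite ler_wpM2l// ltW.
rewrite ler_norml; apply/andP; split; lra.
Qed.

(** * Energies, potentials and densities of a functional *)

Implicit Types (J : (M -> R) -> R) (g : M -> R) (f : homeo M) (P : (homeo M -> R) -> R).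

Definition push J f : (M -> R) -> R := fun g => J (g \o f).

Definition correlation m J1 J2 : R :=
  \sum_(j < m) weight j * \sum_(z <- net j) J1 (feature j z) * J2 (feature j z).

Definition energy m J : R := correlation m J J.

Definition potential m J x : R := J (energy_kernel m x).

Definition density m J g : R := J (fun x => g x * potential m J x).

(** Quadratic in the averages of the features and free of any other trace of [J], so that [spread]
    can control it. *)
Definition atomic_density m J g : R :=
  \sum_(j < m) weight j * \sum_(z <- net j) g z * J (feature j z) ^+ 2.

Lemma averaging_sq J g : averaging J -> bcont g -> J g ^+ 2 <= J (fun x => g x ^+ 2).
Proof.
move=> EJ bg; set a := J g.
have b2 : bcont (fun x => g x ^+ 2) by exact: bcontX.
have bl : bcont (fun x => 2 * a * g x) by exact: bcontZ.
have h : 0 <= J (fun x => g x ^+ 2 - 2 * a * g x + a ^+ 2).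
  apply: (averaging_ge0 EJ) => [|x].
    by apply: bcontD; [exact: bcontB|exact: bcont_cst].
  by have := sqr_ge0 (g x - a); rewrite sqrrB mulr2n; lra.
rewrite (averagingD EJ (bcontB b2 bl) (bcont_cst _)) (averagingB EJ b2 bl) in h.
by rewrite (averaging_cst EJ) (averagingZ EJ _ bg) -/a in h; lra.
Qed.

Lemma energy_kernelE m x y : energy_kernel m x y =
  \sum_(j < m) \sum_(z <- net j) (weight j * feature j z x) * feature j z y.
Proof.
apply: eq_bigr => j _; rewrite /scale_kernel mulr_sumr; apply: eq_bigr => z _.
by rewrite mulrA.
Qed.

Lemma bcont_energy_kernel m x : bcont (energy_kernel m x).
Proof.
have -> : energy_kernel m x = fun y =>
   \sum_(j < m) \sum_(z <- net j) (weight j * feature j z x) * feature j z y.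
  by apply/funext => y; exact: energy_kernelE.
apply: bcont_sum => j; apply: bcont_sum => z; apply: bcontZ; exact: bcont_feature.
Qed.

Lemma potentialE m J x : averaging J -> potential m J x =
  \sum_(j < m) \sum_(z <- net j) (weight j * J (feature j z)) * feature j z x.
Proof.
move=> EJ; rewrite /potential.
have -> : energy_kernel m x = fun y =>
   \sum_(j < m) \sum_(z <- net j) (weight j * feature j z x) * feature j z y.
  by apply/funext => y; exact: energy_kernelE.
rewrite (averaging_sum EJ (index_enum _)); last first.
  by move=> j; apply: bcont_sum => z; apply: bcontZ; exact: bcont_feature.
apply: eq_bigr => j _; rewrite (averaging_sum EJ (net j)); last first.
  by move=> z; apply: bcontZ; exact: bcont_feature.
apply: eq_bigr => z _; rewrite (averagingZ EJ)//; last exact: bcont_feature.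
by rewrite mulrAC.
Qed.

Lemma bcont_potential m J : averaging J -> bcont (potential m J).
Proof.
move=> EJ; have -> : potential m J = fun x =>
    \sum_(j < m) \sum_(z <- net j) (weight j * J (feature j z)) * feature j z x.
  by apply/funext => x; exact: potentialE.
apply: bcont_sum => j; apply: bcont_sum => z; apply: bcontZ; exact: bcont_feature.
Qed.

Lemma densityE m J1 J2 g : averaging J1 -> averaging J2 -> bcont g ->
  J1 (fun x => g x * potential m J2 x) =
  \sum_(j < m) weight j * \sum_(z <- net j) J1 (fun x => g x * feature j z x) * J2 (feature j z).
Proof.
move=> E1 E2 bg.
have bgf j z : bcont (fun x => g x * feature j z x) by apply: bcontM => //; exact: bcont_feature.
have -> : (fun x => g x * potential m J2 x) = fun x =>
    \sum_(j < m) \sum_(z <- net j) (weight j * J2 (feature j z)) * (g x * feature j z x).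
  apply/funext => x; rewrite potentialE// mulr_sumr; apply: eq_bigr => j _.
  rewrite mulr_sumr; apply: eq_bigr => z _; ring.
rewrite (averaging_sum E1 (index_enum _)); last first.
  by move=> j; apply: bcont_sum => z; exact: bcontZ.
apply: eq_bigr => j _; rewrite (averaging_sum E1 (net j)); last first.
  by move=> z; exact: bcontZ.
rewrite mulr_sumr; apply: eq_bigr => z _; rewrite (averagingZ E1)//; ring.
Qed.

Lemma correlationE m J1 J2 : averaging J1 -> averaging J2 ->
  correlation m J1 J2 = J1 (potential m J2).
Proof.
move=> E1 E2; have := @densityE m J1 J2 (fun=> 1) E1 E2 (bcont_cst 1).
have -> : (fun x => 1 * potential m J2 x) = potential m J2.
  by apply/funext => x; rewrite mul1r.
move=> ->; apply: eq_bigr => j _; congr (_ * _); apply: eq_bigr => z _; congr (_ * _).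
by congr J1; apply/funext => x; rewrite mul1r.
Qed.

Lemma energyE m J : averaging J -> energy m J = J (potential m J).
Proof. by move=> EJ; exact: correlationE. Qed.

Lemma energy_ge0 m J : 0 <= energy m J.
Proof.
apply: sumr_ge0 => j _; rewrite mulr_ge0 ?weight_ge0//; apply: sumr_ge0 => z _.
by rewrite -expr2 sqr_ge0.
Qed.

Lemma sum_sq_feature_le1 j J : averaging J -> \sum_(z <- net j) J (feature j z) ^+ 2 <= 1.
Proof.
move=> EJ; rewrite -(averaging_cst EJ 1).
have -> : (fun=> 1 : R) = fun x : M => \sum_(z <- net j) feature j z x ^+ 2.
  by apply/funext => x; rewrite sum_feature_sq.
rewrite (averaging_sum EJ (net j)); last by move=> z; apply: bcontX; exact: bcont_feature.
by apply: ler_sum => z _; apply: averaging_sq => //; exact: bcont_feature.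
Qed.

Lemma energy_le m J : averaging J -> energy m J <= m%:R `^ alpha.
Proof.
move=> EJ; rewrite -sum_weight; apply: ler_sum => j _.
rewrite -[leRHS]mulr1 ler_wpM2l ?weight_ge0//.
apply: le_trans (sum_sq_feature_le1 j EJ).
by apply: ler_sum => z _; rewrite -expr2.
Qed.

Lemma correlation_le m J1 J2 : correlation m J1 J2 <= 2^-1 * (energy m J1 + energy m J2).
Proof.
rewrite /energy /correlation -big_split/= mulr_sumr; apply: ler_sum => j _.
rewrite -mulrDr mulrCA ler_wpM2l ?weight_ge0//.
rewrite -big_split/= mulr_sumr; apply: ler_sum => z _.
by rewrite -!expr2; exact: mul_le_mean_sq.
Qed.

Lemma potential_quasi (e C : R) m J f (X : R) : averaging J ->
  (forall x y, `|energy_kernel m (f x) (f y) - energy_kernel m x y| <=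
     e * energy_kernel m x y + C * (1 + X `^ alpha)) ->
  forall x, `|potential m (push J f) (f x) - potential m J x| <=
     e * potential m J x + C * (1 + X `^ alpha).
Proof.
move=> EJ H x; rewrite /potential /push.
have b1 : bcont (energy_kernel m (f x) \o f) by exact: bcont_homeo (bcont_energy_kernel _ _).
have b2 := bcont_energy_kernel m x.
rewrite -(averagingB EJ b1 b2).
apply: (le_trans (le_norm_averaging EJ (bcontB b1 b2))).
rewrite -(averagingZ EJ e b2) -[X in _ + X](averaging_cst EJ).
rewrite -(averagingD EJ (bcontZ _ b2) (bcont_cst _)).
apply: (le_averaging EJ).
- by apply: bcont_norm; exact: bcontB.
- by apply: bcontD; [exact: bcontZ|exact: bcont_cst].
- by move=> y; exact: H.
Qed.

(** The density of the pushed functional and the push of the density differ only in the potential,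
    taken at [f x] for the former and at [x] for the latter. *)
Lemma density_quasi (e C b : R) m J f (X : R) g : averaging J -> continuous g ->
  0 <= b -> (forall x, `|g x| <= b) ->
  (forall x y, `|energy_kernel m (f x) (f y) - energy_kernel m x y| <=
     e * energy_kernel m x y + C * (1 + X `^ alpha)) ->
  `|density m (push J f) g - density m J (g \o f)| <= b * (e * energy m J + C * (1 + X `^ alpha)).
Proof.
move=> EJ cg b0 gb H.
have bg := bcont_continuous cg.
have EP := push_averaging f EJ.
have bU := bcont_potential m EJ; have bUf := bcont_homeo f (bcont_potential m EP).
have bgf := bcont_homeo f bg.
rewrite /density {1}/push.
have -> : (fun x => g x * potential m (push J f) x) \o f =
   fun x => (g \o f) x * (potential m (push J f) \o f) x by [].
rewrite -(averagingB EJ (bcontM bgf bUf) (bcontM bgf bU)).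
apply: (le_trans (le_norm_averaging EJ (bcontB (bcontM bgf bUf) (bcontM bgf bU)))).
rewrite energyE// -(averagingZ EJ e bU) -[X in _ + X](averaging_cst EJ).
have bs : bcont (fun x => e * potential m J x + C * (1 + X `^ alpha)).
  by apply: bcontD; [exact: bcontZ|exact: bcont_cst].
rewrite -(averagingD EJ (bcontZ _ bU) (bcont_cst _)) -(averagingZ EJ b bs).
apply: (le_averaging EJ).
- by apply: bcont_norm; apply: bcontB; exact: bcontM.
- exact: bcontZ.
- move=> x; move: (gb (f x)) (potential_quasi EJ H x) => /=.
  move: (potential m (push J f) (f x)) (potential m J x) (g (f x)) => u v w wb uv.
  by rewrite -mulrBr normrM; apply: ler_pM.
Qed.

Lemma energy_quasi (e C : R) m J f (X : R) : averaging J ->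
  (forall x y, `|energy_kernel m (f x) (f y) - energy_kernel m x y| <=
     e * energy_kernel m x y + C * (1 + X `^ alpha)) ->
  energy m (push J f) <= (1 + e) * energy m J + C * (1 + X `^ alpha).
Proof.
move=> EJ H.
have c1 : continuous (fun _ : M => 1 : R) by move=> x; exact: cvg_cst.
have := @density_quasi e C 1 m J f X (fun=> 1) EJ c1 ler01 _ H.
have E J' : averaging J' -> density m J' (fun=> 1) = energy m J'.
  move=> EJ'; rewrite energyE//; congr J'; apply/funext => x; exact: mul1r.
have -> : density m J ((fun=> 1) \o f) = energy m J by exact: E.
rewrite (E _ (push_averaging f EJ)) => h.
have h1 : forall x : M, `|1 : R| <= 1 by move=> _; rewrite normr1.
move: (h h1) => {h h1 H}; rewrite mul1r ler_norml => /andP[_].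
by move: (energy m (push J f)) (energy m J) (C * _) => u v w; lra.
Qed.

(* At small scales the features are concentrated near the points of the net. *)
Lemma density_atomic g (e : R) : continuous g -> 0 < e -> exists2 C : R, 0 <= C &
  forall m J, averaging J -> `|density m J g - atomic_density m J g| <= e * energy m J + C.
Proof.
move=> cg e0; have bg := bcont_continuous cg.
have [b b0 gb] := continuous_bounded cg.
have [d d0 Hd] := continuous_uniformly cg e0.
pose K := Num.max 0 (- ln d) + 1.
have K0 : 0 <= K by rewrite addr_ge0// le_max lexx.
exists (2 * b * K `^ alpha + 2 * b * 2).
  by rewrite addr_ge0// ?mulr_ge0 ?powR_ge0// ltW.
move=> m J EJ.
pose c j := (d <= expR (- j%:R)).
(* Over the reach of a feature, [g] may vary by [2 * b] at the finitely many scales with [c j], and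
   by at most [e] at the others. *)
pose osc j : R := e + (if c j then 2 * b else 0).
have osc0 j : 0 <= osc j by rewrite addr_ge0 ?(ltW e0)//; case: ifP => // _; rewrite mulr_ge0// ltW.
have bF j z := bcont_feature j z.
have tc0 j : 0 <= tail j / card_net j by rewrite divr_ge0// ltW ?tail_gt0 ?card_net_gt0.
have gg x z : `|g x - g z| <= 2 * b.
  by rewrite (le_trans (ler_normB _ _))// mulr_natl mulr2n lerD.
have pt j z x : `|(g x - g z) * feature j z x| <= osc j * feature j z x + 2 * b * (tail j / card_net j).
  rewrite normrM [X in _ * X]ger0_norm ?feature_ge0//.
  have [far|near_] := leP (expR (- j%:R)) (rdist x z).
    apply: ler_wpDl; first exact: mulr_ge0 (osc0 j) (feature_ge0 j z x).
    by apply: ler_pM; rewrite ?feature_ge0// ?feature_far.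
  apply: ler_wpDr; first by apply: mulr_ge0 (tc0 j); rewrite mulr_ge0// ltW.
  apply: ler_wpM2r; first exact: feature_ge0.
  rewrite /osc /c; case: ifPn => [_|]; first by rewrite (le_trans (gg x z))// lerDr ltW.
  by rewrite -ltNge addr0 => h; apply: ltW; apply: Hd; exact: lt_trans h.
have FJ0 j z : 0 <= J (feature j z).
  by apply: (averaging_ge0 EJ) => // x; exact: feature_ge0.
have FJ1 j z : z \in net j -> J (feature j z) <= 1.
  by move=> zj; apply: (averaging_le EJ) => // x; exact: feature_le1.
have one j z : z \in net j -> `|J (fun x => g x * feature j z x) * J (feature j z) - g z * J (feature j z) ^+ 2|
    <= osc j * J (feature j z) ^+ 2 + 2 * b * (tail j / card_net j).
  move=> zj; have bgF := bcontM bg (bF j z).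
  have -> : J (fun x => g x * feature j z x) * J (feature j z) - g z * J (feature j z) ^+ 2 =
     J (fun x => (g x - g z) * feature j z x) * J (feature j z).
    have -> : (fun x => (g x - g z) * feature j z x) = (fun x => g x * feature j z x - g z * feature j z x).
      by apply/funext => x; rewrite mulrBl.
    rewrite (averagingB EJ bgF (bcontZ _ (bF j z))) (averagingZ EJ _ (bF j z)); ring.
  rewrite normrM [X in _ * X]ger0_norm//.
  have h : `|J (fun x => (g x - g z) * feature j z x)| <= osc j * J (feature j z) + 2 * b * (tail j / card_net j).
    have bgg : bcont (fun x => (g x - g z) * feature j z x).
      by apply: bcontM => //; apply: bcontB => //; exact: bcont_cst.
    apply: (le_trans (le_norm_averaging EJ bgg)).
    rewrite -(averagingZ EJ _ (bF j z)) -[X in _ + X](averaging_cst EJ).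
    rewrite -(averagingD EJ (bcontZ _ (bF j z)) (bcont_cst _)).
    apply: (le_averaging EJ); first exact: bcont_norm.
      by apply: bcontD; [exact: bcontZ|exact: bcont_cst].
    by move=> x; exact: pt.
  apply: (le_trans (ler_wpM2r (FJ0 j z) h)).
  rewrite mulrDl -(mulrA (osc j)) -expr2 lerD2l -[leRHS]mulr1 ler_wpM2l ?FJ1//.
  by apply: mulr_ge0 (tc0 j); rewrite mulr_ge0// ltW.
rewrite /density (densityE m EJ EJ bg) /atomic_density -sumrB.
apply: (le_trans (ler_norm_sum _ _ _)).
apply: (@le_trans _ _ (\sum_(j < m) (e * (weight j * \sum_(z <- net j) J (feature j z) * J (feature j z)) +
    2 * b * (if c j then weight j else 0) + 2 * b * (weight j * tail j)))); last first.
  rewrite !big_split/= -!mulr_sumr -addrA lerD2l.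
  apply: lerD; apply: ler_wpM2l; rewrite ?mulr_ge0 ?(ltW b0)//; last exact: sum_weight_tail.
  apply: sum_weight_cond_le => // j jm; rewrite /c /K lerD2r => dj.
  have : ln d <= - j%:R by rewrite -[leRHS]expRK ler_ln ?posrE ?expR_gt0.
  by rewrite le_max lerNr => ->; rewrite orbT.
apply: ler_sum => j _; rewrite -mulrBr normrM [X in X * _]ger0_norm ?weight_ge0//.
rewrite -sumrB.
apply: (@le_trans _ _ (weight j * \sum_(z <- net j) (osc j * J (feature j z) ^+ 2 + 2 * b * (tail j / card_net j)))).
  rewrite ler_wpM2l ?weight_ge0// (le_trans (ler_norm_sum _ _ _))//.
  by rewrite big_seq [leRHS]big_seq; apply: ler_sum => z; exact: one.
rewrite big_split/= -mulr_sumr big_const_seq count_predT iter_addr_0 -(mulr_natr _ (size _)) -/(card_net j).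
have -> : 2 * b * (tail j / card_net j) * card_net j = 2 * b * tail j.
  by field; rewrite lt0r_neq0// card_net_gt0.
under [X in _ <= e * (_ * X) + _ + _]eq_bigr do rewrite -expr2.
have S1 := sum_sq_feature_le1 j EJ.
have S0 : 0 <= \sum_(z <- net j) J (feature j z) ^+ 2 by apply: sumr_ge0 => z _; exact: sqr_ge0.
have w0 := weight_ge0 j; have t0 := tail_gt0 j.
move: S1 S0; set S := \sum_(z <- net j) _ => S1 S0.
rewrite mulrDr /osc; apply: lerD; last by rewrite mulrCA.
rewrite [(_ + _) * S]mulrDl [weight j * (_ + _)]mulrDr; apply: lerD; first by rewrite mulrCA.
case: ifP => _; last by rewrite mul0r !mulr0.
by rewrite mulrCA ler_wpM2l ?mulr_ge0 ?(ltW b0)// -[leRHS]mulr1 ler_wpM2l.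
Qed.

(** * Averaging over the group: moments, variance and concentration *)

Definition log_distortion f (X : R) : Prop := 0 <= X /\ forall x y,
  rdist x y <= expR X * rdist (f x) (f y) /\ rdist (f x) (f y) <= expR X * rdist x y.

(** States that the mean of X^alpha is at most [c], but tested on bounded continuous [h]: the
    bi-Lipschitz constant need not be continuous in [f], so [P] is not applied to it. *)
Definition log_moment P (c : R) : Prop := forall h (a b : R), bcont h -> 0 <= b ->
  (forall f X, log_distortion f X -> h f <= a + b * X `^ alpha) -> P h <= a + b * c.

Lemma potential_ge0 m J x : averaging J -> 0 <= potential m J x.
Proof.
move=> EJ; apply: (averaging_ge0 EJ) (bcont_energy_kernel m x) _ => y.
exact: energy_kernel_ge0.
Qed.

Lemma density_averaging m J : averaging J -> 0 < energy m J ->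
  averaging (fun g => density m J g / energy m J).
Proof.
move=> EJ E0; have bU := bcont_potential m EJ; split.
- move=> a g1 g2 b1 b2; rewrite /density.
  have -> : (fun x => (a * g1 x + g2 x) * potential m J x) =
      fun x => a * (g1 x * potential m J x) + g2 x * potential m J x.
    by apply/funext => x; rewrite mulrDl mulrA.
  rewrite (averagingD EJ (bcontZ _ (bcontM b1 bU)) (bcontM b2 bU)).
  by rewrite (averagingZ EJ _ (bcontM b1 bU)) mulrDl mulrA.
- move=> g bg g0; apply: mulr_ge0; last by rewrite invr_ge0 ltW.
  apply: (averaging_ge0 EJ (bcontM bg bU)) => x.
  by apply: mulr_ge0 => //; exact: potential_ge0.
- rewrite /density.
  have -> : (fun x => 1 * potential m J x) = potential m J by apply/funext => x; rewrite mul1r.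
  by rewrite -energyE// divff// gt_eqF.
Qed.

Lemma bcont_density_push m J g : averaging J -> 0 < energy m J -> continuous g ->
  bcont (fun f => density m J (g \o f)).
Proof.
move=> EJ E0 cg.
have := bcontZ (energy m J) (bcont_push (density_averaging EJ E0) (bcont_continuous cg)).
congr bcont; apply/funext => f; rewrite mulrC divfK// gt_eqF//.
Qed.

Lemma bcont_feature_push J j z : averaging J -> bcont (fun f => J (feature j z \o f)).
Proof. by move=> EJ; apply: bcont_push => //; exact: bcont_feature. Qed.

Lemma bcont_energy_push m J : averaging J -> bcont (fun f => energy m (push J f)).
Proof.
move=> EJ; apply: bcont_sum => j; apply: bcontZ; apply: bcont_sum => z.
exact: bcontM (bcont_feature_push j z EJ) (bcont_feature_push j z EJ).
Qed.

(** The weighted squared deviation of the features under [f] from their mean; averaging it over [P]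
    gives the variance. *)
Definition spread m P J f : R := \sum_(j < m) weight j *
  \sum_(z <- net j) (J (feature j z \o f) - conv_mean P J (feature j z)) ^+ 2.

Lemma bcont_spread m P J : averaging J -> bcont (spread m P J).
Proof.
move=> EJ; apply: bcont_sum => j; apply: bcontZ; apply: bcont_sum => z; apply: bcontX.
by apply: bcontB; [exact: bcont_feature_push|exact: bcont_cst].
Qed.

Lemma mean_spread m P J : averaging P -> averaging J ->
  P (spread m P J) = P (fun f => energy m (push J f)) - energy m (conv_mean P J).
Proof.
move=> EP EJ.
have ba j z := bcont_feature_push j z EJ.
have bs j z : bcont (fun f => (J (feature j z \o f) - conv_mean P J (feature j z)) ^+ 2).
  by apply: bcontX; apply: bcontB => //; exact: bcont_cst.
have bm j z : bcont (fun f => push J f (feature j z) * push J f (feature j z)).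
  exact: bcontM (ba j z) (ba j z).
have bsw j : bcont (fun f => weight j * \sum_(z <- net j) (J (feature j z \o f) - conv_mean P J (feature j z)) ^+ 2).
  by apply: bcontZ; exact: bcont_sum.
have bmw j : bcont (fun f => weight j * \sum_(z <- net j) push J f (feature j z) * push J f (feature j z)).
  by apply: bcontZ; exact: bcont_sum.
rewrite /spread /energy /correlation.
rewrite (averaging_sum EP (index_enum 'I_m) (fun j : 'I_m => bsw j)) (averaging_sum EP (index_enum 'I_m) (fun j : 'I_m => bmw j)) -sumrB.
apply: eq_bigr => j _.
rewrite (averagingZ EP _ (bcont_sum (net j) (bs j))) (averagingZ EP _ (bcont_sum (net j) (bm j))) -mulrBr.
congr (_ * _); rewrite (averaging_sum EP (net j) (bs j)) (averaging_sum EP (net j) (bm j)) -sumrB.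
apply: eq_bigr => z _; rewrite /push; set b := conv_mean P J _.
have -> : (fun f => (J (feature j z \o f) - b) ^+ 2) = fun f =>
    (J (feature j z \o f) * J (feature j z \o f) - 2 * b * J (feature j z \o f)) + b * b.
  by apply/funext => f; rewrite sqrrB; ring.
rewrite (averagingD EP (bcontB (bm j z) (bcontZ _ (ba j z))) (bcont_cst _)).
rewrite (averagingB EP (bm j z) (bcontZ _ (ba j z))) (averagingZ EP _ (ba j z)) (averaging_cst EP).
by rewrite -[P (fun f => J (feature j z \o f))]/b; ring.
Qed.

Lemma spread_ge0 m P J f : 0 <= spread m P J f.
Proof.
apply: sumr_ge0 => j _; rewrite mulr_ge0 ?weight_ge0//; apply: sumr_ge0 => z _.
exact: sqr_ge0.
Qed.

(** Young's inequality for (a - b)(a + b), with the large factor on the difference, which will be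
    small on average. *)
Lemma sqr_sub_le (a b eta : R) : 0 < eta ->
  `|a ^+ 2 - b ^+ 2| <= (a - b) ^+ 2 / eta + eta * (a ^+ 2 + b ^+ 2).
Proof.
move=> eta0; rewrite subr_sqr normrM.
have h := mul_le_mean_sq (`|a - b| / Num.sqrt eta) (Num.sqrt eta * `|a + b|).
have s0 : 0 < Num.sqrt eta by rewrite sqrtr_gt0.
have e1 : `|a - b| / Num.sqrt eta * (Num.sqrt eta * `|a + b|) = `|a - b| * `|a + b|.
  by field; rewrite gt_eqF.
rewrite e1 in h; apply: (le_trans h).
rewrite !exprMn exprVn sqr_sqrtr ?(ltW eta0)// !real_normK ?num_real//.
have q : (a + b) ^+ 2 <= 2 * (a ^+ 2 + b ^+ 2).
  by have := sqr_ge0 (a - b); rewrite sqrrB sqrrD !mulr2n; lra.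
have q2 : eta * (a + b) ^+ 2 <= 2 * (eta * (a ^+ 2 + b ^+ 2)).
  by rewrite (mulrCA 2 eta) (ler_wpM2l (ltW eta0) q).
have q3 : 0 <= (a - b) ^+ 2 / eta by rewrite divr_ge0 ?sqr_ge0// ltW.
move: q2 q3; move: (_ / eta) (eta * (a ^+ 2 + _)) (eta * (a + b) ^+ 2).
by move=> u v w; lra.
Qed.

Lemma atomic_density_push m P J f g (b eta : R) : 0 <= b -> (forall x, `|g x| <= b) -> 0 < eta ->
  `|atomic_density m (push J f) g - atomic_density m (conv_mean P J) g| <=
  b * (spread m P J f / eta + eta * (energy m (push J f) + energy m (conv_mean P J))).
Proof.
move=> b0 gb eta0.
rewrite /atomic_density -sumrB (le_trans (ler_norm_sum _ _ _))//.
rewrite /spread /energy /correlation -big_split/= mulr_suml mulr_sumr -big_split/= mulr_sumr.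
apply: ler_sum => j _; rewrite -mulrBr normrM [X in X * _]ger0_norm ?weight_ge0//.
rewrite -mulrDr -mulrA [eta * _]mulrCA -mulrDr mulrCA.
rewrite ler_wpM2l ?weight_ge0// -sumrB (le_trans (ler_norm_sum _ _ _))//.
rewrite -big_split/= mulr_suml mulr_sumr -big_split/= mulr_sumr.
apply: ler_sum => z _; rewrite -mulrBr normrM -!expr2.
apply: ler_pM => //; exact: sqr_sub_le.
Qed.

Lemma mean_energy_push_le (e : R) : 0 < e -> exists2 C : R, 0 <= C &
  forall m P J c, averaging P -> averaging J -> log_moment P c ->
    P (fun f => energy m (push J f)) <= (1 + e) * energy m J + C * (1 + c).
Proof.
move=> e0; have [C C_ge0 HC] := energy_kernel_quasi e0.
exists C => // m P J c EP EJ Pc.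
rewrite mulrDr mulr1 addrA; apply: Pc => //; first exact: bcont_energy_push.
move=> f X [X0 fX].
have -> : (1 + e) * energy m J + C + C * X `^ alpha = (1 + e) * energy m J + C * (1 + X `^ alpha).
  by rewrite [in RHS]mulrDr mulr1 addrA.
apply: energy_quasi => // x y.
by have [? ?] := fX x y; exact: HC.
Qed.

Lemma energy_conv_le m P J : averaging P -> averaging J ->
  energy m (conv_mean P J) <= P (fun f => energy m (push J f)).
Proof.
move=> EP EJ; rewrite -subr_ge0 -mean_spread//.
by apply: (averaging_ge0 EP (bcont_spread m P EJ)) => f; exact: spread_ge0.
Qed.

(* If averaging over P nearly preserves the energy, then the densities seen through P-almost every f are nearly the same. *)
Lemma concentration g (e : R) : continuous g -> 0 < e -> exists C C' : R, [/\ 0 <= C, 0 <= C' &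
  forall m P J c, averaging P -> averaging J -> 0 <= c -> log_moment P c -> 0 < energy m J ->
    P (fun f => `|density m J (g \o f) - atomic_density m (conv_mean P J) g|) <=
    e * energy m J + C * (1 + c) + C' * (energy m J - energy m (conv_mean P J))].
Proof.
move=> cg e0; have [b b0 gb] := continuous_bounded cg.
have b0' := ltW b0.
have b53 : 0 < 5 * b + 3 by rewrite addr_gt0// mulr_gt0.
(* The errors proportional to the energy will add up to [(5 * b + 3) * d]. *)
pose d := Num.min 1 (e / (5 * b + 3)).
have d0 : 0 < d by rewrite lt_min ltr01 divr_gt0.
have d1 : d <= 1 by rewrite ge_min lexx.
have bd : (5 * b + 3) * d <= e.
  by rewrite mulrC -ler_pdivlMr// ge_min lexx orbT.
clearbody d.
have b1 : 0 < b + 1 by rewrite addr_gt0.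
(* The spread enters with the factor [b / d], so its mean needs the finer error [e2], for which
   [b / d * e2 <= d]. *)
pose e2 := d * d / (b + 1).
have e20 : 0 < e2 by rewrite divr_gt0// mulr_gt0.
have be2 : b / d * e2 <= d.
  have -> : b / d * e2 = d * (b / (b + 1)) by rewrite /e2; field; rewrite !gt_eqF.
  by rewrite ger_pMr// ler_pdivrMr// mul1r lerDl.
have [C1 C10 H1] := energy_kernel_quasi d0.
have [C2 C20 H2] := density_atomic cg d0.
have [C3 C30 H3] := mean_energy_push_le d0.
have [C4 C40 H4] := mean_energy_push_le e20.
have d0' := ltW d0; have bid : 0 <= b / d by rewrite divr_ge0.
exists (C1 * (b + d + b * d) + C2 + b * d * C3 + b / d * C4), (b / d).
have bd0 : 0 <= b * d by exact: mulr_ge0.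
have bbd0 : 0 <= b + d + b * d by rewrite !addr_ge0.
split=> //; first by rewrite !addr_ge0// mulr_ge0.
move=> m P J c EP EJ c0 Pc E0.
set A := atomic_density m (conv_mean P J) g.
set E := energy m J in E0 *; set Ec := energy m (conv_mean P J).
have bD : bcont (fun f => `|density m J (g \o f) - A|).
  by apply: bcont_norm; apply: bcontB; [exact: bcont_density_push|exact: bcont_cst].
have bS := bcont_spread m P EJ.
have PE := H3 m P J c EP EJ Pc; have PE2 := H4 m P J c EP EJ Pc.
have EcP : Ec <= P (fun f => energy m (push J f)) := energy_conv_le m EP EJ.
have PS : P (spread m P J) = P (fun f => energy m (push J f)) - Ec := mean_spread m EP EJ.
have Ec2 : Ec <= 2 * E + C3 * (1 + c).
  apply: (le_trans EcP); apply: (le_trans PE); rewrite lerD2r ler_wpM2r ?(ltW E0)//.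
  by rewrite -[2]/(1 + 1) lerD2l.
have PSle : b / d * P (spread m P J) <= d * E + b / d * C4 * (1 + c) + b / d * (E - Ec).
  apply: (@le_trans _ _ (b / d * ((1 + e2) * E + C4 * (1 + c) - Ec))).
    by rewrite ler_wpM2l// PS lerD2r.
  have := ler_wpM2r (ltW E0) be2.
  by move: (b / d) => t; lra.
(* The spread is subtracted before averaging: what remains is bounded by a constant plus a multiple
   of X^alpha, the form that [log_moment] accepts. *)
have hle : P (fun f => `|density m J (g \o f) - A| - b / d * spread m P J f) <=
    ((5 * b + 2) * d * E + C1 * (b + d + b * d) + C2 + b * d * C3 * (1 + c)) +
    C1 * (b + d + b * d) * c.
  apply: Pc; [|by rewrite mulr_ge0|].
    by apply: bcontB => //; exact: bcontZ.
  move=> f X [X0 fX].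
  have Hq x y : `|energy_kernel m (f x) (f y) - energy_kernel m x y| <=
      d * energy_kernel m x y + C1 * (1 + X `^ alpha).
    by have [? ?] := fX x y; exact: H1.
  have S1 := density_quasi EJ cg b0' gb Hq.
  have S2 := H2 m (push J f) (push_averaging f EJ).
  have S3 := atomic_density_push m P J f b0' gb d0.
  have Ef := energy_quasi EJ Hq.
  have Ef2 : energy m (push J f) <= 2 * E + C1 * (1 + X `^ alpha).
    apply: (le_trans Ef); rewrite lerD2r ler_wpM2r ?(ltW E0)//.
    by rewrite -[2]/(1 + 1) lerD2l.
  rewrite -/A -/Ec in S3; rewrite -/E in S1.
  have tri : `|density m J (g \o f) - A| <=
      `|density m (push J f) g - density m J (g \o f)| +
      `|density m (push J f) g - atomic_density m (push J f) g| +
      `|atomic_density m (push J f) g - A|.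
    rewrite [X in _ <= X + _ + _]distrC.
    apply: (le_trans (ler_distD (atomic_density m (push J f) g) _ _)).
    by rewrite lerD2r ler_distD.
  have := lerD (lerD S1 S2) S3.
  move=> /(le_trans tri) {tri S1 S2 S3 Hq Ef} tot.
  rewrite lerBlDl; apply: (le_trans tot).
  exact: (concentration_arith _ _ b0' d0' Ef2 Ec2).
have := lerD hle PSle; rewrite (averagingB EP bD (bcontZ _ bS)) (averagingZ EP _ bS).
move=> tot.
have Ebd := ler_wpM2r (ltW E0) bd.
have C2c := mulr_ge0 C20 c0.
rewrite subrK in tot; move: tot Ebd C2c.
move: (P _) => p; lra.
Qed.

End kernel.

(** * Contraction of the energy *)

Section ultralimits.
Context (R : realType) (U : set_system nat) {UU : UltraFilter U}.

Lemma fmap_ultra (T : Type) (u : nat -> T) : UltraFilter (u @ U).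
Proof.
have PU : ProperFilter U by exact: ultra_proper.
split; first exact: fmap_proper_filter.
move=> G PG sG; apply/seteqP; split=> // A GA.
have [//|UnA] := in_ultra_setVsetC (u @^-1` A) UU.
have GnA : G (~` A) by exact: sG.
by have [x []] := filter_ex (filterI GA GnA).
Qed.

Lemma compact_ultralimit (T : topologicalType) (A : set T) (u : nat -> T) :
  compact A -> (forall k, A (u k)) -> exists2 l, A l & u @ U --> l.
Proof.
have PU : ProperFilter U by exact: ultra_proper.
rewrite compact_ultra => cA Au.
have FA : (u @ U) A by apply: (@filterE _ U) => k; exact: Au.
have [l [Al ul]] := cA (u @ U) (fmap_ultra u) FA.
by exists l.
Qed.

Lemma bounded_ultralimit (u : nat -> R) (b : R) : (forall k, `|u k| <= b) ->
  cvg (u @ U).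
Proof.
move=> ub; have [k|l _ ul] := compact_ultralimit (u := u) (@segment_compact R (- b) b).
  by rewrite /= in_itv/= -ler_norml.
by apply/cvg_ex; exists l.
Qed.

(** Along an ultrafilter every bounded sequence converges, so one limit is defined for all test
    functions simultaneously and inherits linearity and positivity. *)
Lemma ultralimit_averaging (T : topologicalType) (J : nat -> (T -> R) -> R) :
  (forall k, averaging (J k)) -> averaging (fun g => lim (J k g @[k --> U])).
Proof.
have PU : ProperFilter U by exact: ultra_proper.
move=> EJ.
have cJ g : bcont g -> cvg (J k g @[k --> U]).
  move=> bg; have [B gB] := bg.2.
  apply: (@bounded_ultralimit _ B) => k.
  apply: (le_trans (le_norm_averaging (EJ k) bg)).
  exact: (averaging_le (EJ k) (bcont_norm bg)).
split.
- move=> a f g bf bg.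
  have -> : (fun k => J k (fun x => a * f x + g x)) = (fun k => a * J k f + J k g).
    by apply/funext => k; have [-> ] := EJ k.
  apply/cvg_lim => //; apply: cvgD; last exact: cJ.
  by apply: cvgMl_tmp; exact: cJ.
- move=> g bg g0; apply: limr_ge; first exact: cJ.
  by apply: filterE => k; exact: (averaging_ge0 (EJ k)).
- have -> : (fun k => J k (fun=> 1)) = (fun=> 1) by apply/funext => k; have [] := EJ k.
  by apply/cvg_lim => //; exact: cvg_cst.
Qed.

End ultralimits.

Lemma mean_continuous (R : realType) (T : ptopologicalType) (g : T -> R) : bcont g ->
  continuous (fun mu : borel_prob T R => mean mu g).
Proof.
move=> [cg [B gB]]; apply/continuousP => V oV.
have gb : bounded_fun g.
  exists B; split; first exact: num_real.
  by move=> y By x _; exact: le_trans (gB x) (ltW By).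
exists [set (fun mu : borel_prob T R => mean mu g) @^-1` V]; last by rewrite bigcup_set1.
by move=> _ ->; apply: (@finI_from1 _ _ _ _ (g, V)).
Qed.

Section sup_distance.
Context (R : realType) (n : nat) (M : closed_riemannian_manifold R n).
Implicit Types f g h : homeo M.

Definition hdist f g : R := sup [set rdist (f x) (g x) | x in [set: M]].

Lemma rdist_le_hdist f g x : rdist (f x) (g x) <= hdist f g.
Proof.
have [D _ HD] := @rdist_bounded R n M.
apply: ub_le_sup; last by exists x.
by exists D => _ [y _ <-]; exact: HD.
Qed.

Lemma hdist_le f g (c : R) : (forall x, rdist (f x) (g x) <= c) -> hdist f g <= c.
Proof.
move=> fg; apply: ge_sup; first by exists (rdist (f point) (g point)), point.
by move=> _ [y _ <-]; exact: fg.
Qed.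

Lemma hdist_continuous f : continuous (hdist f).
Proof.
move=> g; apply/(@cvgrPdist_le _ _ _ (nbhs g) (nbhs_filter g)) => e e0.
apply/nbhs_homeo; exists e => // h gh.
have H (a b : homeo M) : (forall x, rdist (a x) (b x) <= e) -> hdist f a <= hdist f b + e.
  move=> ab; apply: hdist_le => x.
  apply: (le_trans (rdist_triangle (b x) _ _)).
  by apply: lerD; [exact: rdist_le_hdist|rewrite rdistC].
rewrite ler_norml lerBlDl lerBrDr addrC -lerBrDr opprK.
apply/andP; split.
  by apply: H => x; rewrite rdistC ltW.
by apply: H => x; exact: ltW.
Qed.

(** A continuous stand-in for the indicator of a ball, to which weak-* convergence applies. *)
Definition hbump (d : R) f g : R := Num.max 0 (1 - hdist f g / d).

Lemma hbump_ge0 d f g : 0 <= hbump d f g.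
Proof. by rewrite le_max lexx. Qed.

Lemma hbump_le1 d f g : 0 < d -> hbump d f g <= 1.
Proof.
move=> d0; rewrite ge_max ler01/= gerBl divr_ge0 ?(ltW d0)//.
exact: le_trans (rdist_ge0 _ _) (rdist_le_hdist f g point).
Qed.

Lemma bcont_hbump d f : 0 < d -> bcont (hbump d f).
Proof.
move=> d0; apply: bcont_pos; apply: bcontB; first exact: bcont_cst.
split.
  move=> g; apply: (@cvgMr_tmp _ _ _ (nbhs_filter g) _ _ d^-1).
  exact: hdist_continuous.
have [D _ HD] := @rdist_bounded R n M.
exists (D / d) => g; rewrite ger0_norm.
  by rewrite ler_pM2r ?invr_gt0// hdist_le.
rewrite divr_ge0 ?(ltW d0)//.
exact: le_trans (rdist_ge0 _ _) (rdist_le_hdist f g point).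
Qed.

Lemma hbump_gt0 d f g x : 0 < d -> 0 < hbump d f g -> rdist (f x) (g x) < d.
Proof.
move=> d0; rewrite lt_max ltxx/= subr_gt0 ltr_pdivrMr// mul1r.
exact: le_lt_trans (rdist_le_hdist f g x).
Qed.

Lemma mean_hbump_gt0 (mu : borel_prob (homeo M) R) d f : 0 < d -> msupport mu f ->
  0 < mean mu (hbump d f).
Proof.
move=> d0 sf.
pose O := hball f (d / 2).
have d20 : 0 < d / 2 by rewrite divr_gt0.
have mO : measurable (O : set (borel (homeo M))) by apply: open_borel; exact: open_hball.
have O0 : (0 < mu O)%E.
  apply: sf; first exact: open_hball.
  by apply: mem_hball => x; rewrite rdistxx divr_gt0.
rewrite -lte_fin -meanE; last exact: bcont_hbump.
(* On the ball of radius [d / 2] the bump is at least one half. *)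
have h : (\int[mu]_(g in O) (2^-1)%:E <= \int[mu]_g (hbump d f g)%:E)%E.
  rewrite integral_mkcond; apply: ge0_le_integral_nomeas => g _.
    by rewrite patchE; case: ifP => // _; rewrite lee_fin.
  rewrite patchE; case: ifPn => [/set_mem Og|_]; last by rewrite lee_fin hbump_ge0.
  have hd : hdist f g <= d / 2 by apply: hdist_le => x; rewrite ltW// (hball_sub x Og).
  rewrite lee_fin le_max; apply/orP; right.
  have : hdist f g / d <= 2^-1 by rewrite ler_pdivrMr// mulrC.
  by move: (_ / d) => u; lra.
apply: lt_le_trans h; rewrite integral_cst//.
by rewrite mule_gt0// lte_fin.
Qed.

End sup_distance.

(** * From the moment of the bi-Lipschitz constant to test functions *)

Section moments.
Context (R : realType) (n : nat) (M : closed_riemannian_manifold R n).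
Variable alpha : R.
Hypothesis alpha0 : 0 < alpha.
Implicit Types (f : homeo M) (x y : M).

Lemma Lip_log_distortion f : Lip M f -> exists2 X : R, log_distortion f X &
  ((X `^ alpha)%:E <= poweR (lne (frakL f)) alpha)%E.
Proof.
move=> [C HC].
(* On a one-point manifold the suprema in [frakL] are over the empty set; [X = 0] works there. *)
have [[p x0]|sub] := pselect (exists p : M * M, p.1 <> p.2); last first.
  have xE x y : x = y by apply: contrapT => xy; apply: sub; exists (x, y).
  exists 0; last by rewrite powR0 ?gt_eqF// poweR_ge0.
  by split=> // x y; rewrite (xE y x) !rdistxx expR0 mulr0.
have gt0 x y : x <> y -> 0 < rdist x y.
  by move=> xy; rewrite lt0r rdist_ge0 andbT; apply/eqP => /rdist_eq0.
have injf x y : x <> y -> f x <> f y by move=> xy /(can_inj (homeoK f)).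
have ub (h : M -> M) : (forall x y, rdist (h x) (h y) <= C * rdist x y) -> (best_lip h <= C%:E)%E.
  move=> hC; apply: ge_ereal_sup => _ [q /= qxy <-].
  by rewrite lee_fin ler_pdivrMr ?gt0.
have lb (h : M -> M) x y : x <> y -> ((rdist (h x) (h y) / rdist x y)%:E <= best_lip h)%E.
  by move=> xy; apply: ereal_sup_ubound; exists (x, y).
have LC : (frakL f <= C%:E)%E.
  by rewrite /frakL ge_max !ub// => x y; case: (HC x y).
(* The quotient of [f] at a pair and that of its inverse at the image pair are reciprocal, so one of
   them is at least 1; this gives [0 <= ln L]. *)
have L1 : (1%:E <= frakL f)%E.
  have h1 := lb f p.1 p.2 x0; have h2 := lb (homeo_inv f) _ _ (injf _ _ x0).
  rewrite !homeoK in h2; rewrite /frakL le_max.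
  have [le1|gt1] := leP 1 (rdist (f p.1) (f p.2) / rdist p.1 p.2).
    by rewrite (le_trans _ h1)// lee_fin.
  rewrite (le_trans _ h2) ?orbT// lee_fin ler_pdivlMr; last exact: gt0 (injf _ _ x0).
  rewrite mul1r; move: gt1; rewrite ltr_pdivrMr; last exact: gt0.
  by rewrite mul1r; exact: ltW.
have Lfin : frakL f \is a fin_num.
  by rewrite fin_numElt (lt_le_trans _ L1) ?ltNyr// (le_lt_trans LC) ?ltry.
have [L LE] : exists L : R, frakL f = L%:E by exists (fine (frakL f)); rewrite fineK.
rewrite LE lee_fin in L1; have L0 : 0 < L by exact: lt_le_trans L1.
have lipL x y : rdist (f x) (f y) <= L * rdist x y.
  have [->|/eqP xy] := eqVneq x y; first by rewrite !rdistxx mulr0.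
  rewrite -ler_pdivrMr; last exact: gt0.
  rewrite -lee_fin -LE (le_trans (lb f _ _ xy))//.
  by rewrite /frakL le_max lexx.
have lipL' x y : rdist x y <= L * rdist (f x) (f y).
  have [->|/eqP xy] := eqVneq x y; first by rewrite !rdistxx mulr0.
  have fxy := injf _ _ xy.
  rewrite -ler_pdivrMr; last exact: gt0.
  rewrite -lee_fin -LE.
  have := lb (homeo_inv f) _ _ fxy; rewrite !homeoK => /le_trans; apply.
  by rewrite /frakL le_max lexx orbT.
exists (ln L).
  by split=> [|x y]; [rewrite ln_ge0|rewrite lnK ?posrE].
by rewrite LE /lne (leNgt L 0) L0.
Qed.

(** Neither [Lip M] nor [frakL] is shown to be measurable, so the mean is moved to the support and
    compared with the moment integral by monotonicity alone. This requires a nonnegative integrand,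
    hence the positive part of [h - a]. *)
Lemma log_moment_mean (mu : borel_prob (homeo M) R) (C0 : R) : msupport mu `<=` Lip M ->
  (\int[mu]_(f in Lip M) poweR (lne (frakL f)) alpha < C0%:E)%E ->
  log_moment alpha (mean mu) C0.
Proof.
move=> muL muC h a b bh b0 hb.
have Emu := mean_averaging mu.
have bk : bcont (fun f => Num.max 0 (h f - a)).
  by apply: bcont_pos; apply: bcontB => //; exact: bcont_cst.
suff : mean mu (fun f => Num.max 0 (h f - a)) <= b * C0.
  move=> le; rewrite -lerBlDl; apply: le_trans le.
  rewrite -{1}(averaging_cst Emu a) -(averagingB Emu bh (bcont_cst a)).
  apply: (le_averaging Emu) bk _; first by apply: bcontB => //; exact: bcont_cst.
  by move=> f; rewrite le_max lexx orbT.
have k0 f : 0 <= Num.max 0 (h f - a) by rewrite le_max lexx.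
have suppb f : msupport mu f -> exists2 X : R, Num.max 0 (h f - a) <= b * X `^ alpha &
    ((X `^ alpha)%:E <= poweR (lne (frakL f)) alpha)%E.
  move=> /muL/Lip_log_distortion[X fX XL]; exists X => //.
  by rewrite ge_max mulr_ge0 ?powR_ge0//= lerBlDl hb.
move: b0; rewrite le_eqVlt => /predU1P[b0|b0].
  rewrite -b0 mul0r -lee_fin mean_msupport//.
  rewrite integral_mkcond -[leRHS](integral0 mu setT); apply: ge0_le_integral_nomeas => f _.
    by rewrite patchE; case: ifP => // _; rewrite lee_fin.
  rewrite patchE; case: ifPn => // /set_mem/suppb[X].
  by rewrite -b0 mul0r lee_fin.
rewrite -ler_pdivrMl// -(averagingZ Emu _ bk) -lee_fin mean_msupport; last 2 first.
  exact: bcontZ.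
  by move=> f; rewrite mulr_ge0// invr_ge0 ltW.
apply: (le_trans _ (ltW muC)).
rewrite integral_mkcond [leRHS]integral_mkcond; apply: ge0_le_integral_nomeas => f _.
  by rewrite patchE; case: ifP => // _; rewrite lee_fin mulr_ge0// invr_ge0 ltW.
rewrite !patchE; case: ifPn => [/set_mem sf|_]; last by case: ifP => // _; exact: poweR_ge0.
rewrite mem_set; last exact: muL.
have [X kX XL] := suppb f sf; apply: le_trans XL.
by rewrite lee_fin ler_pdivrMl.
Qed.

End moments.

(** * Limits of steps that hardly contract the energy *)

Section contraction.
Context (R : realType) (n : nat) (M : closed_riemannian_manifold R n).
Variables (alpha B : R) (net : nat -> seq M).
Hypotheses (alpha0 : 0 < alpha) (B0 : 0 <= B).
Hypothesis net_size : forall j, (0 < size (net j))%N.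
Hypothesis net_le : forall j, (size (net j))%:R <= expR (n%:R * j%:R + B).
Hypothesis net_cover : forall j z, exists2 w, w \in net j & rdist z w <= expR (- j%:R) / 2.
Implicit Types (f h : homeo M) (g : M -> R).

Section near_equality.
Variables (c : R) (m : nat -> nat) (J : nat -> (M -> R) -> R).
Variables (mu : nat -> borel_prob (homeo M) R) (mu0 : borel_prob (homeo M) R).
Variables (U : set_system nat) (UU : UltraFilter U).
Hypotheses (subU : \oo `<=` U) (muU : mu @ U --> mu0).
Hypotheses (c0 : 0 <= c) (EJ : forall k, averaging (J k)).
Hypothesis mom : forall k, log_moment alpha (mean (mu k)) c.
Let E k := energy alpha net (m k) (J k).
Let P k := mean (mu k).
Hypothesis E_ge : forall k, k.+1%:R / 2 <= E k.
Hypothesis conv_ge : forall k,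
  (1 - k.+1%:R^-1) * E k <= energy alpha net (m k) (conv_mean (P k) (J k)).

Let PU : ProperFilter U. Proof. exact: ultra_proper. Qed.
Let E_gt0 k : 0 < E k. Proof. by apply: lt_le_trans (E_ge k); rewrite divr_gt0. Qed.
Let Theta k g := density alpha net (m k) (J k) g / E k.
Let atom k g := atomic_density alpha net (m k) (conv_mean (P k) (J k)) g / E k.
Let ETheta k : averaging (Theta k). Proof. exact: (density_averaging alpha0 net_cover (EJ k) (E_gt0 k)). Qed.
Let EP k : averaging (P k). Proof. exact: mean_averaging. Qed.

Let bcont_gap k g : continuous g -> bcont (fun h => `|Theta k (g \o h) - atom k g|).
Proof.
move=> cg; apply: bcont_norm; apply: bcontB; last exact: bcont_cst.
exact: bcont_push (ETheta k) (bcont_continuous cg).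
Qed.

(** [concentration] divided by [E k]: the constant is absorbed because [E k] is at least
    [k.+1%:R / 2], and the energy loss is at most [E k / k.+1%:R]. *)
Let mean_gap_small g (e : R) : continuous g -> 0 < e ->
  \forall k \near U, P k (fun h => `|Theta k (g \o h) - atom k g|) <= e.
Proof.
move=> cg e0; have e20 : 0 < e / 2 by rewrite divr_gt0.
have [C [C' [C_ge0 C'0 HC]]] := concentration alpha0 B0 net_size net_le net_cover cg e20.
pose A := 2 * (C * (1 + c)) + C'.
have near1 : \forall k \near U, A / (e / 2) <= k%:R by apply: subU; exact: nbhs_infty_ger.
apply: filterS near1 => k kA.
have Ek := E_gt0 k; have k1 : 0 < k.+1%:R :> R by [].
have -> : P k (fun h => `|Theta k (g \o h) - atom k g|) = (E k)^-1 *
   P k (fun h => `|density alpha net (m k) (J k) (g \o h) -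
      atomic_density alpha net (m k) (conv_mean (P k) (J k)) g|).
  rewrite -(averagingZ (EP k)); last first.
    apply: bcont_norm; apply: bcontB; last exact: bcont_cst.
    exact: bcont_density_push.
  congr (P k _); apply/funext => h; rewrite /Theta /atom -mulrBl normrM mulrC.
  by rewrite [in X in X * _]ger0_norm// invr_ge0 ltW.
rewrite ler_pdivrMl//; apply: (le_trans (HC _ _ _ _ (EP k) (EJ k) c0 (mom k) Ek)).
rewrite -/(E k); set D := (X in C' * X).
have h1 : D <= k.+1%:R^-1 * E k.
  by have := conv_ge k; rewrite /D mulrBl mul1r lerBlDl lerBlDr addrC.
have h2 := ler_wpM2l C'0 h1.
have h3 : C * (1 + c) <= 2 * (C * (1 + c)) / k.+1%:R * E k.
  have h := ler_wpM2l (mulr_ge0 C_ge0 (addr_ge0 ler01 c0)) (E_ge k).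
  have h' : 0 <= 2 / k.+1%:R :> R by rewrite divr_ge0.
  have := ler_wpM2l h' h; move: (C * (1 + c)) (E k) => X F.
  have -> : 2 / k.+1%:R * (X * (k.+1%:R / 2)) = X by field; rewrite lt0r_neq0.
  by have -> : 2 * X / k.+1%:R * F = 2 / k.+1%:R * (X * F) by ring.
have h4 : A / k.+1%:R <= e / 2.
  rewrite ler_pdivrMr// mulrC -ler_pdivrMr//; apply: (le_trans kA).
  by rewrite ler_nat.
have := ler_wpM2r (ltW Ek) h4; rewrite /A.
move: h2 h3.
by clearbody D; move: (E k) (C * (1 + c)) (k.+1%:R^-1) => F X s; lra.
Qed.

(** Smallness on average becomes smallness at [f]. Since [f] lies in the support of the limit, the
    homeomorphisms near [f] keep a mass bounded below for [U]-most [k], and by [push_equicontinuous]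
    their gaps are close to the gap at [f]. *)
Let near_atom f g (e : R) : msupport mu0 f -> continuous g -> 0 < e ->
  \forall k \near U, `|Theta k (g \o f) - atom k g| <= e.
Proof.
move=> sf cg e0; have e20 : 0 < e / 2 by rewrite divr_gt0.
have [d d0 Hd] := push_equicontinuous cg e20.
have bu := bcont_hbump f d0.
have p0 := mean_hbump_gt0 d0 sf; set p := mean mu0 (hbump d f) in p0.
have p20 : 0 < p / 2 by rewrite divr_gt0.
have near1 : \forall k \near U, p / 2 <= P k (hbump d f).
  apply: (@cvgr_ge _ _ U _ (fun k => P k (hbump d f)) p); last by rewrite ltr_pdivrMr// mulr_natr mulr2n ltrDl.
  by have := @mean_continuous _ _ _ bu mu0; exact: cvg_comp muU.
have near2 := mean_gap_small cg (mulr_gt0 e20 p20).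
apply: filterS2 near1 near2 => k pk gapk.
set a := `|_ - _|.
have bgap := bcont_gap k cg.
(* The gap at [f] is at most [e / 2] plus the gap at [h] for each [h] close to [f]; this is
   multiplied by the bump, which vanishes for other [h], and averaged. *)
have key : P k (hbump d f) * a <= e / 2 * P k (hbump d f) + e / 2 * (p / 2).
  rewrite -(averagingZr (EP k) _ bu) -(averagingZ (EP k) _ bu).
  apply: le_trans (lerD (lexx _) gapk).
  rewrite -(averagingD (EP k) (bcontZ _ bu) bgap).
  apply: (le_averaging (EP k)).
  - have := bcontZ a bu; congr bcont; apply/funext => h; exact: mulrC.
  - by apply: bcontD => //; exact: bcontZ.
  move=> h; have := hbump_ge0 d f h; rewrite le_eqVlt => /predU1P[<-|u0].
    by rewrite mul0r mulr0 add0r.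
  have := Hd _ f h (ETheta k) (fun x => hbump_gt0 x d0 u0) => close.
  have tri : a <= e / 2 + `|Theta k (g \o h) - atom k g|.
    apply: (le_trans (ler_distD (Theta k (g \o h)) _ _)).
    by rewrite lerD2r.
  apply: (le_trans (ler_wpM2l (ltW u0) tri)); rewrite mulrDr mulrC lerD2l.
  by rewrite ler_piMl// hbump_le1.
have := le_trans key (lerD (lexx _) (ler_wpM2l (ltW e20) pk)).
rewrite -mulrDl -splitr mulrC ler_pM2r//.
exact: lt_le_trans pk.
Qed.

Lemma near_equality_transport : exists m1 m2 : borel_prob M R,
  {ae mu0, forall f, forall A : set (borel M), measurable A -> m1 (f @^-1` A) = m2 A}.
Proof.
pose I g := lim (Theta k g @[k --> U]).
have EI : averaging I by exact: (ultralimit_averaging ETheta).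
have cT g : continuous g -> Theta k g @[k --> U] --> I g.
  move=> /bcont_continuous bg; have [b gb] := bg.2.
  apply: (@bounded_ultralimit _ _ _ _ b) => k.
  apply: (le_trans (le_norm_averaging (ETheta k) bg)).
  exact: (averaging_le (ETheta k) (bcont_norm bg)).
(* Both values are limits of quantities close to [atom k g], which does not involve [f]. *)
have eqI f f' g : msupport mu0 f -> msupport mu0 f' -> continuous g -> I (g \o f) = I (g \o f').
  move=> sf sf' cg; apply/eqP; rewrite -subr_eq0 -normr_le0.
  apply/ler_addgt0Pr => e e0; rewrite add0r.
  have e20 : 0 < e / 2 by rewrite divr_gt0.
  have cv : `|Theta k (g \o f) - Theta k (g \o f')| @[k --> U] --> `|I (g \o f) - I (g \o f')|.
    by apply: cvg_norm; apply: cvgB; apply: cT; exact: homeo_comp_continuous.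
  rewrite -(cvg_lim (@Rhausdorff R) cv); apply: limr_le; first by apply/cvg_ex; exists `|I (g \o f) - I (g \o f')|.
  apply: filterS2 (near_atom sf cg e20) (near_atom sf' cg e20) => k h1 h2.
  apply: (le_trans (ler_distD (atom k g) _ _)); rewrite [leRHS]splitr; apply: lerD => //.
  by rewrite distrC.
have [f0 sf0] : msupport mu0 !=set0.
  apply: contrapT => /nonemptyPn s0; have := msupportC0 mu0.
  by rewrite s0 setC0 probability_setT => /eqP; rewrite onee_eq0.
have [m1 [m2 H]] := transport_measures EI (push_averaging f0 EI).
exists m1, m2; exists (~` msupport mu0); split.
- by apply: open_borel; exact: open_msupportC.
- exact: msupportC0.
- move=> f /= nf sf; apply: nf; apply: H => g cg; exact: eqI.
Qed.

End near_equality.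

Lemma energy_contraction (K : set (borel_prob (homeo M) R)) (c : R) : compact K -> 0 <= c ->
  (forall mu, K mu -> log_moment alpha (mean mu) c) ->
  (forall mu, K mu -> ~ exists m1 m2 : borel_prob M R,
    {ae mu, forall f, forall A : set (borel M), measurable A -> m1 (f @^-1` A) = m2 A}) ->
  exists lam C : R, [/\ 0 < lam, lam < 1, 0 <= C & forall mu m J, K mu -> averaging J ->
    energy alpha net m (conv_mean (mean mu) J) <= lam * energy alpha net m J + C].
Proof.
move=> cK c0 mom nK.
have [C1 C10 H1] := mean_energy_push_le alpha0 B0 net_size net_le net_cover ltr01.
apply: contrapT => ncontr.
(* The failing pairs are lam = 1 - 1 / (k + 2), positive already at [k = 0], and a constant
   exceeding the additive term of [mean_energy_push_le] by [k + 2]. *)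
have wit (k : nat) : exists t : borel_prob (homeo M) R * nat * ((M -> R) -> R),
   [/\ K t.1.1, averaging t.2 & (1 - k.+2%:R^-1) * energy alpha net t.1.2 t.2 + (C1 * (1 + c) + k.+2%:R)
     < energy alpha net t.1.2 (conv_mean (mean t.1.1) t.2)].
  apply: contrapT => nt; apply: ncontr.
  exists (1 - k.+2%:R^-1), (C1 * (1 + c) + k.+2%:R); split.
  - by rewrite subr_gt0 invf_lt1// ltr1n.
  - by rewrite gtrBl invr_gt0.
  - by rewrite addr_ge0// mulr_ge0// addr_ge0.
  - move=> mu m J Kmu EJ; rewrite leNgt; apply/negP => lt.
    by apply: nt; exists (mu, m, J).
have [t Ht] := choice wit.
pose mu k := (t k).1.1; pose m k := (t k).1.2; pose J k := (t k).2.
have Kmu k : K (mu k) by case: (Ht k).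
have EJ k : averaging (J k) by case: (Ht k).
have big k : (1 - k.+2%:R^-1) * energy alpha net (m k) (J k) + (C1 * (1 + c) + k.+2%:R)
     < energy alpha net (m k) (conv_mean (mean (mu k)) (J k)) by case: (Ht k).
have [U [UU subU]] := ultraFilterLemma (F := \oo) _.
have [mu0 Kmu0 muU] := compact_ultralimit (U := U) cK Kmu.
apply: (nK mu0 Kmu0).
have E0 k : 0 <= energy alpha net (m k) (J k) by exact: energy_ge0.
apply: (near_equality_transport UU subU muU c0 EJ (m := m)).
- by move=> k; exact: mom.
- move=> k.
  (* One step at most doubles the energy up to [C1 * (1 + c)], so the excess [k + 2] in [big] must
     come from the energy before the step. *)
  have h2 := energy_conv_le alpha0 net_cover (m k) (mean_averaging (mu k)) (EJ k).
  have h1 := H1 (m k) (mean (mu k)) (J k) c (mean_averaging (mu k)) (EJ k) (mom _ (Kmu k)).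
  have h3 : 0 <= (1 - k.+2%:R^-1) * energy alpha net (m k) (J k).
    by rewrite mulr_ge0// subr_ge0 invf_le1// ler1n.
  have := lt_le_trans (big k) (le_trans h2 h1); move: h3.
  rewrite -[k.+2]addn1 natrD.
  move: ((1 - (k.+1 + 1)%:R^-1) * energy alpha net (m k) (J k)) (energy alpha net (m k) (J k)).
  by move: k.+1%:R (C1 * (1 + c)) => a b d e; lra.
- move=> k; apply: le_trans (ltW (big k)).
  apply: ler_wpDr; first by rewrite addr_ge0// mulr_ge0// addr_ge0.
  by rewrite ler_wpM2r// lerD2l lerN2 lef_pV2 ?posrE// ler_nat.
Qed.

End contraction.

(** * Iteration of the contraction and truncation at scale r *)

Section iterated_energy.
Context (R : realType) (n : nat) (M : closed_riemannian_manifold R n).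
Variables (alpha : R) (net : nat -> seq M) (K : set (borel_prob (homeo M) R)) (lam C : R) (m : nat).
Hypotheses (lam0 : 0 < lam) (lam1 : lam < 1) (C_ge0 : 0 <= C).
Hypothesis contr : forall mu J, K mu -> averaging J ->
  energy alpha net m (conv_mean (mean mu) J) <= lam * energy alpha net m J + C.

(** [C / (1 - lam)] is the fixed point of the affine map in [contr]. *)
Lemma energy_iter_mean (mu : nat -> borel_prob (homeo M) R) J k :
  (forall i, (1 <= i <= k)%N -> K (mu i)) -> averaging J ->
  energy alpha net m (iter_mean mu J k) <= lam ^+ k * energy alpha net m J + C / (1 - lam).
Proof.
move=> Kmu EJ; have l1 : 0 < 1 - lam by rewrite subr_gt0.
elim: k Kmu => [_|k IH Kmu] /=; first by rewrite expr0 mul1r lerDl divr_ge0// ltW.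
apply: (le_trans (contr _ _)).
- by apply: Kmu; rewrite /= ltnSn.
- exact: iter_mean_averaging.
have Kk : forall i, (1 <= i <= k)%N -> K (mu i).
  by move=> i /andP[i1 ik]; apply: Kmu; rewrite i1 ltnW.
have := ler_wpM2l (ltW lam0) (IH Kk); rewrite exprS mulrDr mulrA => h.
have -> : C / (1 - lam) = lam * (C / (1 - lam)) + C by field; rewrite gt_eqF.
by rewrite addrA lerD2r.
Qed.

End iterated_energy.

(** [L] accounts for pairs at distance above 1, where the level is 0 but the logarithm can be as
    large as that of the diameter. For the others, [s <= m%:R] says that the level is truncated no
    earlier than at [expR (- s)]. *)
Lemma log_max_le_level (R : realType) (n : nat) (M : closed_riemannian_manifold R n) :
  exists2 L : R, 0 <= L & forall m (s : R) (x y : M), s <= m%:R -> 0 <= s ->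
    `| ln (Num.max (rdist x y) (expR (- s))) | <= level m x y + L.
Proof.
have [D D0 HD] := @rdist_bounded R n M.
exists (Num.max 0 (ln D)); first by rewrite le_max lexx.
move=> m s x y sm s0; set v := Num.max _ _.
have v0 : 0 < v by rewrite lt_max expR_gt0 orbT.
have L0 : 0 <= Num.max 0 (ln D) by rewrite le_max lexx.
have [v1|v1] := leP v 1.
  rewrite ler0_norm ?ln_le0//; apply: ler_wpDr => //.
  rewrite /level le_max; apply/orP; right; rewrite lerN2 ler_ln ?posrE//.
    by rewrite ge_max !le_max lexx/= ler_expR lerN2 sm orbT.
  by rewrite lt_max expR_gt0 orbT.
rewrite ger0_norm ?ln_ge0 ?(ltW v1)//; apply: ler_wpDl; first exact: level_ge0.
rewrite le_max; apply/orP; right; rewrite ler_ln ?posrE//.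
rewrite /v ge_max HD/=; move: v1; rewrite /v lt_max => /orP[v1|].
  apply: (le_trans _ (HD x y)); apply: (le_trans _ (ltW v1)).
  by rewrite -expR0 ler_expR oppr_le0.
by rewrite -expR0 ltr_expR oppr_gt0 ltNge s0.
Qed.

Lemma energy_kernelC (R : realType) (n : nat) (M : closed_riemannian_manifold R n) alpha net m
  (x y : M) : energy_kernel alpha net m x y = energy_kernel (M := M) alpha net m y x.
Proof.
by apply: eq_bigr => j _; congr (_ * _); apply: eq_bigr => z _; exact: mulrC.
Qed.

Theorem theoremB1p1 (R : realType) (n : nat)
    (M : closed_riemannian_manifold R n)
    (K : set (borel_prob (homeo M) R)) (alpha C0 : R) :
  compact K ->
  (forall mu, K mu -> msupport mu `<=` Lip M) ->
  0 < alpha ->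
  (forall mu, K mu ->
    (\int[mu]_(f in Lip M) poweR (lne (frakL f)) alpha < C0%:E)%E) ->
  (forall mu, K mu ->
    ~ exists m1 m2 : borel_prob M R,
        {ae mu, forall f : homeo M,
          forall A : set (borel M), measurable A -> m1 (f @^-1` A) = m2 A}) ->
  exists C kappa : R, 1 < kappa /\
    forall (nu01 nu02 : borel_prob M R) (n1 n2 : nat)
      (mu1 mu2 : nat -> borel_prob (homeo M) R),
      (forall i, (1 <= i <= n1)%N -> K (mu1 i)) ->
      (forall i, (1 <= i <= n2)%N -> K (mu2 i)) ->
      let r := expR (- kappa ^+ minn n1 n2) in
      let nu1 := iter_convol mu1 nu01 n1 in
      let nu2 := iter_convol mu2 nu02 n2 in
      (\int[nu2]_y \int[nu1]_x
          (`| ln (Num.max (rdist x y) r) | `^ alpha)%:E < C%:E)%E.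
Proof.
move=> cK sK alpha0 momK nK.
have [B B0 /choice[net Hnet]] := @exponential_nets R n M.
have net_size j : (0 < size (net j))%N by case: (Hnet j).
have net_le j : (size (net j))%:R <= expR (n%:R * j%:R + B) by case: (Hnet j).
have net_cover j z : exists2 w, w \in net j & rdist z w <= expR (- j%:R) / 2 by case: (Hnet j).
(* [C0] may be negative if [K] is empty. *)
have c0 : 0 <= Num.max 0 C0 by rewrite le_max lexx.
have [mu Kmu|lam [C1 [lam0 lam1 C10 contr]]] :=
    energy_contraction alpha0 B0 net_size net_le net_cover cK c0 _ nK.
  apply: (log_moment_mean alpha0 (sK _ Kmu)); apply: (lt_le_trans (momK _ Kmu)).
  by rewrite lee_fin le_max lexx orbT.
have [C2 C20 HC2] := energy_kernel_level alpha0 B0 net_size net_le net_cover (@ltr01 R).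
have [L L0 HL] := @log_max_le_level R n M.
(* Solves kappa^alpha lam = 1 for [kappa = expR t]. *)
pose t := - ln lam / alpha.
have t0 : 0 < t by rewrite divr_gt0// oppr_gt0 ln_lt0// lam0.
pose S := 2 `^ alpha + C1 / (1 - lam).
pose A := (1 + 1) `^ alpha * (1 + 1).
pose A' := (1 + 1) `^ alpha * C2 + (1 + 1^-1) `^ alpha * L `^ alpha.
exists (A * S + A' + 1), (expR t); split; first by rewrite -expR0 ltr_expR.
move=> nu01 nu02 n1 n2 mu1 mu2 K1 K2; cbv zeta.
set N := minn n1 n2; set s := expR t ^+ N.
have s1 : 1 <= s by rewrite exprn_ege1// -expR0 ler_expR ltW.
have s0 : 0 <= s by exact: le_trans s1.
have sa : s `^ alpha = lam ^- N.
  rewrite /s -expRM_natl -expRM.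
  have -> : N%:R * t * alpha = - (N%:R * ln lam) by rewrite /t; field; rewrite gt_eqF.
  by rewrite expRN expRM_natl lnK.
(* The first integer above [s]: the kernel then resolves the scale [expR (- s)], and [m] is at most
   [2 * s], whence the power of 2 in [S]. *)
pose m := (Num.truncn s).+1.
have /andP[ms sm] := truncn_itv s0; rewrite -/m in sm.
have m2s : m%:R <= 2 * s.
  by rewrite /m -addn1 natrD (mulr_natl s 2) mulr2n lerD.
have mN k : (N <= k)%N -> lam ^+ k * m%:R `^ alpha <= 2 `^ alpha.
  move=> Nk; have ma : m%:R `^ alpha <= 2 `^ alpha * s `^ alpha.
    by rewrite -powRM//; apply: ge0_ler_powR => //; rewrite ?nnegrE ?mulr_ge0// ltW.
  apply: (le_trans (ler_wpM2l (exprn_ge0 k (ltW lam0)) ma)).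
  rewrite mulrCA ler_piMr ?powR_ge0// sa ler_pdivrMr ?exprn_gt0// mul1r.
  by apply: ler_wiXn2l => //; exact: ltW.
have en mu nu k : (forall i, (1 <= i <= k)%N -> K (mu i)) -> (N <= k)%N ->
    energy alpha net m (iter_mean mu (mean nu) k) <= S.
  move=> Kmu Nk; have Enu := mean_averaging nu.
  apply: (le_trans (energy_iter_mean lam0 lam1 C10 (fun mu J => contr mu m J) Kmu Enu)).
  rewrite lerD2r; apply: (le_trans _ (mN k Nk)).
  by rewrite ler_wpM2l ?exprn_ge0 ?(ltW lam0)// energy_le.
have [Q1 [-> HQ1]] := iter_convol_probability mu1 nu01 n1.
have [Q2 [-> HQ2]] := iter_convol_probability mu2 nu02 n2.
(* The mean of [Q] and the iterated functional agree on continuous functions, and the energy only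
   evaluates them at the features. *)
have eQ (Q : borel_prob M R) J : (forall g : M -> R, continuous g -> mean Q g = J g) ->
    energy alpha net m (mean Q) = energy alpha net m J.
  move=> QJ; apply: eq_bigr => j _; congr (_ * _); apply: eq_bigr => z _.
  by rewrite QJ//; exact: (bcont_feature alpha net_cover j z).1.
have EQ1 := mean_averaging Q1; have EQ2 := mean_averaging Q2.
have bU := bcont_potential alpha net_cover m EQ1.
have ptw x y : `|ln (Num.max (rdist x y) (expR (- s)))| `^ alpha <= A * energy_kernel alpha net m y x + A'.
  have h1 := HL m s x y (ltW sm) s0.
  have [_ h2] := HC2 m x y; rewrite energy_kernelC in h2.
  apply: (@le_trans _ _ ((level m x y + L) `^ alpha)).
    by apply: ge0_ler_powR => //; rewrite ?nnegrE ?addr_ge0 ?level_ge0// ltW.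
  apply: (le_trans (powR_add_le (ltW alpha0) ltr01 (level_ge0 m x y) L0)).
  rewrite /A /A' addrA lerD2r -mulrA -mulrDr ler_wpM2l ?powR_ge0//.
have A0 : 0 <= A by rewrite mulr_ge0 ?powR_ge0.
have inner y : (\int[Q1]_x (`|ln (Num.max (rdist x y) (expR (- s)))| `^ alpha)%:E <=
    (A * potential alpha net m (mean Q1) y + A')%:E)%E.
  have bK := bcont_energy_kernel alpha net_cover m y.
  have bKA : bcont (fun x => A * energy_kernel alpha net m y x + A').
    by apply: bcontD; [exact: bcontZ|exact: bcont_cst].
  have -> : A * potential alpha net m (mean Q1) y + A' =
      mean Q1 (fun x => A * energy_kernel alpha net m y x + A').
    rewrite (averagingD EQ1 (bcontZ _ bK) (bcont_cst _)) (averagingZ EQ1 _ bK).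
    by rewrite (averaging_cst EQ1).
  rewrite -meanE//; apply: ge0_le_integral_nomeas => x _.
    by rewrite lee_fin powR_ge0.
  by rewrite lee_fin.
have bUA : bcont (fun y => A * potential alpha net m (mean Q1) y + A').
  by apply: bcontD; [exact: bcontZ|exact: bcont_cst].
apply: (@le_lt_trans _ _ (mean Q2 (fun y => A * potential alpha net m (mean Q1) y + A'))%:E).
  rewrite -meanE//; apply: ge0_le_integral_nomeas => y _ //.
  by apply: integral_ge0 => x _; rewrite lee_fin powR_ge0.
rewrite (averagingD EQ2 (bcontZ _ bU) (bcont_cst _)) (averagingZ EQ2 _ bU) (averaging_cst EQ2).
rewrite -correlationE// lte_fin (@le_lt_trans _ _ (A * S + A'))// ?ltrDl//.
rewrite lerD2r ler_wpM2l//; apply: (le_trans (correlation_le net alpha0 m _ _)).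
rewrite (eQ Q1 _ HQ1) (eQ Q2 _ HQ2) ler_pdivrMl// mulr_natl mulr2n.
by apply: lerD; apply: en; rewrite // /N ?geq_minl ?geq_minr.
Qed.
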